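(* Suppose that $\sigma:X\to X$ and $\tau:Y\to Y$ are homeomorphisms of second-countable compact Hausdorff spaces. The following are equivalent: (1) $G(X,\sigma)$ and $G(Y,\tau)$ are isomorphic (as topological groupoids); (2) $C(X)\times_\sigma\mathbb{Z}\cong C(Y)\times_\tau\mathbb{Z}$ via an isomorphism that maps $C(X)$ to $C(Y)$; (3) there exist decompositions $X=X_1\sqcup X_2$ and $Y=Y_1\sqcup Y_2$ into disjoint open invariant sets such that $\sigma|_{X_1}$ is conjugate to $\tau|_{Y_1}$ and $\sigma|_{X_2}$ is conjugate to $\tau^{-1}|_{Y_2}$. If $\sigma$ and $\tau$ are topologically transitive or $X$ and $Y$ are connected, then these conditions hold if and only if $\sigma$ and $\tau$ are flip-conjugate.
   Context: $G(X,\sigma)=\bigcup_{n,m\in\mathbb{N}}\{(x,n-m,y)\in X\times\{n-m\}\times X:\sigma^n(x)=\sigma^m(y)\}$ is the Deaconu–Renault groupoid, with $(x,p,y)(y,q,z)=(x,p+q,z)$, $(x,p,y)^{-1}=(y,-p,x)$ and basic open sets $\{(x,n-m,y):x\in U,y\in V,\sigma^n(x)=\sigma^m(y)\}$ for $U,V\subseteq X$ open; since $\sigma$ is a homeomorphism, $(x,n,y)\mapsto(x,n)$ identifies it with the transformation groupoid of the $\mathbb{Z}$-action generated by $\sigma$. $C(X)\times_\sigma\mathbb{Z}$ is the crossed product $C^*$-algebra, containing $C(X)$ canonically. The sets in the decompositions in (3) may be empty. $\sigma$ and $\tau$ are flip conjugate if there is a homeomorphism $h:X\to Y$ such that either $h\circ\sigma=\tau\circ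 h$ or $h\circ\sigma=\tau^{-1}\circ h$. *)

(* Defs.v *)
From HB Require Import structures.
From mathcomp Require Import all_boot all_order all_algebra.
From mathcomp Require Import complex zify.
From mathcomp Require Import all_classical all_reals all_analysis.

Set Implicit Arguments.
Unset Strict Implicit.
Unset Printing Implicit Defensive.
Import Order.TTheory GRing.Theory Num.Theory.
Import numFieldNormedType.Exports.
Local Open Scope classical_set_scope.
Local Open Scope ring_scope.

Record homeo (X Y : topologicalType) := Homeo {
  homeo_fun :> X -> Y;
  homeo_inv : Y -> X;
  homeo_funK : cancel homeo_fun homeo_inv;
  homeo_invK : cancel homeo_inv homeo_fun;
  homeo_fun_cts : continuous homeo_fun;
  homeo_inv_cts : continuous homeo_inv }.
Arguments homeo_fun_cts {X Y} h : rename.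
Arguments homeo_inv_cts {X Y} h : rename.

Definition int_iter (X : topologicalType) (s : homeo X X) (n : int) : X -> X :=
  match n with
  | Posz k => iter k s
  | Negz k => iter k.+1 (homeo_inv s)
  end.

(* Transitivity of the action of the group of integers: n may be negative. *)
Definition topologically_transitive (X : topologicalType) (s : homeo X X) :=
  forall U V : set X, open U -> open V -> U !=set0 -> V !=set0 ->
    exists n : int, (int_iter s n @` U) `&` V !=set0.

Definition flip_conjugate (X Y : topologicalType)
    (s : homeo X X) (t : homeo Y Y) :=
  exists h : homeo X Y,
    (h \o s =1 t \o h) \/ (h \o s =1 homeo_inv t \o h).

Definition invariant (X : topologicalType) (s : homeo X X) (A : set X) :=
  s @` A = A.

Lemma invariant_fun (X : topologicalType) (s : homeo X X) (A : set X) :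
  invariant s A -> forall x, x \in A -> s x \in A.
Proof. by move=> sA x /set_mem Ax; apply/mem_set; rewrite -sA; exists x. Qed.

Lemma invariant_inv (X : topologicalType) (s : homeo X X) (A : set X) :
  invariant s A -> forall x, x \in A -> homeo_inv s x \in A.
Proof.
move=> sA x /set_mem; rewrite -{1}sA => -[y Ay <-].
by rewrite homeo_funK; exact: mem_set.
Qed.

Definition restriction (X : Type) (A : set X) (f : X -> X)
    (fA : forall x, x \in A -> f x \in A) : set_type A -> set_type A :=
  fun x => exist _ (f (val x)) (fA _ (valP x)).

Definition conjugate (X Y : topologicalType) (f : X -> X) (g : Y -> Y) :=
  exists h : homeo X Y, h \o f =1 g \o h.

Definition piecewise_flip_conjugate (X Y : topologicalType)
    (s : homeo X X) (t : homeo Y Y) :=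
  exists (X1 X2 : set X) (Y1 Y2 : set Y)
    (sX1 : invariant s X1) (sX2 : invariant s X2)
    (tY1 : invariant t Y1) (tY2 : invariant t Y2),
    [/\ open X1, open X2, X1 `|` X2 = setT & X1 `&` X2 = set0] /\
    [/\ open Y1, open Y2, Y1 `|` Y2 = setT & Y1 `&` Y2 = set0] /\
    conjugate (restriction (invariant_fun sX1))
              (restriction (invariant_fun tY1)) /\
    conjugate (restriction (invariant_fun sX2))
              (restriction (invariant_inv tY2)).

(* The triple (x, p, y) with range x, degree p and source y. *)
Record DRgroupoid (X : topologicalType) (s : X -> X) := DRarrow {
  dr_rng : X;
  dr_deg : int;
  dr_src : X;
  dr_axiom : exists n m : nat,
    dr_deg = n%:Z - m%:Z /\ iter n s dr_rng = iter m s dr_src }.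

Section DRgroupoid_theory.
Variables (X : topologicalType) (s : X -> X).
Local Notation G := (DRgroupoid s).
Implicit Types g h : G.

Fact dr_mul_subproof g h : dr_src g = dr_rng h ->
  exists n m : nat, dr_deg g + dr_deg h = n%:Z - m%:Z /\
    iter n s (dr_rng g) = iter m s (dr_src h).
Proof.
case: g h => [x p y [n [m [dp e]]]] [y' q z [n' [m' [dq e']]]] /= yy'.
exists (n' + n)%N, (m + m')%N; split; first by lia.
by rewrite iterD e yy' -iterD addnC iterD e' -iterD.
Qed.

Definition dr_mul g h (gh : dr_src g = dr_rng h) : G :=
  DRarrow (dr_mul_subproof gh).

Fact dr_inv_subproof g : exists n m : nat, - dr_deg g = n%:Z - m%:Z /\
    iter n s (dr_src g) = iter m s (dr_rng g).
Proof.
by case: g => [x p y [n [m [dp e]]]] /=; exists m, n; rewrite dp opprB e.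
Qed.

Definition dr_inv g : G := DRarrow (dr_inv_subproof g).

Definition dr_basic (b : set X * set X * (nat * nat)) : set G :=
  [set g | [/\ b.1.1 (dr_rng g), b.1.2 (dr_src g),
    dr_deg g = b.2.1%:Z - b.2.2%:Z &
    iter b.2.1 s (dr_rng g) = iter b.2.2 s (dr_src g)]].

Definition dr_index : set (set X * set X * (nat * nat)) :=
  [set b | open b.1.1 /\ open b.1.2].

Fact dr_basic_cover : \bigcup_(b in dr_index) dr_basic b = setT.
Proof.
apply/seteqP; split=> // g _; have [n [m [e1 e2]]] := dr_axiom g.
by exists (setT, setT, (n, m)) => //; split; exact: openT.
Qed.

Fact dr_basic_join b c g : dr_index b -> dr_index c ->
  dr_basic b g -> dr_basic c g ->
  exists d, [/\ dr_index d, dr_basic d g &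
                dr_basic d `<=` dr_basic b `&` dr_basic c].
Proof.
wlog bc : b c / (b.2.1 <= c.2.1)%N => [hw|].
  have [/hw//|/ltnW/hw h] := leqP b.2.1 c.2.1.
  move=> Db Dc bg cg; have [d [Dd dg dbc]] := h Dc Db cg bg.
  by exists d; split=> //; rewrite setIC.
case: b c bc => [[U V] [n m]] [[U' V'] [n' m']] /= nn' [/= oU oV] [/= oU' oV'].
move=> [/= Ug Vg dg eg] [/= U'g V'g d'g e'g].
exists (U `&` U', V `&` V', (n, m)); split=> //.
- by split; exact: openI.
- move=> h [/= [Uh U'h] [Vh V'h] dh eh]; split; split => //=.
    by rewrite dh -dg.
  rewrite -(subnK nn') iterD eh -iterD; congr (iter _ s _); lia.
Qed.

HB.instance Definition _ := gen_eqMixin G.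
HB.instance Definition _ := gen_choiceMixin G.
HB.instance Definition _ :=
  isBaseTopological.Build G dr_basic_cover dr_basic_join.

End DRgroupoid_theory.

Definition DRgroupoid_isomorphic (X Y : topologicalType)
    (s : X -> X) (t : Y -> Y) :=
  exists phi : homeo (DRgroupoid s) (DRgroupoid t),
    (forall g h : DRgroupoid s,
       dr_src g = dr_rng h <-> dr_src (phi g) = dr_rng (phi h)) /\
    (forall (g h : DRgroupoid s) (gh : dr_src g = dr_rng h)
       (pgh : dr_src (phi g) = dr_rng (phi h)),
       phi (dr_mul gh) = dr_mul pgh) /\
    (forall g : DRgroupoid s, phi (dr_inv g) = dr_inv (phi g)).

(* The zero algebra must be allowed (it is C(X) for empty X).  MathComp's
   [GRing.Algebra] imposes 1 != 0, hence a separate hierarchy, whose ring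
   structure is exported as a [pzRingType]. *)
HB.mixin Record isStarAlgebra (K : numClosedFieldType) A & GRing.Lmodule K A := {
  algmul : A -> A -> A;
  algone : A;
  starop : A -> A;
  algmulA : associative algmul;
  algmul1l : left_id algone algmul;
  algmul1r : right_id algone algmul;
  algmulDl : left_distributive algmul +%R;
  algmulDr : right_distributive algmul +%R;
  algscaleAl : forall (k : K) (a b : A), k *: algmul a b = algmul (k *: a) b;
  algscaleAr : forall (k : K) (a b : A), k *: algmul a b = algmul a (k *: b);
  staropK : involutive starop;
  staropD : {morph starop : a b / a + b};
  staropZ : forall (k : K) (a : A), starop (k *: a) = k^* *: starop a;
  staropM : forall a b : A, starop (algmul a b) = algmul (starop b) (starop a) }.

#[short(type="starAlgType")]
HB.structure Definition StarAlgebra (K : numClosedFieldType) :=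
  {A of GRing.Lmodule K A & isStarAlgebra K A}.

HB.instance Definition _ (K : numClosedFieldType) (A : starAlgType K) :=
  GRing.Zmodule_isPzRing.Build A
    algmulA algmul1l algmul1r algmulDl algmulDr.

HB.mixin Record isCstarAlgebra (K : numClosedFieldType) A
    & StarAlgebra K A & CompleteNormedModule K A := {
  cstar_normM : forall a b : A, `|algmul a b| <= `|a| * `|b|;
  cstar_identity : forall a : A, `|algmul (starop a) a| = `|a| ^+ 2 }.

#[short(type="cstarAlgType")]
HB.structure Definition CstarAlgebra (K : numClosedFieldType) :=
  {A of StarAlgebra K A & CompleteNormedModule K A & isCstarAlgebra K A}.

HB.instance Definition _ (K : numClosedFieldType) (A : cstarAlgType K) :=
  GRing.PzRing.copy A (A : starAlgType K).

Record star_morphism (K : numClosedFieldType) (A B : starAlgType K)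
    (f : A -> B) : Prop := StarMorphism {
  star_morphD : {morph f : a b / a + b};
  star_morphZ : forall k : K, {morph f : a / k *: a};
  star_morphM : {morph f : a b / a * b};
  star_morph1 : f 1 = 1;
  star_morph_star : {morph f : a / starop a} }.

Definition unitary (K : numClosedFieldType) (A : starAlgType K) (u : A) :=
  starop u * u = 1 /\ u * starop u = 1.

Definition contfun (K : numClosedFieldType) (X : topologicalType) :=
  continuousType X K^o.

Section contfun.
Variables (K : numClosedFieldType) (X : topologicalType).
Local Notation CX := (contfun K X).
Implicit Types f g : CX.

HB.instance Definition _ := Choice.on CX.

Definition mk_contfun (f : X -> K^o) (cf : continuous f) : CX := mkcts cf.

Lemma contfunP f g : f =1 g -> f = g.
Proof. by move=> fg; apply/continuousEP. Qed.

Fact contfun_cst_subproof (k : K) : continuous (fun _ : X => k : K^o).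
Proof. by move=> x; exact: cst_continuous. Qed.

Fact contfun_opp_subproof f : continuous (fun x => - f x).
Proof. by move=> x; apply: continuousN; exact: cts_fun. Qed.

Fact contfun_add_subproof f g : continuous (fun x => f x + g x).
Proof. by move=> x; apply: continuousD; exact: cts_fun. Qed.

Fact contfun_mul_subproof f g : continuous (fun x => (f x * g x : K^o)).
Proof. by move=> x; apply: (@continuousM K X f g); exact: cts_fun. Qed.

Fact contfun_conj_subproof f : continuous (fun x => ((f x : K)^* : K^o)).
Proof.
move=> x; apply/(@cvgrPdist_lt _ K^o) => e e0.
have /(@cvgrPdist_lt _ K^o) /(_ e e0) := @cts_fun _ _ f x.
by apply: filterS => y; rewrite -rmorphB norm_conjC.
Qed.

Let cst k := mk_contfun (@contfun_cst_subproof k).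
Definition contfun_opp f := mk_contfun (@contfun_opp_subproof f).
Definition contfun_add f g := mk_contfun (@contfun_add_subproof f g).
Definition contfun_mul f g := mk_contfun (@contfun_mul_subproof f g).
Definition contfun_scale k f := contfun_mul (cst k) f.
Definition contfun_conj f := mk_contfun (@contfun_conj_subproof f).

Fact contfun_addA : associative contfun_add.
Proof. by move=> f g h; apply: contfunP => x; exact: addrA. Qed.
Fact contfun_addC : commutative contfun_add.
Proof. by move=> f g; apply: contfunP => x; exact: addrC. Qed.
Fact contfun_add0 : left_id (cst 0) contfun_add.
Proof. by move=> f; apply: contfunP => x; exact: add0r. Qed.
Fact contfun_addN : left_inverse (cst 0) contfun_opp contfun_add.
Proof. by move=> f; apply: contfunP => x; exact: addNr. Qed.

HB.instance Definition _ := GRing.isZmodule.Build CX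
  contfun_addA contfun_addC contfun_add0 contfun_addN.

Fact contfun_mulA : associative contfun_mul.
Proof. by move=> f g h; apply: contfunP => x; exact: mulrA. Qed.
Fact contfun_mul1 : left_id (cst 1) contfun_mul.
Proof. by move=> f; apply: contfunP => x; exact: mul1r. Qed.
Fact contfun_mulr1 : right_id (cst 1) contfun_mul.
Proof. by move=> f; apply: contfunP => x; exact: mulr1. Qed.
Fact contfun_mulDl : left_distributive contfun_mul +%R.
Proof. by move=> f g h; apply: contfunP => x; exact: mulrDl. Qed.
Fact contfun_mulDr : right_distributive contfun_mul +%R.
Proof. by move=> f g h; apply: contfunP => x; exact: mulrDr. Qed.

Fact contfun_scaleA k l f :
  contfun_scale k (contfun_scale l f) = contfun_scale (k * l) f.
Proof. by apply: contfunP => x; exact: mulrA. Qed.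
Fact contfun_scale1 : left_id 1 contfun_scale.
Proof. by move=> f; apply: contfunP => x; exact: mul1r. Qed.
Fact contfun_scaleDr : right_distributive contfun_scale +%R.
Proof. by move=> k f g; apply: contfunP => x; exact: mulrDr. Qed.
Fact contfun_scaleDl f : {morph contfun_scale^~ f : k l / k + l}.
Proof. by move=> k l; apply: contfunP => x; exact: mulrDl. Qed.

HB.instance Definition _ := GRing.Zmodule_isLmodule.Build K CX
  contfun_scaleA contfun_scale1 contfun_scaleDr contfun_scaleDl.

Fact contfun_scalerAl (k : K) f g :
  k *: contfun_mul f g = contfun_mul (k *: f) g.
Proof. by apply: contfunP => x; exact: mulrA. Qed.
Fact contfun_scalerAr (k : K) f g :
  k *: contfun_mul f g = contfun_mul f (k *: g).
Proof. by apply: contfunP => x; exact: mulrCA. Qed.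
Fact contfun_conjK : involutive contfun_conj.
Proof. by move=> f; apply: contfunP => x; exact: conjCK. Qed.
Fact contfun_conjD : {morph contfun_conj : f g / f + g}.
Proof. by move=> f g; apply: contfunP => x; exact: rmorphD. Qed.
Fact contfun_conjZ (k : K) f : contfun_conj (k *: f) = k^* *: contfun_conj f.
Proof. by apply: contfunP => x; exact: rmorphM. Qed.
Fact contfun_conjM f g : 
  contfun_conj (contfun_mul f g) = contfun_mul (contfun_conj g) (contfun_conj f).
Proof. by apply: contfunP => x; rewrite /= [RHS]mulrC; exact: rmorphM. Qed.

HB.instance Definition _ := isStarAlgebra.Build K CX
  contfun_mulA contfun_mul1 contfun_mulr1 contfun_mulDl contfun_mulDr
  contfun_scalerAl contfun_scalerAr contfun_conjK contfun_conjD contfun_conjZ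
  contfun_conjM.

End contfun.

Section contfun_comp.
Variables (K : numClosedFieldType) (X Y : topologicalType).

Fact contfun_pull_subproof (f : contfun K Y) (h : homeo X Y) :
  continuous (f \o h).
Proof.
move=> x; apply: continuous_comp; first exact: homeo_fun_cts.
exact: cts_fun.
Qed.

Definition contfun_pull (f : contfun K Y) (h : homeo X Y) : contfun K X :=
  mk_contfun (@contfun_pull_subproof f h).

End contfun_comp.

Definition homeo_sym (X Y : topologicalType) (h : homeo X Y) : homeo Y X :=
  Homeo (homeo_invK h) (homeo_funK h) (homeo_inv_cts h) (homeo_fun_cts h).

(* The automorphism of C(X) attached to s is f |-> f \o s^-1. *)
Definition covariant (K : numClosedFieldType) (X : topologicalType)
    (s : homeo X X) (A : starAlgType K) (i : contfun K X -> A) (u : A) : Prop :=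
  [/\ star_morphism i, unitary u &
      forall f : contfun K X,
        u * i f * starop u = i (contfun_pull f (homeo_sym s))].

(* Universal property of the full crossed product: as C(X) and the group of
   integers are unital, resp. discrete, A is the universal unital C*-algebra
   generated by a copy i of C(X) and a unitary u implementing s.  The triple
   (A, i, u) is determined up to a unique isomorphism. *)
Definition is_crossed_product (K : numClosedFieldType) (X : topologicalType)
    (s : homeo X X) (A : cstarAlgType K) (i : contfun K X -> A) (u : A) : Prop :=
  covariant s i u /\
  forall (B : cstarAlgType K) (j : contfun K X -> B) (v : B),
    covariant s j v ->
    exists! L : A -> B, [/\ star_morphism L, L \o i = j & L u = v].

Definition crossed_products_isomorphic (K : numClosedFieldType)
    (X Y : topologicalType) (s : homeo X X) (t : homeo Y Y) :=
  exists (A : cstarAlgType K) (i : contfun K X -> A) (u : A)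
         (B : cstarAlgType K) (j : contfun K Y -> B) (v : B),
    [/\ is_crossed_product s i u, is_crossed_product t j v &
        exists Phi : A -> B,
          [/\ star_morphism Phi, bijective Phi & Phi @` range i = range j]].

(* Main.v *)
(* All conditions are compared with a fourth one: there are a homeomorphism
   h from X to Y and a clopen tau-invariant set P such that h sigma h^-1 is tau
   on P and tau^-1 off P ([twist_conjugate]).  This condition yields a groupoid
   isomorphism by reversing degrees off P, and an isomorphism of crossed
   products by replacing the canonical unitary v by chi v + (1 - chi) v^*, where
   chi is the indicator function of P.

   A groupoid isomorphism amounts to a homeomorphism of the unit spaces with
   locally constant cocycles c(x, .) and c'(x, .), mutually inverse bijections
   of the integers ([cocycle_equivalent]).  By compactness their increments are
   bounded, so c(x, .) tends to +oo on one side and to -oo on the other; this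
   dichotomy defines P, and moving x along its orbit by Boyle's counting
   function [drift] straightens the orbit equivalence into a conjugacy.

   An isomorphism of crossed products respecting the function algebras is, by
   Gelfand duality, a single algebra A with two crossed product structures
   (i, u) and (i, u') over the same function algebra.  The powers of u' are
   normalizers of i(C(X)).  A normalizer w which moves y as u^n does gives a loop
   t |-> psi y t (w u^-n) of complex numbers of modulus 1, where psi y t are
   states living over the isotropy of y, and exactly one such n makes its winding
   number vanish.  This degree is multiplicative in w and locally constant in y,
   which produces the cocycles.  The states come from the construction of the
   crossed product as the completion of the skew Laurent polynomials in their
   largest C*-seminorm, which dominates every state. *)

From HB Require Import structures.
From mathcomp Require Import all_boot all_order all_algebra.
From mathcomp Require Import complex zify ring lra.
From mathcomp Require Import all_classical all_reals all_analysis.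
Require Import Defs.

Set Implicit Arguments.
Unset Strict Implicit.
Unset Printing Implicit Defensive.
Import Order.TTheory GRing.Theory Num.Theory.
Import numFieldNormedType.Exports.
Local Open Scope classical_set_scope.
Local Open Scope complex_scope.
Local Open Scope ring_scope.

(** The actions need not be free, and this shapes the argument. At a periodic point the way a
    normalizer moves the point does not determine its degree. The isotropy there is infinite cyclic
    with a circle as dual, and the loop on this circle supplies the missing integer. The states over
    the isotropy do not vary continuously with the point. At points fixed by the motion of a
    normalizer, however, their Fejer means are finite sums of Fourier coefficients. These are
    continuous, and the means converge uniformly. The degree is therefore locally constant. The
    degrees for [u] and [u'] invert each other because degree 0 means the same for both structures.

    In the dynamical half, the drift solves [drift x - drift (s x) = c x 1 - 1]: the cocycle [c]
    differs from the tautological one by a coboundary, and moving [x] by [drift x] steps of [s']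
    intertwines [s] and [s'].

    States take the place of Hilbert space representations: the supremum of their GNS seminorms is
    again a C*-seminorm, so each state is bounded by the largest one. *)

(** * Real-valued norms over the complex numbers *)

Section real_norm.
Variable R : realType.
Local Notation K := R[i].

(** Norms over [R[i]] take their values in [R[i]]. The real part brings them back to [R], where
    suprema and limits of reals are available; [rnorm] does the same for vectors. *)
Definition cabs (k : K) : R := complex.Re `|k|.

Lemma cabsE k : `|k| = (cabs k)%:C.
Proof. by rewrite RRe_real // normr_real. Qed.

Lemma cabs_ge0 k : 0 <= cabs k.
Proof. by rewrite -ler0c -cabsE. Qed.

Definition rnorm (V : normedModType K) (x : V) : R := complex.Re `|x|.

Section normed.
Variable V : normedModType K.
Implicit Types x y : V.

Lemma rnormE x : `|x| = (rnorm x)%:C.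
Proof. by rewrite RRe_real // normr_real. Qed.

Lemma rnorm_ge0 x : 0 <= rnorm x.
Proof. by rewrite -ler0c -rnormE. Qed.

Lemma rnormD x y : rnorm (x + y) <= rnorm x + rnorm y.
Proof. by rewrite -lecR rmorphD /= -!rnormE; exact: ler_normD. Qed.

Lemma rnormZ k x : rnorm (k *: x) = cabs k * rnorm x.
Proof. by apply: complexI; rewrite rmorphM /= -!rnormE -cabsE normrZ. Qed.

Lemma rnormN x : rnorm (- x) = rnorm x.
Proof. by rewrite /rnorm normrN. Qed.

Lemma rnormB x y : rnorm (x - y) = rnorm (y - x).
Proof. by rewrite -rnormN opprB. Qed.

Lemma rnorm0_eq0 x : rnorm x = 0 -> x = 0.
Proof. by move=> x0; apply/normr0_eq0; rewrite rnormE x0. Qed.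

Lemma rnorm0 : rnorm (0 : V) = 0.
Proof. by rewrite /rnorm normr0. Qed.

Lemma rnorm_small x : (forall e, 0 < e -> rnorm x <= e) -> x = 0.
Proof.
move=> h; apply: rnorm0_eq0; apply/eqP; rewrite eq_le rnorm_ge0 andbT.
by apply/ler_addgt0Pl => e /h; rewrite addr0.
Qed.

Lemma cvg_rnorm (T : Type) (F : set_system T) {FF : Filter F} (f : T -> V) y :
  f @ F --> y <-> forall e : R, 0 < e -> \forall t \near F, rnorm (y - f t) <= e.
Proof.
split=> [/cvgrPdist_le h e e0|h].
  by have := h e%:C; rewrite ltcR => /(_ e0); apply: filterS => t;
    rewrite rnormE lecR.
apply/cvgrPdist_le => e e0.
have eR : (complex.Re e)%:C = e by rewrite RRe_real // gtr0_real.
have := h (complex.Re e); rewrite -ltcR eR => /(_ e0).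
by apply: filterS => t; rewrite rnormE -eR lecR.
Qed.

End normed.

(** A bare function [d] is allowed, so that the notion applies to a seminorm on an algebra that
    carries no topology. *)
Definition cauchy_on (T : Type) (d : T -> T -> R) (a : nat -> T) :=
  forall e, 0 < e -> exists N, forall m n, (N <= m)%N -> (N <= n)%N ->
    d (a m) (a n) <= e.

Lemma cauchy_cvgn (V : completeNormedModType K) (a : nat -> V) :
  cauchy_on (fun x y => rnorm (x - y)) a -> cvgn a.
Proof.
move=> ca; apply: cauchy_cvg; apply/cauchy_ballP => e e0.
have eR : (complex.Re e)%:C = e by rewrite RRe_real // gtr0_real.
have e0' : 0 < complex.Re e / 2 by rewrite divr_gt0 // -ltcR eR.
have [N hN] := ca _ e0'.
near_simpl; exists ([set n | (N <= n)%N], [set n | (N <= n)%N]).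
  by split; exists N.
move=> [m n] /= [Nm Nn]; rewrite -ball_normE /= rnormE -eR ltcR.
apply: le_lt_trans (hN _ _ Nm Nn) _.
by rewrite ltr_pdivrMr // ltr_pMr ?ltr1n // -ltcR eR.
Qed.

Lemma cauchy_cvgnR (a : nat -> R) :
  cauchy_on (fun x y => `|x - y|) a -> cvgn a.
Proof.
move=> ca; apply: cauchy_cvg; apply/cauchy_ballP => e e0.
have [N hN] := ca (e / 2) ltac:(by rewrite divr_gt0).
near_simpl; exists ([set n | (N <= n)%N], [set n | (N <= n)%N]).
  by split; exists N.
move=> [m n] /= [Nm Nn]; rewrite -ball_normE /=.
by apply: le_lt_trans (hN _ _ Nm Nn) _; rewrite ltr_pdivrMr // ltr_pMr ?ltr1n.
Qed.

End real_norm.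

Section cabs_theory.
Variable R : realType.
Local Notation K := R[i].
Implicit Types k l : K.

Lemma cabsM k l : cabs (k * l) = cabs k * cabs l.
Proof. by apply: complexI; rewrite rmorphM /= -!cabsE normrM. Qed.

Lemma cabs_sqr k : ((cabs k) ^+ 2)%:C = k * k^*.
Proof. by rewrite rmorphXn /= -cabsE; exact: sqr_normc. Qed.

Lemma cabs_conj k : cabs k^* = cabs k.
Proof. by apply: complexI; rewrite -!cabsE norm_conjC. Qed.

Lemma cabsD k l : cabs (k + l) <= cabs k + cabs l.
Proof. by rewrite -lecR rmorphD /= -!cabsE ler_normD. Qed.

Lemma cabs_Re k : complex.Re k <= cabs k.
Proof.
apply: le_trans (ler_norm _) _; rewrite -lecR -cabsE; exact: normc_ge_Re.
Qed.

Lemma cabs_real (r : R) : 0 <= r -> cabs r%:C = r.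
Proof. by move=> r0; apply: complexI; rewrite -cabsE ger0_norm // ler0c. Qed.

End cabs_theory.

(** * Star algebras and C*-seminorms *)

Section star_algebra.
Variables (K : numClosedFieldType) (A : starAlgType K).
Implicit Types a b : A.

Lemma star_mul a b : starop (a * b) = starop b * starop a.
Proof. exact: staropM. Qed.

Lemma star1 : starop (1 : A) = 1.
Proof. by have := star_mul (starop 1) 1; rewrite mulr1 staropK mulr1. Qed.

Lemma starD a b : starop (a + b) = starop a + starop b.
Proof. exact: staropD. Qed.

Lemma star0 : starop (0 : A) = 0.
Proof. by apply: (addIr (starop 0)); rewrite -starD !add0r. Qed.

Lemma starN a : starop (- a) = - starop a.
Proof. by apply: (addIr (starop a)); rewrite -starD !addNr star0. Qed.

Lemma starB a b : starop (a - b) = starop a - starop b.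
Proof. by rewrite starD starN. Qed.

Lemma star_sum (I : Type) (r : seq I) (F : I -> A) :
  starop (\sum_(i <- r) F i) = \sum_(i <- r) starop (F i).
Proof. exact: (big_morph _ starD star0). Qed.

Lemma scaleAl (k : K) a b : k *: (a * b) = (k *: a) * b.
Proof. exact: algscaleAl. Qed.

Lemma scaleAr (k : K) a b : k *: (a * b) = a * (k *: b).
Proof. exact: algscaleAr. Qed.

End star_algebra.

(** Nonnegativity, invariance under [starop] and the bound 1 on unitaries follow from these clauses.
    The zero seminorm qualifies, so [p 1 = 1] cannot be expected. *)
Record cstar_seminorm (R : realType) (A : starAlgType R[i]) (p : A -> R) :
    Prop := CstarSeminorm {
  csnD : forall a b, p (a + b) <= p a + p b;
  csnZ : forall k a, p (k *: a) = cabs k * p a;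
  csnM : forall a b : A, p (a * b) <= p a * p b;
  csn_star : forall a : A, p (starop a * a) = p a ^+ 2 }.

Section seminorm_theory.
Variables (R : realType) (A : starAlgType R[i]) (p : A -> R).
Hypothesis pC : cstar_seminorm p.
Implicit Types a b : A.

Lemma csn0 : p 0 = 0.
Proof. by rewrite -(scale0r (0 : A)) csnZ // /cabs normr0 mul0r. Qed.

Lemma csnN a : p (- a) = p a.
Proof. by rewrite -scaleN1r csnZ // /cabs normrN1 mul1r. Qed.

Lemma csnB a b : p (a - b) = p (b - a).
Proof. by rewrite -csnN opprB. Qed.

Lemma csn_ge0 a : 0 <= p a.
Proof.
have := csnD pC a (- a); rewrite subrr csn0 csnN -mulr2n.
by rewrite pmulrn_lge0.
Qed.

(** From [p b ^+ 2 = p (starop b * b) <= p (starop b) * p b], cancel [p b]; the opposite inequality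
    is the same one for [starop b]. *)
Lemma csn_starE a : p (starop a) = p a.
Proof.
suff h b : p b <= p (starop b).
  by apply/eqP; rewrite eq_le h andbT -{2}(staropK a) h.
have := csnM pC (starop b) b; rewrite csn_star // expr2.
have := csn_ge0 b; rewrite le_eqVlt => /predU1P[<- _|b0]; first exact: csn_ge0.
by rewrite ler_pM2r.
Qed.

(** The C*-identity at 1 reads [p 1 = p 1 ^+ 2]. *)
Lemma csn1 : p 1 <= 1.
Proof.
have := csn_star pC 1; rewrite star1 mul1r => p1.
by rewrite leNgt; apply/negP => h; move: p1; have := h; nra.
Qed.

Lemma csn_unitary (u : A) : unitary u -> p u <= 1.
Proof.
move=> [uu _]; have := csn_star pC u; rewrite uu => h.
by rewrite -(expr_le1 (n := 2)) ?csn_ge0 // -h csn1.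
Qed.

Lemma csn_sum (I : Type) (r : seq I) (F : I -> A) :
  p (\sum_(i <- r) F i) <= \sum_(i <- r) p (F i).
Proof.
elim/big_ind2: _ => [|x y x' y' h h'|//]; first by rewrite csn0.
by apply: le_trans (csnD pC _ _) _; rewrite lerD.
Qed.

Lemma csn_dist a b : `|p a - p b| <= p (a - b).
Proof.
rewrite ler_norml lerBlDr lerNl opprB lerBlDr; apply/andP; split.
  by have := csnD pC (b - a) a; rewrite subrK csnB.
by have := csnD pC (a - b) b; rewrite subrK.
Qed.

End seminorm_theory.

(** * Completion of a C*-seminorm *)

Record cauchy_seq (R : realType) (A : starAlgType R[i]) (p : A -> R)
    (pC : cstar_seminorm p) := CauchySeq {
  cs_fun :> nat -> A;
  cs_cauchy : cauchy_on (fun x y : A => p (x - y)) cs_fun }.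

Section completion.
Variables (R : realType) (A : starAlgType R[i]) (p : A -> R).
Variable pC : cstar_seminorm p.
Local Notation K := R[i].
Local Notation CS := (cauchy_seq pC).
Implicit Types a b c : CS.

Lemma cs_eq a b : a =1 b :> (nat -> A) -> a = b.
Proof.
case: a b => [a ca] [b cb] /= /funext ab; case: _ / ab cb => cb.
by congr CauchySeq; exact: Prop_irrelevance.
Qed.

Lemma cs_bounded a : exists2 M, 0 < M & forall n, p (a n) <= M.
Proof.
have [N hN] := cs_cauchy a ltr01.
exists (1 + \sum_(i < N.+1) p (a i)) => [|n].
  by rewrite ltr_pwDl // sumr_ge0 // => i _; exact: csn_ge0.
have ge (m : nat) : (m <= N)%N -> p (a m) <= \sum_(i < N.+1) p (a i).
  move=> mN; rewrite (bigD1 (inord m)) //= inordK // lerDl.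
  by rewrite sumr_ge0 // => i _; exact: csn_ge0.
have [/ge h|Nn] := leqP n N; first by apply: le_trans h _; rewrite lerDr.
have := csnD pC (a n - a N) (a N); rewrite subrK => /le_trans; apply.
by rewrite lerD ?ge // hN // ltnW.
Qed.

Fact cs_cst_subproof (x : A) : cauchy_on (fun x y : A => p (x - y)) (fun=> x).
Proof. by move=> e e0; exists 0 => m n _ _; rewrite subrr csn0 // ltW. Qed.
Definition cs_cst x : CS := CauchySeq pC (@cs_cst_subproof x).

Fact cs_add_subproof a b : cauchy_on (fun x y : A => p (x - y)) (fun n => a n + b n).
Proof.
move=> e e0; have e2 : 0 < e / 2 by rewrite divr_gt0.
have [N hN] := cs_cauchy a e2; have [M hM] := cs_cauchy b e2.
exists (maxn N M) => m n; rewrite !geq_max => /andP[m1 m2] /andP[n1 n2].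
rewrite opprD addrACA (le_trans (csnD pC _ _)) // (splitr e).
by rewrite lerD ?hN ?hM.
Qed.
Definition cs_add a b : CS := CauchySeq pC (@cs_add_subproof a b).

Fact cs_scale_subproof k a : cauchy_on (fun x y : A => p (x - y)) (fun n => k *: a n).
Proof.
move=> e e0; have k1 : 0 < cabs k + 1 by rewrite ltr_wpDl // cabs_ge0.
have [N hN] := cs_cauchy a (divr_gt0 e0 k1).
exists N => m n /hN h /h; rewrite ler_pdivlMr // => {}h.
rewrite -scalerBr csnZ //; apply: le_trans h; rewrite mulrC.
by rewrite ler_wpM2l ?csn_ge0 // lerDl.
Qed.
Definition cs_scale k a : CS := CauchySeq pC (@cs_scale_subproof k a).
Definition cs_opp a : CS := cs_scale (-1) a.

Fact cs_star_subproof a : cauchy_on (fun x y : A => p (x - y)) (fun n => starop (a n)).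
Proof.
move=> e e0; have [N hN] := cs_cauchy a e0.
by exists N => m n /hN h /h; rewrite -starB csn_starE.
Qed.
Definition cs_star a : CS := CauchySeq pC (@cs_star_subproof a).

Lemma csn_mulB (x y x' y' : A) :
  p (x * y - x' * y') <= p (x - x') * p y + p x' * p (y - y').
Proof.
have -> : x * y - x' * y' = (x - x') * y + x' * (y - y').
  by rewrite mulrBl mulrBr addrA subrK.
by apply: le_trans (csnD pC _ _) _; rewrite lerD // csnM.
Qed.

Fact cs_mul_subproof a b : cauchy_on (fun x y : A => p (x - y)) (fun n => a n * b n).
Proof.
move=> e e0; have [M M0 hM] := cs_bounded a; have [L L0 hL] := cs_bounded b.
have e2 : 0 < e / 2 by rewrite divr_gt0.
have [N hN] := cs_cauchy a (divr_gt0 e2 L0).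
have [N' hN'] := cs_cauchy b (divr_gt0 e2 M0).
exists (maxn N N') => m n; rewrite !geq_max => /andP[m1 m2] /andP[n1 n2].
apply: le_trans (csn_mulB _ _ _ _) _; rewrite [leRHS](splitr e) lerD //.
  have := hN _ _ m1 n1; rewrite ler_pdivlMr // => h; apply: le_trans h.
  by rewrite ler_wpM2l // csn_ge0.
have := hN' _ _ m2 n2; rewrite ler_pdivlMr // mulrC => h; apply: le_trans h.
by rewrite ler_wpM2r // csn_ge0.
Qed.
Definition cs_mul a b : CS := CauchySeq pC (@cs_mul_subproof a b).

Lemma cs_cvg a : cvgn (fun n => p (a n)).
Proof.
apply: cauchy_cvgnR => e e0; have [N hN] := cs_cauchy a e0.
by exists N => m n /hN h /h; apply: le_trans; exact: csn_dist.
Qed.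

Definition cs_norm a : R := limn (fun n => p (a n)).

Lemma cs_norm_cvg a : (fun n => p (a n)) @ \oo --> cs_norm a.
Proof. exact: cs_cvg. Qed.

Lemma cs_norm_eq a l : (fun n => p (a n)) @ \oo --> l -> cs_norm a = l.
Proof. by move=> h; apply/cvg_lim. Qed.

Lemma cs_norm_ge0 a : 0 <= cs_norm a.
Proof.
by apply: limr_ge; [exact: cs_cvg | apply: nearW => n; exact: csn_ge0].
Qed.

Lemma cs_norm_cst x : cs_norm (cs_cst x) = p x.
Proof. by apply: cs_norm_eq; rewrite /=; exact: cvg_cst. Qed.

Lemma cs_normD a b : cs_norm (cs_add a b) <= cs_norm a + cs_norm b.
Proof.
have h : (fun n => p (a n) + p (b n)) @ \oo --> cs_norm a + cs_norm b.
  by apply: cvgD; exact: cs_norm_cvg.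
rewrite -(cvg_lim _ h) //; apply: ler_lim; [exact: cs_cvg | by apply/cvg_ex; exists (cs_norm a + cs_norm b)|].
by apply: nearW => n; exact: csnD.
Qed.

Lemma cs_normZ k a : cs_norm (cs_scale k a) = cabs k * cs_norm a.
Proof.
apply: cs_norm_eq; under eq_fun do rewrite /= csnZ //.
by apply: cvgMr; exact: cs_norm_cvg.
Qed.

Lemma cs_normM a b : cs_norm (cs_mul a b) <= cs_norm a * cs_norm b.
Proof.
have h : (fun n => p (a n) * p (b n)) @ \oo --> cs_norm a * cs_norm b.
  by apply: cvgM; exact: cs_norm_cvg.
rewrite -(cvg_lim _ h) //; apply: ler_lim; [exact: cs_cvg | by apply/cvg_ex; exists (cs_norm a * cs_norm b)|].
by apply: nearW => n; exact: csnM.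
Qed.

Lemma cs_norm_star a : cs_norm (cs_star a) = cs_norm a.
Proof.
apply: cs_norm_eq; under eq_fun do rewrite /= csn_starE //.
exact: cs_norm_cvg.
Qed.

Lemma cs_norm_starM a : cs_norm (cs_mul (cs_star a) a) = cs_norm a ^+ 2.
Proof.
apply: cs_norm_eq; under eq_fun do rewrite /= csn_star //.
by rewrite expr2; under eq_fun do rewrite expr2; apply: cvgM; exact: cs_norm_cvg.
Qed.

Definition cs_sub a b := cs_add a (cs_opp b).
Definition cs_equiv a b := cs_norm (cs_sub a b) == 0.

Lemma cs_equivP a b : reflect (cs_norm (cs_sub a b) = 0) (cs_equiv a b).
Proof. exact: eqP. Qed.

Lemma cs_norm_le0 a b : cs_norm a <= cs_norm b -> cs_norm b = 0 -> cs_norm a = 0.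
Proof. by move=> h b0; apply/eqP; rewrite eq_le cs_norm_ge0 andbT -b0. Qed.

Lemma cabsN1 : cabs (-1 : K) = 1.
Proof. by rewrite /cabs normrN1. Qed.

Lemma cs_equiv_refl : reflexive cs_equiv.
Proof.
move=> a; apply/cs_equivP; apply: cs_norm_eq; rewrite /=.
by under eq_fun do rewrite scaleN1r subrr csn0 //; exact: cvg_cst.
Qed.
Lemma cs_equiv_sym : symmetric cs_equiv.
Proof.
suff h a b : cs_equiv a b -> cs_equiv b a by move=> a b; apply/idP/idP => /h.
move=> /cs_equivP ab; apply/cs_equivP; apply: cs_norm_le0 ab.
have -> : cs_sub b a = cs_scale (-1) (cs_sub a b).
  by apply: cs_eq => n /=; rewrite !scaleN1r opprB.
by rewrite cs_normZ cabsN1 mul1r.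
Qed.
Lemma cs_equiv_trans : transitive cs_equiv.
Proof.
move=> b a c /cs_equivP ab /cs_equivP bc; apply/cs_equivP.
apply/eqP; rewrite eq_le cs_norm_ge0 andbT.
have -> : cs_sub a c = cs_add (cs_sub a b) (cs_sub b c).
  by apply: cs_eq => n /=; rewrite !scaleN1r addrA subrK.
by apply: le_trans (cs_normD _ _) _; rewrite ab bc addr0.
Qed.

HB.instance Definition _ := gen_eqMixin CS.
HB.instance Definition _ := gen_choiceMixin CS.

Canonical cs_equiv_rel :=
  EquivRel cs_equiv cs_equiv_refl cs_equiv_sym cs_equiv_trans.

(** Dividing by null differences also kills the kernel of [p], so that a seminorm yields a normed
    algebra. *)
Definition completion := {eq_quot cs_equiv}%qT.
HB.instance Definition _ := Choice.on completion.
HB.instance Definition _ := Quotient.on completion.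

Local Notation Q := completion.
Local Open Scope quotient_scope.

Lemma cs_equivE a b : cs_norm (cs_sub a b) = 0 -> \pi_Q a = \pi_Q b.
Proof. by move=> h; apply/eqmodP/cs_equivP. Qed.

Lemma cs_piP a b : \pi_Q a = \pi_Q b -> cs_norm (cs_sub a b) = 0.
Proof. by move/eqmodP/cs_equivP. Qed.

Lemma cs_repr a : cs_norm (cs_sub (repr (\pi_Q a)) a) = 0.
Proof. by apply: cs_piP; rewrite reprK. Qed.

Definition compl_add (x y : Q) : Q := \pi_Q (cs_add (repr x) (repr y)).
Definition compl_scale k (x : Q) : Q := \pi_Q (cs_scale k (repr x)).
Definition compl_opp (x : Q) : Q := compl_scale (-1) x.
Definition compl_mul (x y : Q) : Q := \pi_Q (cs_mul (repr x) (repr y)).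
Definition compl_star (x : Q) : Q := \pi_Q (cs_star (repr x)).
Definition compl_norm (x : Q) : R := cs_norm (repr x).
Definition compl_in (x : A) : Q := \pi_Q (cs_cst x).

(** The operations are computed on representatives chosen by [repr]. This lemma and the next four
    say that the choice does not matter. *)
Lemma compl_addE a b : compl_add (\pi_Q a) (\pi_Q b) = \pi_Q (cs_add a b).
Proof.
apply: cs_equivE; apply/eqP; rewrite eq_le cs_norm_ge0 andbT.
set a' := repr _; set b' := repr _.
have -> : cs_sub (cs_add a' b') (cs_add a b) = cs_add (cs_sub a' a) (cs_sub b' b).
  by apply: cs_eq => n /=; rewrite !scaleN1r opprD addrACA.
by apply: le_trans (cs_normD _ _) _; rewrite !cs_repr addr0.
Qed.

Lemma compl_scaleE k a : compl_scale k (\pi_Q a) = \pi_Q (cs_scale k a).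
Proof.
apply: cs_equivE; set a' := repr _.
have -> : cs_sub (cs_scale k a') (cs_scale k a) = cs_scale k (cs_sub a' a).
  by apply: cs_eq => n /=; rewrite !scaleN1r scalerBr.
by rewrite cs_normZ cs_repr mulr0.
Qed.

Lemma compl_mulE a b : compl_mul (\pi_Q a) (\pi_Q b) = \pi_Q (cs_mul a b).
Proof.
apply: cs_equivE; apply/eqP; rewrite eq_le cs_norm_ge0 andbT.
set a' := repr _; set b' := repr _.
have -> : cs_sub (cs_mul a' b') (cs_mul a b) =
    cs_add (cs_mul (cs_sub a' a) b') (cs_mul a (cs_sub b' b)).
  by apply: cs_eq => n /=; rewrite !scaleN1r mulrBl mulrBr addrA subrK.
apply: le_trans (cs_normD _ _) _.
apply: (@le_trans _ _ (0 * cs_norm b' + cs_norm a * 0)).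
  apply: lerD.
    by have := cs_normM (cs_sub a' a) b'; rewrite cs_repr.
  by have := cs_normM a (cs_sub b' b); rewrite cs_repr.
by rewrite mul0r mulr0 addr0.
Qed.

Lemma compl_starE a : compl_star (\pi_Q a) = \pi_Q (cs_star a).
Proof.
apply: cs_equivE; set a' := repr _.
have -> : cs_sub (cs_star a') (cs_star a) = cs_star (cs_sub a' a).
  by apply: cs_eq => n /=; rewrite !scaleN1r starB.
by rewrite cs_norm_star cs_repr.
Qed.

Lemma compl_normE a : compl_norm (\pi_Q a) = cs_norm a.
Proof.
rewrite /compl_norm; set a' := repr _.
have h b c : cs_norm (cs_sub b c) = 0 -> cs_norm b <= cs_norm c.
  move=> bc; have -> : b = cs_add (cs_sub b c) c.
    by apply: cs_eq => n /=; rewrite !scaleN1r subrK.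
  by apply: le_trans (cs_normD _ _) _; rewrite bc add0r.
apply/eqP; rewrite eq_le !h //; apply: cs_piP; rewrite ?reprK //.
Qed.

Fact compl_addA : associative compl_add.
Proof.
elim/quotW => a; elim/quotW => b; elim/quotW => c; rewrite (compl_addE b c) (compl_addE a b) !compl_addE.
by congr (\pi_Q _); apply: cs_eq => n /=; exact: addrA.
Qed.
Fact compl_addC : commutative compl_add.
Proof.
elim/quotW => a; elim/quotW => b; rewrite !compl_addE.
by congr (\pi_Q _); apply: cs_eq => n /=; exact: addrC.
Qed.
Fact compl_add0 : left_id (compl_in 0) compl_add.
Proof.
elim/quotW => a; rewrite !compl_addE.
by congr (\pi_Q _); apply: cs_eq => n /=; exact: add0r.
Qed.
Fact compl_addN : left_inverse (compl_in 0) compl_opp compl_add.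
Proof.
elim/quotW => a; rewrite /compl_opp compl_scaleE !compl_addE.
by congr (\pi_Q _); apply: cs_eq => n /=; rewrite scaleN1r addNr.
Qed.
HB.instance Definition _ := GRing.isZmodule.Build Q
  compl_addA compl_addC compl_add0 compl_addN.

Lemma pi_addE a b : \pi_Q a + \pi_Q b = \pi_Q (cs_add a b).
Proof. exact: compl_addE. Qed.

Fact compl_scaleA k l (x : Q) :
  compl_scale k (compl_scale l x) = compl_scale (k * l) x.
Proof.
elim/quotW: x => a; rewrite (compl_scaleE l) !compl_scaleE.
by congr (\pi_Q _); apply: cs_eq => n /=; exact: scalerA.
Qed.
Fact compl_scale1 : left_id 1 compl_scale.
Proof.
elim/quotW => a; rewrite !compl_scaleE.
by congr (\pi_Q _); apply: cs_eq => n /=; exact: scale1r.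
Qed.
Fact compl_scaleDr : right_distributive compl_scale +%R.
Proof.
move=> k; elim/quotW => a; elim/quotW => b.
rewrite pi_addE !compl_scaleE pi_addE.
by congr (\pi_Q _); apply: cs_eq => n /=; exact: scalerDr.
Qed.
Fact compl_scaleDl (x : Q) : {morph compl_scale^~ x : k l / k + l}.
Proof.
elim/quotW: x => a k l; rewrite !compl_scaleE pi_addE.
by congr (\pi_Q _); apply: cs_eq => n /=; exact: scalerDl.
Qed.
HB.instance Definition _ := GRing.Zmodule_isLmodule.Build K Q
  compl_scaleA compl_scale1 compl_scaleDr compl_scaleDl.

Lemma pi_scaleE k a : k *: \pi_Q a = \pi_Q (cs_scale k a).
Proof. exact: compl_scaleE. Qed.

Fact compl_mulA : associative compl_mul.
Proof.
elim/quotW => a; elim/quotW => b; elim/quotW => c; rewrite (compl_mulE b c) (compl_mulE a b) !compl_mulE.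
by congr (\pi_Q _); apply: cs_eq => n /=; exact: mulrA.
Qed.
Fact compl_mul1 : left_id (compl_in 1) compl_mul.
Proof.
elim/quotW => a; rewrite !compl_mulE.
by congr (\pi_Q _); apply: cs_eq => n /=; exact: mul1r.
Qed.
Fact compl_mulr1 : right_id (compl_in 1) compl_mul.
Proof.
elim/quotW => a; rewrite !compl_mulE.
by congr (\pi_Q _); apply: cs_eq => n /=; exact: mulr1.
Qed.
Fact compl_mulDl : left_distributive compl_mul +%R.
Proof.
elim/quotW => a; elim/quotW => b; elim/quotW => c.
rewrite pi_addE !compl_mulE pi_addE.
by congr (\pi_Q _); apply: cs_eq => n /=; exact: mulrDl.
Qed.
Fact compl_mulDr : right_distributive compl_mul +%R.
Proof.
elim/quotW => a; elim/quotW => b; elim/quotW => c.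
rewrite pi_addE !compl_mulE pi_addE.
by congr (\pi_Q _); apply: cs_eq => n /=; exact: mulrDr.
Qed.
Fact compl_mulZl k (x y : Q) : k *: compl_mul x y = compl_mul (k *: x) y.
Proof.
elim/quotW: x => a; elim/quotW: y => b; rewrite compl_mulE !pi_scaleE compl_mulE.
by congr (\pi_Q _); apply: cs_eq => n /=; exact: scaleAl.
Qed.
Fact compl_mulZr k (x y : Q) : k *: compl_mul x y = compl_mul x (k *: y).
Proof.
elim/quotW: x => a; elim/quotW: y => b; rewrite compl_mulE !pi_scaleE compl_mulE.
by congr (\pi_Q _); apply: cs_eq => n /=; exact: scaleAr.
Qed.
Fact compl_starK : involutive compl_star.
Proof.
elim/quotW => a; rewrite (compl_starE a) compl_starE.
by congr (\pi_Q _); apply: cs_eq => n /=; exact: staropK.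
Qed.
Fact compl_starD : {morph compl_star : x y / x + y}.
Proof.
elim/quotW => a; elim/quotW => b; rewrite pi_addE !compl_starE pi_addE.
by congr (\pi_Q _); apply: cs_eq => n /=; exact: staropD.
Qed.
Fact compl_starZ (k : K) (x : Q) : compl_star (k *: x) = k^* *: compl_star x.
Proof.
elim/quotW: x => a; rewrite pi_scaleE !compl_starE pi_scaleE.
by congr (\pi_Q _); apply: cs_eq => n /=; exact: staropZ.
Qed.
Fact compl_starM (x y : Q) :
  compl_star (compl_mul x y) = compl_mul (compl_star y) (compl_star x).
Proof.
elim/quotW: x => a; elim/quotW: y => b; rewrite compl_mulE !compl_starE compl_mulE.
by congr (\pi_Q _); apply: cs_eq => n /=; exact: staropM.
Qed.
HB.instance Definition _ := isStarAlgebra.Build K Q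
  compl_mulA compl_mul1 compl_mulr1 compl_mulDl compl_mulDr
  compl_mulZl compl_mulZr compl_starK compl_starD compl_starZ compl_starM.

Fact compl_normD (x y : Q) :
  (compl_norm (x + y))%:C <= (compl_norm x)%:C + (compl_norm y)%:C.
Proof.
elim/quotW: x => a; elim/quotW: y => b; rewrite pi_addE !compl_normE.
by rewrite -rmorphD /= lecR cs_normD.
Qed.
Fact compl_normZ (k : K) (x : Q) :
  (compl_norm (k *: x))%:C = `|k| * (compl_norm x)%:C.
Proof.
elim/quotW: x => a; rewrite pi_scaleE !compl_normE cs_normZ.
by rewrite rmorphM /= -cabsE.
Qed.
Fact compl_norm0 (x : Q) : (compl_norm x)%:C = 0 -> x = 0.
Proof.
elim/quotW: x => a; rewrite compl_normE => /complexI a0; apply: cs_equivE.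
rewrite (_ : cs_sub _ _ = a) //.
by apply: cs_eq => n /=; rewrite scaler0 addr0.
Qed.
HB.instance Definition _ := @Lmodule_isNormed.Build K Q
  (fun x => (compl_norm x)%:C) compl_normD compl_normZ compl_norm0.

Lemma rnorm_pi a : rnorm (\pi_Q a) = cs_norm a.
Proof. exact: compl_normE. Qed.

Lemma rnorm_in x : rnorm (compl_in x) = p x.
Proof. by rewrite rnorm_pi cs_norm_cst. Qed.

Lemma compl_inD : {morph compl_in : x y / x + y}.
Proof.
by move=> x y; rewrite pi_addE; congr (\pi_Q _); apply: cs_eq.
Qed.

Lemma compl_inZ k : {morph compl_in : x / k *: x}.
Proof.
by move=> x; rewrite pi_scaleE; congr (\pi_Q _); apply: cs_eq.
Qed.

Lemma compl_inN : {morph compl_in : x / - x}.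
Proof. by move=> x; rewrite -scaleN1r compl_inZ scaleN1r. Qed.

Lemma compl_in_mul (x y : A) : compl_in (x * y) = algmul (compl_in x) (compl_in y).
Proof.
by rewrite [RHS]compl_mulE; congr (\pi_Q _); apply: cs_eq.
Qed.

Lemma compl_in_star x : compl_in (starop x) = starop (compl_in x).
Proof.
by rewrite [RHS]compl_starE; congr (\pi_Q _); apply: cs_eq.
Qed.

Lemma cs_norm_le_near a (M : R) : (\forall n \near \oo, p (a n) <= M) -> cs_norm a <= M.
Proof. by move=> h; apply: limr_le => //; exact: cs_cvg. Qed.

Lemma rnorm_pi_in a y (M : R) :
  (\forall n \near \oo, p (a n - y) <= M) -> rnorm (\pi_Q a - compl_in y) <= M.
Proof.
move=> h; rewrite -compl_inN pi_addE rnorm_pi.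
by apply: cs_norm_le_near; apply: filterS h.
Qed.

Lemma compl_dense (x : Q) e : 0 < e -> exists a : A, rnorm (x - compl_in a) <= e.
Proof.
elim/quotW: x => a e0; have [N hN] := cs_cauchy a e0.
exists (a N); apply: rnorm_pi_in; exists N => // n /= Nn.
by rewrite hN.
Qed.

(** By density, the filter is approximated within [1/(n+1)] by an element [a n] of the original
    algebra. The sequence [a] is Cauchy for [p], hence is itself a point of the completion, and this
    point is the limit. *)
Fact compl_complete (F : set_system Q) : ProperFilter F -> cauchy F -> cvg F.
Proof.
move=> FF /cauchyP cF.
have inv0 n : 0 < (n.+1%:R^-1 : R) by rewrite invr_gt0 ltr0n.
have ha n : {a : A | F [set x | rnorm (x - compl_in a) <= n.+1%:R^-1]}.
  apply: cid; have e2 : 0 < (n.+1%:R^-1 : R) / 2 by rewrite divr_gt0.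
  have e2' : 0 < ((n.+1%:R^-1 : R) / 2)%:C by rewrite ltcR.
  have [x xF] := cF _ e2'; have [a xa] := compl_dense x e2.
  exists a; apply: filterS xF => y; rewrite -ball_normE /= rnormE ltcR => /ltW xy.
  have -> : y - compl_in a = (y - x) + (x - compl_in a) by rewrite addrA subrK.
  by apply: le_trans (rnormD _ _) _; rewrite rnormB (splitr n.+1%:R^-1) lerD.
pose a n := sval (ha n).
have aP n : F [set x | rnorm (x - compl_in (a n)) <= n.+1%:R^-1].
  by rewrite /a; case: (ha n).
have ad m n : p (a m - a n) <= m.+1%:R^-1 + n.+1%:R^-1.
  have [x [xm xn]] := @filter_ex _ _ FF _ (@filterI _ F _ _ _ (aP m) (aP n)).
  rewrite -rnorm_in compl_inD compl_inN.
  have -> : compl_in (a m) - compl_in (a n) =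
     (compl_in (a m) - x) + (x - compl_in (a n)) by rewrite addrA subrK.
  by apply: le_trans (rnormD _ _) _; rewrite rnormB lerD.
have small e : 0 < e -> exists N, forall n, (N <= n)%N -> (n.+1%:R^-1 : R) <= e.
  move=> e0; have [N _ hN] := near_infty_natSinv_lt (PosNum e0).
  by exists N => n /hN /ltW.
have ca : cauchy_on (fun x y : A => p (x - y)) a.
  move=> e e0; have [N hN] := small (e / 2) ltac:(by rewrite divr_gt0).
  exists N => m n Nm Nn; apply: le_trans (ad m n) _.
  by rewrite (splitr e) lerD ?hN.
apply/cvg_ex; exists (\pi_Q (CauchySeq pC ca)).
apply/(@cvg_rnorm R Q Q F _ id) => e e0.
have [N hN] := small (e / 3) ltac:(by rewrite divr_gt0).
apply: filterS (aP N) => y yN.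
have -> : \pi_Q (CauchySeq pC ca) - y =
    (\pi_Q (CauchySeq pC ca) - compl_in (a N)) + (compl_in (a N) - y).
  by rewrite addrA subrK.
apply: le_trans (rnormD _ _) _; rewrite [rnorm (_ - y)]rnormB.
apply: (@le_trans _ _ ((e / 3 + e / 3) + e / 3)); last by lra.
apply: lerD; last by apply: le_trans yN _; exact: hN.
apply: rnorm_pi_in; exists N => // n /= Nn.
by apply: le_trans (ad _ _) _; rewrite lerD ?hN.
Qed.

HB.instance Definition _ := Uniform_isComplete.Build Q compl_complete.

Fact compl_cstar_normM (x y : Q) : `|algmul x y| <= `|x| * `|y|.
Proof.
rewrite !rnormE -rmorphM lecR.
elim/quotW: x => a; elim/quotW: y => b.
by rewrite [algmul _ _]compl_mulE !rnorm_pi cs_normM.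
Qed.
Fact compl_cstar_identity (x : Q) : `|algmul (starop x) x| = `|x| ^+ 2.
Proof.
rewrite !rnormE -rmorphXn /=; congr (_%:C).
elim/quotW: x => a.
by rewrite [starop _]compl_starE [algmul _ _]compl_mulE !rnorm_pi cs_norm_starM.
Qed.
HB.instance Definition _ :=
  isCstarAlgebra.Build K Q compl_cstar_normM compl_cstar_identity.

Definition cstar_completion : cstarAlgType K := Q.

Lemma compl_in_morphism : star_morphism (compl_in : A -> cstar_completion).
Proof.
split; [exact: compl_inD|exact: compl_inZ|exact: compl_in_mul|by []|exact: compl_in_star].
Qed.

Section extension.
Variables (V : completeNormedModType K) (f : A -> V).
Hypotheses (fD : {morph f : x y / x + y}) (fZ : forall k, {morph f : x / k *: x}).
Hypothesis f_le : forall x : A, rnorm (f x) <= p x.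

Lemma ext_fN : {morph f : x / - x}.
Proof. by move=> x; rewrite -scaleN1r fZ scaleN1r. Qed.

Lemma ext_cvg a : cvgn (fun n => f (a n)).
Proof.
apply: cauchy_cvgn => e e0; have [N hN] := cs_cauchy a e0.
exists N => m n /hN h /h; apply: le_trans.
by rewrite -ext_fN -fD f_le.
Qed.

Definition compl_ext (x : Q) : V := limn (fun n => f (repr x n)).

(** Two representatives of a class differ by a sequence on which [p], and therefore [f], tends to 0;
    so [compl_ext] may be computed along any of them. *)
Lemma compl_ext_cvg a : (fun n => f (a n)) @ \oo --> compl_ext (\pi_Q a).
Proof.
have h := @ext_cvg (repr (\pi_Q a)).
have d : (fun n => f (a n) - f (repr (\pi_Q a) n)) @ \oo --> (0 : V).
  apply/cvg_rnorm => e e0.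
  have /cvgrPdist_le /(_ e e0) := @cs_norm_cvg (cs_sub (repr (\pi_Q a)) a).
  rewrite cs_repr; apply: filterS => n; rewrite sub0r normrN ger0_norm ?csn_ge0 //=.
  rewrite scaleN1r => hn; rewrite sub0r opprB -ext_fN -fD.
  exact: le_trans (f_le _) hn.
rewrite -[compl_ext _]add0r.
have -> : (fun n => f (a n)) =
    (fun n => (f (a n) - f (repr (\pi_Q a) n)) + f (repr (\pi_Q a) n)).
  by apply/funext => n; rewrite subrK.
exact: cvgD.
Qed.

Lemma compl_extE a l : (fun n => f (a n)) @ \oo --> l -> compl_ext (\pi_Q a) = l.
Proof. by move=> h; rewrite -(cvg_lim _ h) // -(cvg_lim _ (@compl_ext_cvg a)). Qed.

Lemma compl_ext_in x : compl_ext (compl_in x) = f x.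
Proof. by apply: compl_extE; rewrite /=; exact: cvg_cst. Qed.

Lemma compl_extD : {morph compl_ext : x y / x + y}.
Proof.
elim/quotW => a; elim/quotW => b; rewrite pi_addE; apply: compl_extE => /=.
by under eq_fun do rewrite fD; apply: cvgD; exact: compl_ext_cvg.
Qed.

Lemma compl_extZ k : {morph compl_ext : x / k *: x}.
Proof.
elim/quotW => a; rewrite pi_scaleE; apply: compl_extE => /=.
by under eq_fun do rewrite fZ; apply: cvgZr; exact: compl_ext_cvg.
Qed.

Lemma compl_ext_le x : rnorm (compl_ext x) <= rnorm x.
Proof.
elim/quotW: x => a; rewrite rnorm_pi.
apply/ler_addgt0Pl => e e0; rewrite addrC.
have /cvg_rnorm /(_ _ (divr_gt0 e0 (ltr0Sn _ 1))) h1 := @compl_ext_cvg a.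
have /cvgrPdist_le /(_ _ (divr_gt0 e0 (ltr0Sn _ 1))) h2 := @cs_norm_cvg a.
have [n [h3 h4]] := @filter_ex _ _ _ _ (@filterI _ _ _ _ _ h1 h2).
rewrite -[compl_ext _](subrK (f (a n))).
apply: le_trans (rnormD _ _) _; rewrite (splitr e) addrA addrC lerD //.
apply: le_trans (f_le _) _; rewrite -lerBlDl.
by apply: le_trans h4; rewrite distrC ler_norm.
Qed.

End extension.

End completion.

(** * Star morphisms are contractive *)

Section cstar_theory.
Variables (R : realType) (V : cstarAlgType R[i]).
Local Notation K := R[i].
Implicit Types a b : V.

Lemma rnorm_cstar : cstar_seminorm (@rnorm R V : V -> R).
Proof.
split.
- exact: rnormD.
- exact: rnormZ.
- by move=> a b; rewrite -lecR rmorphM /= -!rnormE; exact: cstar_normM.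
- move=> a; apply: complexI; rewrite rmorphXn /= -!rnormE; exact: cstar_identity.
Qed.

Lemma rnormM a b : rnorm (a * b) <= rnorm a * rnorm b.
Proof. exact: csnM rnorm_cstar a b. Qed.

Lemma rnorm_star a : rnorm (starop a) = rnorm a.
Proof. exact: csn_starE rnorm_cstar a. Qed.

Lemma cvg_algmul (T : Type) (F : set_system T) {FF : Filter F} (u v : T -> V) (l m : V) :
  u @ F --> l -> v @ F --> m -> (fun n => u n * v n) @ F --> l * m.
Proof.
move=> /cvg_rnorm ul /cvg_rnorm vm; apply/cvg_rnorm => e e0.
have m1 : 0 < rnorm m + 1 by rewrite ltr_wpDl ?rnorm_ge0.
have l1 : 0 < rnorm l + 1 by rewrite ltr_wpDl ?rnorm_ge0.
have e2 : 0 < e / 2 by rewrite divr_gt0.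
have h1 := ul _ (divr_gt0 e2 m1); have h2 := ul _ ltr01.
have h3 := vm _ (divr_gt0 e2 l1).
apply: filterS3 h1 h2 h3 => n h1 h2 h3.
have -> : l * m - u n * v n = (l - u n) * m + u n * (m - v n).
  by rewrite mulrBl mulrBr addrA subrK.
have un : rnorm (u n) <= rnorm l + 1.
  have -> : u n = l - (l - u n) by rewrite subKr.
  by apply: le_trans (rnormD _ _) _; rewrite rnormN lerD.
apply: le_trans (rnormD _ _) _; rewrite [leRHS](splitr e).
apply: lerD; apply: le_trans (rnormM _ _) _.
  move: h1; rewrite ler_pdivlMr // => h; apply: le_trans h.
  by rewrite ler_wpM2l ?rnorm_ge0 // lerDl.
move: h3; rewrite ler_pdivlMr // mulrC => h; apply: le_trans h.
by rewrite ler_wpM2r ?rnorm_ge0.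
Qed.

Lemma cvg_star (T : Type) (F : set_system T) {FF : Filter F} (u : T -> V) (l : V) :
  u @ F --> l -> (fun n => starop (u n)) @ F --> starop l.
Proof.
move=> /cvg_rnorm ul; apply/cvg_rnorm => e /ul.
by apply: filterS => n; rewrite -starB rnorm_star.
Qed.

(* sqrt (1 - b) = 1 - t, where t is the fixed point of t |-> (b + t^2) / 2 *)
Lemma cstar_sqrt b (r : R) : r < 1 -> rnorm b <= r -> starop b = b ->
  exists s : V, [/\ s * s = 1 - b, starop s = s &
    forall a, a * b = b * a -> a * s = s * a].
Proof.
move=> r1 br sb; have r0 : 0 <= r := le_trans (rnorm_ge0 b) br.
pose f (t : V) : V := (2^-1 : K) *: (b + t * t).
pose t n := iter n f 0.
have half (x : V) : rnorm ((2^-1 : K) *: x) = rnorm x / 2.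
  rewrite rnormZ mulrC; congr (_ * _); apply: complexI.
  by rewrite -cabsE normfV normr_nat rmorphV ?unitfE ?pnatr_eq0 //= rmorph_nat.
have tr n : rnorm (t n) <= r.
  elim: n => [|n IH]; first by rewrite rnorm0.
  rewrite [t _]/(f (t n)) half ler_pdivrMr //.
  apply: le_trans (rnormD _ _) _; rewrite mulr_natr mulr2n lerD //.
  apply: le_trans (rnormM _ _) _; rewrite -[leRHS]mulr1.
  by apply: ler_pM => //; rewrite ?rnorm_ge0 // (le_trans IH) // ltW.
have fd x y : rnorm x <= r -> rnorm y <= r ->
    rnorm (f x - f y) <= r * rnorm (x - y).
  move=> xr yr; rewrite -scalerBr half ler_pdivrMr // opprD addrACA subrr add0r.
  have -> : x * x - y * y = (x - y) * x + y * (x - y).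
    by rewrite mulrBl mulrBr addrA subrK.
  apply: le_trans (rnormD _ _) _; rewrite mulr_natr mulr2n lerD //.
    by apply: le_trans (rnormM _ _) _; rewrite mulrC ler_wpM2r ?rnorm_ge0.
  by apply: le_trans (rnormM _ _) _; rewrite ler_wpM2r ?rnorm_ge0.
have td k n : rnorm (t (n + k)%N - t n) <= r ^+ n.
  elim: n => [|n IH]; first by rewrite subr0 expr0 (le_trans (tr _)) // ltW.
  rewrite addSn exprS; apply: le_trans (fd _ _ (tr _) (tr _)) _.
  by rewrite ler_wpM2l.
have rn : (fun n => r ^+ n) @ \oo --> (0 : R).
  by apply: cvg_expr; rewrite ger0_norm.
have /cvg_ex[/= l tl] : cvgn (t : nat -> V).
  apply: cauchy_cvgn => e e0.
  have /cvgrPdist_le /(_ (e / 2)) := rn; rewrite divr_gt0 // => /(_ isT)[N _ hN].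
  have {}hN n : (N <= n)%N -> rnorm (t n - t N) <= e / 2.
    move=> Nn; rewrite -(subnKC Nn); apply: le_trans (td _ _) _.
    by have := hN N (leqnn N); rewrite sub0r normrN; apply: le_trans; exact: ler_norm.
  exists N => m n /hN mN /hN nN.
  have -> : t m - t n = (t m - t N) + (t N - t n) by rewrite addrA subrK.
  by apply: le_trans (rnormD _ _) _; rewrite (splitr e) lerD // rnormB.
have tl1 : (fun n => t n.+1) @ \oo --> l by rewrite (cvg_shiftS t).
have lf : l = f l.
  apply: (cvg_unique _ tl1) => //.
  by apply: cvgZr; apply: cvgD; [exact: cvg_cst|exact: cvg_algmul].
exists (1 - l); split.
- have -> : b = l + l - l * l.
    have : l + l = b + l * l.
      rewrite -[LHS](scaler_nat 2 l) {1}lf scalerA mulfV ?scale1r // pnatr_eq0 //.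
    by move=> ->; rewrite addrK.
  by rewrite mulrBl mul1r mulrBr mulr1 -addrA -opprD addrA.
- rewrite starB star1; congr (_ - _).
  apply: (cvg_unique _ (cvg_star tl)) => //.
  suff ts : (fun n => starop (t n)) = t by rewrite /= ts.
  apply/funext => n; elim: n => [|n IH]; first exact: star0.
  rewrite [t _]/(f (t n)) staropZ starD sb star_mul IH.
  by rewrite fmorphV rmorph_nat.
- move=> a ab; rewrite mulrBl mulrBr mul1r mulr1; congr (_ - _).
  have al : (fun n => a * t n) @ \oo --> a * l by apply: cvg_algmul => //; exact: cvg_cst.
  have la : (fun n => t n * a) @ \oo --> l * a by apply: cvg_algmul => //; exact: cvg_cst.
  apply: (cvg_unique _ al) => //.
  suff ts : (fun n => a * t n) = (fun n => t n * a) by rewrite /= ts.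
  apply/funext => n; elim: n => [|n IH]; first by rewrite mulr0 mul0r.
  rewrite [t _]/(f (t n)) -scaleAr -scaleAl mulrDr mulrDl ab; congr (_ *: (_ + _)).
  by rewrite mulrA IH -mulrA IH mulrA.
Qed.

(** A selfadjoint [b] of norm less than 1 is the real part of the unitary [b + i sqrt (1 - b^2)],
    and C*-seminorms are at most 1 on unitaries. The C*-identity reduces the general case to
    [starop a * a]. The square root is the only functional calculus involved. *)
Lemma csn_le_rnorm (q : V -> R) a : cstar_seminorm q -> q a <= rnorm a.
Proof.
move=> qC; have unit_le b : rnorm b < 1 -> starop b = b -> q b <= 1.
  move=> b1 sb; have bb1 : rnorm (b * b) <= rnorm b.
    apply: le_trans (rnormM _ _) _; rewrite -[leRHS]mulr1.
    by apply: ler_wpM2l; rewrite ?rnorm_ge0 // ltW.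
  have [s [ss sas sC]] := cstar_sqrt b1 bb1 ltac:(by rewrite star_mul sb).
  have bs : b * s = s * b by apply: sC; rewrite mulrA.
  pose w := b + ('i%C : K) *: s.
  have ws : starop w = b - ('i%C : K) *: s.
    rewrite starD staropZ sb sas -scaleNr; congr (_ + _ *: _).
    by apply/eqP; rewrite eq_complex /= oppr0 !eqxx.
  have ii (x : V) : ('i%C : K) *: (('i%C : K) *: x) = - x.
    by rewrite scalerA -expr2 sqr_i scaleN1r.
  have uw : unitary w.
    have bJ : b * (('i%C : K) *: s) = ('i%C : K) *: s * b.
      by rewrite -scaleAl -scaleAr bs.
    have JJ : ('i%C : K) *: s * (('i%C : K) *: s) = b * b - 1.
      by rewrite -scaleAl -scaleAr ii ss opprB.
    split; rewrite ws /w.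
      by rewrite mulrBl !mulrDr bJ JJ addrKA subKr.
    by rewrite mulrDl !mulrBr bJ JJ subrKA subKr.
  have bE : b = (2^-1 : K) *: (w + starop w).
    by rewrite ws /w addrACA subrr addr0 -[b + b](scaler_nat 2 b) scalerA mulVf ?scale1r // pnatr_eq0.
  have q2 : q (w + starop w) <= 2.
    apply: le_trans (csnD qC _ _) _; rewrite csn_starE //.
    by rewrite (_ : 2 = 1 + 1) // lerD // csn_unitary.
  rewrite bE csnZ //.
  have -> : cabs (2^-1 : K) = 2^-1.
    apply: complexI; rewrite -cabsE normfV normr_nat.
    by rewrite rmorphV ?unitfE ?pnatr_eq0 //= rmorph_nat.
  by rewrite ler_pdivrMl // mulr1.
(* Dividing by [e + rnorm b] brings the norm strictly below 1, as the square root requires. *)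
have self b : starop b = b -> q b <= rnorm b.
  move=> sb; apply/ler_addgt0Pl => e e0.
  have M0 : 0 < e + rnorm b by rewrite ltr_pwDl // rnorm_ge0.
  have cM : cabs ((e + rnorm b)^-1)%:C = (e + rnorm b)^-1.
    by apply: complexI; rewrite -cabsE ger0_norm // ler0c invr_ge0 ltW.
  have := unit_le (((e + rnorm b)^-1)%:C *: b).
  rewrite rnormZ csnZ // cM ler_pdivrMl // mulr1; apply.
    by rewrite ltr_pdivrMl // mulr1 ltrDr.
  rewrite staropZ sb; congr (_ *: _); apply/eqP.
  by rewrite eq_complex /= oppr0 !eqxx.
have := self (starop a * a); rewrite star_mul staropK => /(_ erefl).
rewrite csn_star // (csn_star rnorm_cstar).
by rewrite ler_sqr // nnegrE ?(csn_ge0 qC) ?rnorm_ge0.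
Qed.

End cstar_theory.

(** The norm of the target pulls back along [f] to a C*-seminorm, which [csn_le_rnorm] bounds. *)
Lemma star_morphism_le (R : realType) (A B : cstarAlgType R[i]) (f : A -> B) :
  star_morphism f -> forall a, rnorm (f a) <= rnorm a.
Proof.
move=> [fD fZ fM f1 fS] a; apply: (@csn_le_rnorm _ A (fun a => rnorm (f a))).
split=> [x y|k x|x y|x].
- by rewrite fD rnormD.
- by rewrite fZ rnormZ.
- by rewrite fM; exact: rnormM.
- by rewrite fM fS; exact: (csn_star (@rnorm_cstar _ B)).
Qed.

(** * States and the largest C*-seminorm *)

Section supremum_of_seminorms.
Variables (R : realType) (A : starAlgType R[i]) (P : set (A -> R)).
Hypotheses (P0 : P !=set0) (P_bounded : forall a, exists M, forall q, P q -> q a <= M).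

Definition supn (a : A) : R := sup [set q a | q in P].

Lemma has_supn a : has_sup [set q a | q in P].
Proof.
split; first by have [q Pq] := P0; exists (q a), q.
by have [M hM] := P_bounded a; exists M => _ [q Pq <-]; exact: hM.
Qed.

Lemma le_supn q a : P q -> q a <= supn a.
Proof. by move=> Pq; apply: (sup_upper_bound (has_supn a)); exists q. Qed.

Lemma supn_le a M : (forall q, P q -> q a <= M) -> supn a <= M.
Proof.
by move=> h; apply: (ge_sup (has_supn a).1) => _ [q Pq <-]; exact: h.
Qed.

Lemma supnD : (forall q, P q -> forall a b, q (a + b) <= q a + q b) ->
  forall a b, supn (a + b) <= supn a + supn b.
Proof.
move=> h a b; apply: supn_le => q Pq; apply: le_trans (h q Pq a b) _.
by rewrite lerD // le_supn.
Qed.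

(** One inequality holds for every scalar; applied to [k^-1] it gives the other. *)
Lemma supnZ : (forall q, P q -> forall k a, q (k *: a) = cabs k * q a) ->
  forall k a, supn (k *: a) = cabs k * supn a.
Proof.
move=> h k a.
have le c b : supn (c *: b) <= cabs c * supn b.
  by apply: supn_le => q Pq; rewrite h // ler_wpM2l ?cabs_ge0 // le_supn.
apply/eqP; rewrite eq_le le /=; have [->|k0] := eqVneq k 0.
  rewrite /cabs normr0 mul0r scale0r; have [q Pq] := P0.
  apply: le_trans (le_supn 0 Pq).
  by rewrite -(scale0r (0 : A)) h // /cabs normr0 mul0r.
have := le k^-1 (k *: a); rewrite scalerA mulVf // scale1r.
have -> : cabs k^-1 = (cabs k)^-1.
  apply: complexI; rewrite -cabsE normfV cabsE rmorphV //.
  by rewrite unitfE -(inj_eq (@complexI R)) -cabsE normr_eq0.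
rewrite ler_pdivlMl // -ltcR -cabsE normr_gt0 //.
Qed.

End supremum_of_seminorms.

(** A purely algebraic notion, since no norm is given yet; boundedness for the largest C*-seminorm
    is the content of [state_le_full]. *)
Record state (R : realType) (A : starAlgType R[i]) (phi : A -> R[i]) : Prop := State {
  stateD : {morph phi : a b / a + b};
  stateZ : forall k, {morph phi : a / k *: a >-> k * a};
  state_ge0 : forall a : A, 0 <= phi (starop a * a);
  state1 : phi 1 = 1 }.

Section state_theory.
Variables (R : realType) (A : starAlgType R[i]) (phi : A -> R[i]).
Hypothesis phiS : state phi.
Implicit Types a b : A.

(** The length of the vector of [a] in the GNS representation of [phi]. *)
Definition state_norm a : R := Num.sqrt (complex.Re (phi (starop a * a))).

Lemma state_normE a : (state_norm a ^+ 2)%:C = phi (starop a * a).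
Proof.
have h := state_ge0 phiS a.
rewrite sqr_sqrtr ?RRe_real ?ger0_real //.
by move: h; rewrite lecE => /andP[_].
Qed.

Lemma state_norm_ge0 a : 0 <= state_norm a.
Proof. exact: sqrtr_ge0. Qed.

Lemma stateN a : phi (- a) = - phi a.
Proof. by rewrite -scaleN1r stateZ // mulN1r. Qed.

(** Positivity at [a + k *: b] makes [k * y + k^* * x] real; [k = 1] and [k = i] together give
    [x = y^*]. *)
Lemma state_conj a b : phi (starop b * a) = (phi (starop a * b))^*.
Proof.
set x := phi (starop b * a); set y := phi (starop a * b).
have h k : 0 <= phi (starop a * a) + k * y + k^* * x + k * k^* * phi (starop b * b).
  have := state_ge0 phiS (a + k *: b).
  rewrite starD staropZ mulrDl !mulrDr -!(scaleAl, scaleAr) !(stateD phiS) !(stateZ phiS).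
  by rewrite -/x -/y mulrA [k^* * k]mulrC !addrA.
have hr k : k * y + k^* * x \is Num.real.
  have r1 : phi (starop a * a) \is Num.real by rewrite ger0_real // state_ge0.
  have r2 : k * k^* * phi (starop b * b) \is Num.real.
    by rewrite ger0_real // mulr_ge0 ?mul_conjC_ge0 // state_ge0.
  have := ger0_real (h k); rewrite -addrA -addrA rpredDl // addrA rpredDr //.
have /complex_realP[r] := hr 1; have /complex_realP[s] := hr 'i%C.
rewrite rmorph1 !mul1r.
have -> : ('i%C : R[i])^* = - 'i%C.
  by apply/eqP; rewrite eq_complex /= oppr0 !eqxx.
case: x y {h hr} => [x1 x2] [y1 y2] [] /= e1 e2 [] e3 e4.
apply/eqP; rewrite eq_complex /=; apply/andP; split; apply/eqP; lra.
Qed.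

(** Positivity at [a - t x b] with [t] real gives a quadratic inequality in [t]. The minimizing [t]
    would be the inverse of [B], which may vanish, so [B + e] is inverted and [e] tends to 0. *)
Lemma cauchy_schwarz a b :
  cabs (phi (starop b * a)) <= state_norm b * state_norm a.
Proof.
set x := phi _; suff h : cabs x ^+ 2 <= state_norm b ^+ 2 * state_norm a ^+ 2.
  by rewrite -ler_sqr ?nnegrE ?mulr_ge0 ?cabs_ge0 ?state_norm_ge0 // exprMn.
set X := cabs x ^+ 2; set B := state_norm b ^+ 2; set S := state_norm a ^+ 2.
have B0 : 0 <= B by rewrite sqr_ge0.
have S0 : 0 <= S by rewrite sqr_ge0.
have X0 : 0 <= X by rewrite sqr_ge0.
have key (t : R) : 0 <= S - 2 * t * X + t ^+ 2 * X * B.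
  have := state_ge0 phiS (a - (t%:C * x) *: b).
  rewrite starB staropZ mulrBl !mulrBr -!(scaleAl, scaleAr) !(stateD phiS, stateN).
  rewrite !(stateZ phiS) (state_conj b a) -/x -!state_normE -/S -/B.
  have -> : (t%:C * x)^* = t%:C * x^*.
    by rewrite rmorphM; congr (_ * _); exact: conjc_real.
  have -> : t%:C * x * x^* = (t * X)%:C by rewrite -mulrA -cabs_sqr -rmorphM.
  have -> : t%:C * x^* * x = (t * X)%:C.
    by rewrite -mulrA [x^* * x]mulrC -cabs_sqr -rmorphM.
  have -> : t%:C * x^* * (t%:C * x * B%:C) = (t ^+ 2 * X * B)%:C.
    have XE : X%:C = x * x^* := cabs_sqr x.
    have -> : (t ^+ 2 * X * B)%:C = t%:C ^+ 2 * X%:C * B%:C.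
      by rewrite [LHS](rmorphM _ (t ^+ 2 * X)) /= (rmorphM _ (t ^+ 2)) rmorphXn.
    by rewrite XE; ring.
  have -> : S%:C - (t * X)%:C - ((t * X)%:C - (t ^+ 2 * X * B)%:C) =
    (S - t * X - (t * X - t ^+ 2 * X * B))%:C by rewrite !rmorphB.
  rewrite ler0c => h; apply: le_trans h _.
  by rewrite le_eqVlt; apply/orP; left; apply/eqP; ring.
have {}key e : 0 < e -> X <= S * (B + e).
  move=> e0; have Be : 0 < B + e by rewrite ltr_wpDl.
  have := key (B + e)^-1 => h.
  rewrite -ler_pdivrMr // -subr_ge0; apply: le_trans h _.
  rewrite -subr_ge0.
  have -> : S - X / (B + e) - (S - 2 * (B + e)^-1 * X + (B + e)^-1 ^+ 2 * X * B)
     = X * e * (B + e)^-1 ^+ 2 by field; rewrite gt_eqF.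
  by rewrite mulr_ge0 ?sqr_ge0 // mulr_ge0 // ltW.
rewrite mulrC; apply/ler_addgt0Pl => e e0.
have S1 : 0 < S + 1 by rewrite ltr_wpDl.
apply: le_trans (key _ (divr_gt0 e0 S1)) _.
rewrite mulrDr addrC lerD2r mulrCA ler_piMr ?ltW //.
by rewrite ltr_pdivrMr // mul1r ltrDl.
Qed.

Lemma state_normZ k a : state_norm (k *: a) = cabs k * state_norm a.
Proof.
rewrite /state_norm staropZ -scaleAl -scaleAr !(stateZ phiS) mulrA [k^* * k]mulrC.
rewrite -cabs_sqr -state_normE -rmorphM /= sqrtrM ?sqr_ge0 //.
by rewrite !sqrtr_sqr !ger0_norm ?cabs_ge0 ?state_norm_ge0.
Qed.

Lemma state_normD a b : state_norm (a + b) <= state_norm a + state_norm b.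
Proof.
rewrite -ler_sqr ?nnegrE ?addr_ge0 ?state_norm_ge0 // -lecR state_normE.
rewrite starD mulrDl !mulrDr !(stateD phiS) -!state_normE.
rewrite (state_conj a b); set x := phi (starop a * b).
have -> : ((state_norm a ^+ 2)%:C + x + (x^* + (state_norm b ^+ 2)%:C)) =
    (state_norm a ^+ 2 + 2 * complex.Re x + state_norm b ^+ 2)%:C.
  have xx : x + x^* = (2 * complex.Re x)%:C.
    by rewrite rmorphM /= rmorph_nat; exact: addcJ.
  by rewrite 2!rmorphD /= -xx !addrA.
have h := le_trans (cabs_Re x) (cauchy_schwarz b a).
by rewrite lecR; nra.
Qed.

Lemma state_norm1 : state_norm 1 = 1.
Proof. by rewrite /state_norm star1 mulr1 state1 // sqrtr1. Qed.

Lemma state_le_norm a : cabs (phi a) <= state_norm a.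
Proof. by have := cauchy_schwarz a 1; rewrite star1 mul1r state_norm1 mul1r. Qed.

(** Null vectors form a left ideal, by Cauchy-Schwarz. This settles the vectors at which
    [state_conjugate] cannot be normalized. *)
Lemma state_normM0 a b : state_norm b = 0 -> state_norm (a * b) = 0.
Proof.
move=> b0; have := cauchy_schwarz (starop a * (a * b)) b; rewrite b0 mul0r => h.
apply/eqP; rewrite -sqrf_eq0 -(inj_eq (@complexI R)) state_normE star_mul -mulrA.
by rewrite -normr_eq0 cabsE; apply/eqP; congr (_%:C); apply/eqP; rewrite eq_le h cabs_ge0.
Qed.

(** The vector state of the normalized GNS vector of [b]. *)
Definition state_conjugate b a := phi (starop b * a * b) / phi (starop b * b).

Lemma state_conjugateP b : state_norm b != 0 -> state (state_conjugate b).
Proof.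
move=> b0; have pb : phi (starop b * b) != 0.
  by rewrite -state_normE fmorph_eq0 sqrf_eq0.
split=> [x y|k x|x|].
- by rewrite /state_conjugate mulrDr mulrDl stateD // mulrDl.
- by rewrite /state_conjugate -scaleAr -scaleAl stateZ // mulrA.
- rewrite divr_ge0 ?(state_ge0 phiS) //.
  have -> : starop b * (starop x * x) * b = starop (x * b) * (x * b).
    by rewrite star_mul !mulrA.
  exact: state_ge0.
- by rewrite /state_conjugate mulr1 divff.
Qed.

End state_theory.

Section enveloping_seminorm.
Variables (R : realType) (A : starAlgType R[i]).
Local Notation K := R[i].
Hypothesis unitary_span : forall a : A, exists l : seq (K * A),
  (forall p, p \in l -> unitary p.2) /\ a = \sum_(p <- l) p.1 *: p.2.

Definition full_seminorm : A -> R := supn (@cstar_seminorm R A).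

Lemma cstar_seminorm0 : cstar_seminorm (fun _ : A => 0 : R).
Proof. by split=> *; rewrite ?addr0 ?mulr0 ?expr0n. Qed.

(** A combination of unitaries is bounded by the sum of the moduli of its coefficients, whatever the
    C*-seminorm; hence the supremum is finite. *)
Lemma full_bounded (a : A) : exists M, forall q : A -> R, cstar_seminorm q -> q a <= M.
Proof.
have [l [ul ->]] := unitary_span a.
exists (\sum_(p <- l) cabs p.1) => q qC; apply: le_trans (csn_sum qC _ _) _.
rewrite !big_seq; apply: ler_sum => p /ul up.
by rewrite csnZ // -[leRHS]mulr1 ler_wpM2l ?cabs_ge0 ?csn_unitary.
Qed.

Let ne : (@cstar_seminorm R A) !=set0.
Proof. by exists (fun=> 0); exact: cstar_seminorm0. Qed.

Lemma le_full (q : A -> R) a : cstar_seminorm q -> q a <= full_seminorm a.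
Proof. by move=> qC; exact: (le_supn ne full_bounded). Qed.

Lemma full_ge0 a : 0 <= full_seminorm a.
Proof. exact: le_full cstar_seminorm0. Qed.

Lemma full_cstar : cstar_seminorm full_seminorm.
Proof.
split.
- by apply: (supnD ne full_bounded) => q; exact: csnD.
- by apply: (supnZ ne full_bounded) => q; exact: csnZ.
- move=> a b; apply: (supn_le ne full_bounded) => q qC.
  apply: le_trans (csnM qC _ _) _.
  by apply: ler_pM; rewrite ?(csn_ge0 qC) ?le_full.
- move=> a; apply/eqP; rewrite eq_le; apply/andP; split.
    apply: (supn_le ne full_bounded) => q qC.
    by rewrite csn_star // ler_sqr ?nnegrE ?full_ge0 ?(csn_ge0 qC) ?le_full.
  rewrite -[leRHS]sqr_sqrtr ?full_ge0 //.
  rewrite ler_sqr ?nnegrE ?full_ge0 ?sqrtr_ge0 //.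
  apply: (supn_le ne full_bounded) => q qC.
  rewrite -(ger0_norm (csn_ge0 qC a)) -sqrtr_sqr ler_sqrt ?full_ge0 //.
  by rewrite -csn_star // le_full.
Qed.

(** The supremum over all states of their GNS seminorms is a C*-seminorm, hence at most
    [full_seminorm]. It is submultiplicative because the length of [x * y] for [f] is the length of
    [y] for [f] times the length of [x] for the state [f] conjugated by [y]. *)
Lemma state_le_full (phi : A -> K) a : state phi -> cabs (phi a) <= full_seminorm a.
Proof.
move=> phiS; pose P : set (A -> R) := [set q | exists2 f, state f & q = state_norm f].
have neP : P !=set0 by exists (state_norm phi), phi.
have bP (b : A) : exists M, forall q, P q -> q b <= M.
  have [l [ul ->]] := unitary_span b.
  exists (\sum_(p <- l) cabs p.1) => _ [f fS ->]; rewrite !big_seq.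
  elim/big_ind2: _ => [|x y x' y' h h'|p /ul up].
  - by rewrite -(scale0r (0 : A)) state_normZ // /cabs normr0 mul0r.
  - by apply: le_trans (state_normD fS _ _) _; rewrite lerD.
  - by rewrite state_normZ // /state_norm up.1 state1 // sqrtr1 mulr1.
apply: le_trans (state_le_norm phiS a) _.
apply: (@le_trans _ _ (supn P a)); first by apply: (le_supn neP bP); exists phi.
apply: le_full.
have p0 b : 0 <= supn P b.
  by apply: le_trans (le_supn neP bP _ (ex_intro2 _ _ _ phiS erefl)); exact: state_norm_ge0.
have pM x y : supn P (x * y) <= supn P x * supn P y.
  apply: (supn_le neP bP) => _ [f fS ->].
  have [y0|y0] := eqVneq (state_norm f y) 0.
    by rewrite state_normM0 // mulr_ge0.
  have gS := state_conjugateP fS y0.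
  apply: (@le_trans _ _ (state_norm (state_conjugate f y) x * state_norm f y)).
    rewrite -ler_sqr ?nnegrE ?mulr_ge0 ?state_norm_ge0 // -lecR exprMn [leRHS]rmorphM /=.
    rewrite !state_normE // /state_conjugate divfK ?star_mul ?mulrA //.
    by rewrite -state_normE // fmorph_eq0 sqrf_eq0.
  by apply: ler_pM; rewrite ?state_norm_ge0 //; apply: (le_supn neP bP); [exists (state_conjugate f y) | exists f].
(* The squared length of [x] is the value of [f] at [starop x * x], which [state_le_norm] bounds by
   the length of [starop x * x]. *)
have pS x : supn P x ^+ 2 <= supn P (starop x * x).
  rewrite -[leRHS]sqr_sqrtr // ler_sqr ?nnegrE ?sqrtr_ge0 //.
  apply: (supn_le neP bP) => _ [f fS ->].
  rewrite -(ger0_norm (state_norm_ge0 f x)) -sqrtr_sqr ler_sqrt //.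
  apply: (@le_trans _ _ (state_norm f (starop x * x))); last first.
    by apply: (le_supn neP bP); exists f.
  apply: le_trans (state_le_norm fS _); apply: le_trans (cabs_Re _).
  by rewrite -state_normE.
have pL x : supn P x <= supn P (starop x).
  have := p0 x; rewrite le_eqVlt => /predU1P[<-|x0]; first exact: p0.
  by have := le_trans (pS x) (pM _ _); rewrite expr2 ler_pM2r.
have pE x : supn P (starop x) = supn P x.
  by apply/eqP; rewrite eq_le pL andbT -{2}(staropK x) pL.
split=> //.
- by apply: (supnD neP bP) => _ [f fS ->]; exact: state_normD.
- by apply: (supnZ neP bP) => _ [f fS ->]; exact: state_normZ.
- by move=> x; apply/eqP; rewrite eq_le pS andbT (le_trans (pM _ _)) // pE expr2.
Qed.

End enveloping_seminorm.

(** * Skew Laurent polynomials over C(X) *)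

Section integer_iterates.
Variables (X : topologicalType) (s : homeo X X).
Implicit Types (m n : int) (x : X).

Lemma int_iter1 x : int_iter s 1 x = s x. Proof. by []. Qed.

Lemma int_iterS n x : int_iter s (1 + n) x = s (int_iter s n x).
Proof.
case: n => [n|[|n]]; first by [].
  by rewrite /= homeo_invK.
have -> : 1 + Negz n.+1 = Negz n by lia.
by rewrite /= homeo_invK.
Qed.

Lemma int_iterP n x : int_iter s (-1 + n) x = homeo_inv s (int_iter s n x).
Proof. by rewrite -[n in RHS](addNKr 1) addrC int_iterS homeo_funK addrC. Qed.

Lemma int_iterD m n x : int_iter s (m + n) x = int_iter s m (int_iter s n x).
Proof.
elim/int_ind: m n x => [|m IH|m IH] n x; first by rewrite add0r.
  by rewrite intS -!addrA !int_iterS IH.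
have -> : - m.+1%:Z = -1 + - m%:Z by lia.
by rewrite -addrA !int_iterP IH.
Qed.

Lemma int_iterK n : cancel (int_iter s n) (int_iter s (- n)).
Proof. by move=> x; rewrite -int_iterD addNr. Qed.

Lemma int_iterKN n : cancel (int_iter s (- n)) (int_iter s n).
Proof. by move=> x; rewrite -int_iterD addrN. Qed.

Lemma continuous_iter (f : X -> X) k : continuous f -> continuous (iter k f).
Proof.
move=> cf; elim: k => [|k IH] x; first exact: cvg_id.
by apply: continuous_comp; [exact: IH|exact: cf].
Qed.

Lemma int_iter_cts n : continuous (int_iter s n).
Proof.
case: n => k; apply: continuous_iter.
  exact: homeo_fun_cts.
exact: homeo_inv_cts.
Qed.

Definition iter_homeo n : homeo X X :=
  Homeo (int_iterK n) (int_iterKN n) (@int_iter_cts n) (@int_iter_cts (- n)).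

End integer_iterates.

Section function_algebra.
Variables (K : numClosedFieldType) (X : topologicalType).
Local Notation CX := (contfun K X).
Implicit Types f g : CX.

Lemma cfD f g x : (f + g) x = f x + g x :> K. Proof. by []. Qed.
Lemma cfN f x : (- f) x = - f x :> K. Proof. by []. Qed.
Lemma cf0 x : (0 : CX) x = 0 :> K. Proof. by []. Qed.
Lemma cf1 x : (algone : CX) x = 1 :> K. Proof. by []. Qed.
Lemma cfM f g x : algmul f g x = f x * g x :> K. Proof. by []. Qed.
Lemma cfZ k f x : (k *: f) x = k * f x :> K. Proof. by []. Qed.
Lemma cfS f x : starop f x = (f x : K)^* :> K. Proof. by []. Qed.

Lemma cf_sum (I : Type) (r : seq I) (F : I -> CX) x :
  (\sum_(i <- r) F i) x = \sum_(i <- r) (F i x : K) :> K.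
Proof. exact: (big_morph (fun f : CX => f x : K)). Qed.

End function_algebra.

Section translate.
Variables (K : numClosedFieldType) (X : topologicalType) (s : homeo X X).
Local Notation CX := (contfun K X).
Implicit Types f g : CX.

(** The effect on functions of conjugation by the [n]-th power of the implementing unitary, whence
    the sign. *)
Definition translate (n : int) f : CX := contfun_pull f (iter_homeo s (- n)).

Lemma translateE n f x : translate n f x = f (int_iter s (- n) x). Proof. by []. Qed.

Lemma translate0 f : translate 0 f = f.
Proof. exact: contfunP. Qed.

Lemma translateA m n f : translate m (translate n f) = translate (m + n) f.
Proof.
by apply: contfunP => x; rewrite !translateE -int_iterD opprD addrC.
Qed.

Lemma translateD n : {morph translate n : f g / f + g}.
Proof. by move=> f g; apply: contfunP. Qed.

Lemma translateZ n k f : translate n (k *: f) = k *: translate n f.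
Proof. by apply: contfunP. Qed.

Lemma translateM n f g : translate n (algmul f g) = algmul (translate n f) (translate n g).
Proof. by apply: contfunP. Qed.

Lemma translate_one n : translate n algone = algone :> CX.
Proof. by apply: contfunP. Qed.

Lemma translate_star n f : translate n (starop f) = starop (translate n f).
Proof. by apply: contfunP. Qed.

End translate.

Section integer_powers.
Variables (K : numClosedFieldType) (A : starAlgType K) (u : A).
Hypothesis uu : unitary u.
Implicit Types m n : int.

Definition upow n : A :=
  match n with Posz k => u ^+ k | Negz k => starop u ^+ k.+1 end.

Lemma upowS n : upow (1 + n) = u * upow n.
Proof.
case: n => [n|[|n]]; first by rewrite /= -exprS.
  by rewrite /= expr1 uu.2.
have -> : 1 + Negz n.+1 = Negz n by lia.
by rewrite /= [in RHS]exprS mulrA uu.2 mul1r.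
Qed.

Lemma upowP n : upow (-1 + n) = starop u * upow n.
Proof.
by rewrite -[n in RHS](addNKr 1) addrC upowS mulrA uu.1 mul1r addrC.
Qed.

Lemma upowD m n : upow (m + n) = upow m * upow n.
Proof.
elim/int_ind: m n => [|m IH|m IH] n; first by rewrite add0r /= mul1r.
  by rewrite intS -!addrA !upowS IH mulrA.
have -> : - m.+1%:Z = -1 + - m%:Z by lia.
by rewrite -addrA !upowP IH mulrA.
Qed.

Lemma upow0 : upow 0 = 1. Proof. by []. Qed.
Lemma upow1 : upow 1 = u. Proof. by rewrite /= expr1. Qed.

Lemma star_exp (a : A) k : starop (a ^+ k) = starop a ^+ k.
Proof.
by elim: k => [|k IH]; rewrite ?star1 // exprS star_mul IH -exprSr.
Qed.

Lemma upow_star n : starop (upow n) = upow (- n).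
Proof.
case: n => [[|k]|k] /=; first by rewrite star1.
  by rewrite star_exp.
by rewrite star_exp staropK.
Qed.

Lemma upow_unitary n : unitary (upow n).
Proof. by split; rewrite upow_star -upowD ?addNr ?addrN. Qed.

End integer_powers.

Lemma star_morphism_upow (K : numClosedFieldType) (A B : starAlgType K)
    (f : A -> B) (u : A) : star_morphism f ->
  forall n, f (upow u n) = upow (f u) n.
Proof.
move=> [fD fZ fM f1 fS].
have fX a k : f (a ^+ k) = f a ^+ k.
  by elim: k => [|k IH]; rewrite ?expr0 // !exprS fM IH.
by case=> k; rewrite /= fX ?fS.
Qed.

Section covariant_pairs.
Variables (K : numClosedFieldType) (X : topologicalType) (s : homeo X X).
Variables (A : starAlgType K) (i : contfun K X -> A) (u : A).
Hypothesis iu : covariant s i u.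

Let uu : unitary u. Proof. by case: iu. Qed.

Lemma covariant1 f : u * i f = i (translate s 1 f) * u.
Proof.
case: iu => _ _ /(_ f) h.
rewrite -[LHS]mulr1 -uu.1 mulrA h; congr (i _ * _).
exact: contfunP.
Qed.

Lemma covariantN1 f : starop u * i f = i (translate s (-1) f) * starop u.
Proof.
have h := covariant1 (translate s (-1) f).
rewrite translateA translate0 in h.
by rewrite -[LHS]mulr1 -uu.2 !mulrA -(mulrA _ (i f)) -h mulrA uu.1 mul1r.
Qed.

Lemma covariant_upow n f : upow u n * i f = i (translate s n f) * upow u n.
Proof.
elim/int_ind: n f => [|n IH|n IH] f.
- by rewrite upow0 translate0 mul1r mulr1.
- by rewrite intS !(upowS uu) -translateA mulrA -covariant1 -!mulrA IH.
have -> : - n.+1%:Z = -1 + - n%:Z by lia.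
by rewrite !(upowP uu) -translateA mulrA -covariantN1 -!mulrA IH.
Qed.

End covariant_pairs.

(* Finite formal sums [\sum_n f_n u^n] with [f_n] in C(X). *)
Record skew (K : numClosedFieldType) (X : topologicalType) (s : homeo X X) := Skew {
  sk_fun :> int -> contfun K X;
  sk_fin : exists r : seq int, forall n, n \notin r -> sk_fun n = 0 }.

Section skew_algebra.
Variables (K : numClosedFieldType) (X : topologicalType) (s : homeo X X).
Local Notation CX := (contfun K X).
Local Notation skew := (skew K s).
Implicit Types (a b c : skew) (f g : CX) (n m : int).

HB.instance Definition _ := gen_eqMixin skew.
HB.instance Definition _ := gen_choiceMixin skew.

Lemma skewP a b : a =1 b -> a = b.
Proof.
case: a b => [a ha] [b hb] /= /funext ab; case: _ / ab hb => hb.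
by congr Skew; exact: Prop_irrelevance.
Qed.

(** A chosen finite set outside which the coefficients vanish. It may be larger than the true
    support, and [lsumE] shows that sums do not depend on it. *)
Definition skew_supp a : seq int := undup (sval (cid (sk_fin a))).

Lemma skew_supp_uniq a : uniq (skew_supp a). Proof. exact: undup_uniq. Qed.

Lemma skew_suppP a n : n \notin skew_supp a -> a n = 0.
Proof. by rewrite mem_undup; case: cid => r /= h /h. Qed.

Fact skew_mono_subproof f n : exists r : seq int, forall m, m \notin r ->
  (if m == n then f else 0) = 0.
Proof. by exists [:: n] => m; rewrite inE => /negbTE->. Qed.
Definition mono f n : skew := Skew s (skew_mono_subproof f n).

Fact skew_add_subproof a b : exists r : seq int, forall m, m \notin r ->
  a m + b m = 0.
Proof.
exists (skew_supp a ++ skew_supp b) => m; rewrite mem_cat negb_or.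
by move=> /andP[/skew_suppP-> /skew_suppP->]; rewrite addr0.
Qed.
Definition skew_add a b : skew := Skew s (skew_add_subproof a b).

Fact skew_scale_subproof (k : K) a : exists r : seq int, forall m, m \notin r ->
  k *: a m = 0.
Proof. by exists (skew_supp a) => m /skew_suppP->; rewrite scaler0. Qed.
Definition skew_scale k a : skew := Skew s (skew_scale_subproof k a).

Fact skew_addA : associative skew_add.
Proof. by move=> a b c; apply: skewP => n; exact: addrA. Qed.
Fact skew_addC : commutative skew_add.
Proof. by move=> a b; apply: skewP => n; exact: addrC. Qed.
Fact skew_add0 : left_id (mono 0 0) skew_add.
Proof. by move=> a; apply: skewP => n /=; rewrite if_same add0r. Qed.
Fact skew_addN : left_inverse (mono 0 0) (skew_scale (-1)) skew_add.
Proof. by move=> a; apply: skewP => n /=; rewrite if_same scaleN1r addNr. Qed.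
HB.instance Definition _ := GRing.isZmodule.Build skew
  skew_addA skew_addC skew_add0 skew_addN.

Fact skew_scaleA k l a : skew_scale k (skew_scale l a) = skew_scale (k * l) a.
Proof. by apply: skewP => n; exact: scalerA. Qed.
Fact skew_scale1 : left_id 1 skew_scale.
Proof. by move=> a; apply: skewP => n; exact: scale1r. Qed.
Fact skew_scaleDr : right_distributive skew_scale +%R.
Proof. by move=> k a b; apply: skewP => n; exact: scalerDr. Qed.
Fact skew_scaleDl a : {morph skew_scale^~ a : k l / k + l}.
Proof. by move=> k l; apply: skewP => n; exact: scalerDl. Qed.
HB.instance Definition _ := GRing.Zmodule_isLmodule.Build K skew
  skew_scaleA skew_scale1 skew_scaleDr skew_scaleDl.

Lemma skew_addE a b n : (a + b) n = a n + b n. Proof. by []. Qed.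
Lemma skew_scaleE k a n : (k *: a) n = k *: a n. Proof. by []. Qed.
Lemma skew_0E n : (0 : skew) n = 0. Proof. by rewrite /= if_same. Qed.
Lemma mono_nn f n : mono f n n = f. Proof. by rewrite /= eqxx. Qed.

Lemma monoD n : {morph mono^~ n : f g / f + g}.
Proof.
by move=> f g; apply: skewP => m; rewrite skew_addE /=; case: eqP; rewrite ?addr0.
Qed.

Lemma mono0 n : mono 0 n = 0.
Proof. by apply: skewP => m; rewrite skew_0E /= if_same. Qed.

Lemma monoZ k f n : mono (k *: f) n = k *: mono f n.
Proof.
by apply: skewP => m; rewrite skew_scaleE /=; case: eqP; rewrite ?scaler0.
Qed.

Lemma skew_sumE (I : Type) (r : seq I) (F : I -> skew) n :
  (\sum_(i <- r) F i) n = \sum_(i <- r) F i n.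
Proof. by apply: (big_morph (fun a : skew => a n)) => //; exact: skew_0E. Qed.

Section linear_sum.
Variables (M : zmodType) (F : int -> CX -> M).
Hypothesis FD : forall n, {morph F n : f g / f + g}.

Let F0 n : F n 0 = 0.
Proof. by apply: (addIr (F n 0)); rewrite -FD !add0r. Qed.

(** The additive extension of a map given on monomials. Product, star, evaluation and fibre
    functionals all have this form, so their identities need checking on monomials only, through
    [skew_lsum_ext]. *)
Definition lsum a : M := \sum_(n <- skew_supp a) F n (a n).

Lemma lsumE a (r : seq int) : uniq r -> (forall n, n \notin r -> a n = 0) ->
  lsum a = \sum_(n <- r) F n (a n).
Proof.
move=> ur hr.
have drop (t : seq int) :
    \sum_(n <- t) F n (a n) = \sum_(n <- [seq n <- t | a n != 0]) F n (a n).
  rewrite big_filter [LHS](bigID (fun n => a n != 0)) /= [X in _ + X]big1 ?addr0 //.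
  by move=> n; rewrite negbK => /eqP->.
rewrite /lsum drop [RHS]drop; apply: perm_big; apply: uniq_perm.
- by rewrite filter_uniq // skew_supp_uniq.
- by rewrite filter_uniq.
move=> n; rewrite !mem_filter; case: eqP => //= an0.
have -> : n \in r by apply: contrapT => /negP/hr.
by apply: contrapT => /negP/skew_suppP.
Qed.

Lemma lsumD : {morph lsum : a b / a + b}.
Proof.
move=> a b; pose r := undup (skew_supp a ++ skew_supp b).
have ur : uniq r by exact: undup_uniq.
have ha n : n \notin r -> a n = 0.
  by rewrite mem_undup mem_cat negb_or => /andP[/skew_suppP].
have hb n : n \notin r -> b n = 0.
  by rewrite mem_undup mem_cat negb_or => /andP[_ /skew_suppP].
rewrite (lsumE ur ha) (lsumE ur hb) (lsumE ur) => [|n nr]; last first.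
  by rewrite skew_addE ha // hb // addr0.
by rewrite -big_split; apply: eq_bigr => n _; rewrite skew_addE FD.
Qed.

Lemma lsum0 : lsum 0 = 0.
Proof. by apply: (addIr (lsum 0)); rewrite -lsumD !add0r. Qed.

Lemma lsum_mono f n : lsum (mono f n) = F n f.
Proof.
rewrite (@lsumE _ [:: n]) ?big_seq1 ?mono_nn // => m.
by rewrite inE /= => /negbTE ->.
Qed.

Lemma lsum_sum (I : Type) (r : seq I) (G : I -> skew) :
  lsum (\sum_(i <- r) G i) = \sum_(i <- r) lsum (G i).
Proof. exact: (big_morph lsum lsumD lsum0). Qed.

End linear_sum.

Lemma lsum_add (M : zmodType) (F G : int -> CX -> M) a :
  lsum (fun n f => F n f + G n f) a = lsum F a + lsum G a.
Proof. by rewrite /lsum big_split. Qed.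

Lemma skewE a : a = \sum_(n <- skew_supp a) mono (a n) n.
Proof.
apply: skewP => m; rewrite skew_sumE.
have [h|h] := boolP (m \in skew_supp a).
  rewrite (bigD1_seq m) ?skew_supp_uniq //= eqxx big1 ?addr0 // => n.
  by rewrite eq_sym => /negbTE->.
rewrite (skew_suppP h) big_seq big1 // => n nr /=.
by case: eqP nr h => // -> ->.
Qed.

Lemma skew_ind (P : skew -> Prop) : P 0 ->
  (forall f n a, P a -> P (mono f n + a)) -> forall a, P a.
Proof.
move=> P0 PD a; rewrite (skewE a); elim: (skew_supp a) => [|n r IH].
  by rewrite big_nil.
by rewrite big_cons; exact: PD.
Qed.

Lemma skew_lsum_ext (M : zmodType) (F G : skew -> M) :
  {morph F : a b / a + b} -> {morph G : a b / a + b} ->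
  (forall f n, F (mono f n) = G (mono f n)) -> F =1 G.
Proof.
move=> FD GD FG; have z (H : skew -> M) : {morph H : a b / a + b} -> H 0 = 0.
  by move=> HD; apply: (addIr (H 0)); rewrite -HD !add0r.
by elim/skew_ind => [|f n a IH]; rewrite ?z // FD GD FG IH.
Qed.

(** Left multiplication by the monomial [f u^n], as forced by [u^n g = (translate s n g) u^n]. *)
Let mul1 n f b := lsum (fun m g => mono (algmul f (translate s n g)) (n + m)) b.

Let mul1D n f : {morph mul1 n f : b c / b + c}.
Proof.
apply: lsumD => m g h; rewrite -monoD; congr mono.
by rewrite translateD algmulDr.
Qed.

Let mul1_D n b : {morph (mul1 n)^~ b : f g / f + g}.
Proof.
move=> f g; rewrite /mul1 -lsum_add; congr lsum.
by apply/funext => m; apply/funext => h; rewrite -monoD algmulDl.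
Qed.

Definition skew_mul a b : skew := lsum (fun n f => mul1 n f b) a.

Fact skew_mulDl : left_distributive skew_mul +%R.
Proof. by move=> a b c; apply: lsumD => n; exact: mul1_D. Qed.

Fact skew_mulDr : right_distributive skew_mul +%R.
Proof.
move=> a b c; rewrite /skew_mul -lsum_add; congr lsum.
by apply/funext => n; apply/funext => f; rewrite mul1D.
Qed.

Lemma skew_mul_mono f n g m :
  skew_mul (mono f n) (mono g m) = mono (algmul f (translate s n g)) (n + m).
Proof.
rewrite /skew_mul lsum_mono => [|k]; last exact: mul1_D.
rewrite /mul1 lsum_mono // => k h h'; rewrite -monoD; congr mono.
by rewrite translateD algmulDr.
Qed.

Fact skew_mulA : associative skew_mul.
Proof.
move=> a b c; move: a; apply: skew_lsum_ext => [a a'|a a'|f n].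
- exact: skew_mulDl.
- by rewrite skew_mulDl skew_mulDl.
move: b; apply: skew_lsum_ext => [b b'|b b'|g m].
- by rewrite skew_mulDl skew_mulDr.
- by rewrite skew_mulDr skew_mulDl.
move: c; apply: skew_lsum_ext => [c c'|c c'|h k].
- by rewrite !skew_mulDr.
- by rewrite skew_mulDr.
rewrite !skew_mul_mono addrA; congr mono.
by rewrite translateM translateA algmulA.
Qed.

Fact skew_mul1 : left_id (mono algone 0) skew_mul.
Proof.
apply: skew_lsum_ext => [a a'|//|f n]; first by rewrite skew_mulDr.
by rewrite skew_mul_mono add0r translate0 algmul1l.
Qed.

Fact skew_mulr1 : right_id (mono algone 0) skew_mul.
Proof.
apply: skew_lsum_ext => [a a'|//|f n]; first by rewrite skew_mulDl.
by rewrite skew_mul_mono addr0 translate_one algmul1r.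
Qed.

Fact skew_scaleAl (k : K) a b : k *: skew_mul a b = skew_mul (k *: a) b.
Proof.
move: a; apply: skew_lsum_ext => [a a'|a a'|f n].
- by rewrite skew_mulDl scalerDr.
- by rewrite scalerDr skew_mulDl.
move: b; apply: skew_lsum_ext => [b b'|b b'|g m].
- by rewrite skew_mulDr scalerDr.
- by rewrite skew_mulDr.
by rewrite -monoZ !skew_mul_mono -monoZ algscaleAl.
Qed.

Fact skew_scaleAr (k : K) a b : k *: skew_mul a b = skew_mul a (k *: b).
Proof.
move: a; apply: skew_lsum_ext => [a a'|a a'|f n].
- by rewrite skew_mulDl scalerDr.
- by rewrite skew_mulDl.
move: b; apply: skew_lsum_ext => [b b'|b b'|g m].
- by rewrite skew_mulDr scalerDr.
- by rewrite scalerDr skew_mulDr.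
by rewrite -monoZ !skew_mul_mono -monoZ translateZ algscaleAr.
Qed.

(** Forced by [starop (f u^n) = u^-n (starop f)] and the commutation relation. *)
Definition skew_star a : skew :=
  lsum (fun n f => mono (translate s (- n) (starop f)) (- n)) a.

Fact skew_starD : {morph skew_star : a b / a + b}.
Proof.
by apply: lsumD => n f g; rewrite -monoD staropD translateD.
Qed.

Lemma skew_star_mono f n :
  skew_star (mono f n) = mono (translate s (- n) (starop f)) (- n).
Proof.
by rewrite /skew_star lsum_mono // => m g h; rewrite -monoD staropD translateD.
Qed.

Fact skew_starK : involutive skew_star.
Proof.
apply: skew_lsum_ext => [a a'|//|f n]; first by rewrite !skew_starD.
by rewrite !skew_star_mono opprK translate_star translateA addrN translate0 staropK.
Qed.

Fact skew_starZ (k : K) a : skew_star (k *: a) = k^* *: skew_star a.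
Proof.
move: a; apply: skew_lsum_ext => [a a'|a a'|f n].
- by rewrite scalerDr skew_starD.
- by rewrite skew_starD scalerDr.
by rewrite -monoZ !skew_star_mono -monoZ staropZ translateZ.
Qed.

Fact skew_starM a b : skew_star (skew_mul a b) = skew_mul (skew_star b) (skew_star a).
Proof.
move: a; apply: skew_lsum_ext => [a a'|a a'|f n].
- by rewrite skew_mulDl skew_starD.
- by rewrite skew_starD skew_mulDr.
move: b; apply: skew_lsum_ext => [b b'|b b'|g m].
- by rewrite skew_mulDr skew_starD.
- by rewrite skew_starD skew_mulDl.
rewrite skew_mul_mono !skew_star_mono skew_mul_mono opprD addrC; congr mono.
by rewrite staropM translateM -[starop (translate _ _ g)]translate_star !translateA subrK.
Qed.

HB.instance Definition _ := isStarAlgebra.Build K skew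
  skew_mulA skew_mul1 skew_mulr1 skew_mulDl skew_mulDr
  skew_scaleAl skew_scaleAr skew_starK skew_starD skew_starZ skew_starM.

Definition skew_alg : starAlgType K := skew.

Lemma mulmono f n g m : (mono f n : skew_alg) * mono g m =
  mono (algmul f (translate s n g)) (n + m).
Proof. exact: skew_mul_mono. Qed.

Lemma starmono f n :
  starop (mono f n : skew_alg) = mono (translate s (- n) (starop f)) (- n).
Proof. exact: skew_star_mono. Qed.

Lemma mono_one : mono algone 0 = 1 :> skew_alg. Proof. by []. Qed.

Section evaluation.
Variables (A : starAlgType K) (i : CX -> A) (u : A).
Hypothesis iu : covariant s i u.

Let iD : {morph i : f g / f + g}. Proof. by case: iu => -[]. Qed.
Let uu : unitary u. Proof. by case: iu. Qed.

Definition skew_ev a : A := lsum (fun n f => i f * upow u n) a.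

Let evD n : {morph (fun f => i f * upow u n) : f g / f + g}.
Proof. by move=> f g; rewrite iD mulrDl. Qed.

Lemma skew_ev_mono f n : skew_ev (mono f n) = i f * upow u n.
Proof. exact: lsum_mono. Qed.

Lemma skew_evD : {morph skew_ev : a b / a + b}.
Proof. exact: lsumD. Qed.

Lemma skew_ev_morphism : star_morphism (skew_ev : skew_alg -> A).
Proof.
case: (iu) => -[_ iZ iM i1 iS] _ _; split.
- exact: skew_evD.
- move=> k; apply: skew_lsum_ext => [a b|a b|f n].
  + by rewrite scalerDr skew_evD.
  + by rewrite skew_evD scalerDr.
  by rewrite -monoZ !skew_ev_mono iZ scaleAl.
- move=> a b; move: a; apply: skew_lsum_ext => [a a'|a a'|f n].
  + by rewrite mulrDl skew_evD.
  + by rewrite skew_evD mulrDl.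
  move: b; apply: skew_lsum_ext => [b b'|b b'|g m].
  + by rewrite mulrDr skew_evD.
  + by rewrite skew_evD mulrDr.
  rewrite mulmono !skew_ev_mono (iM f) (upowD uu) !mulrA.
  by rewrite -(mulrA (i f) (upow u n)) (covariant_upow iu) mulrA.
- by rewrite -mono_one skew_ev_mono upow0 mulr1; exact: i1.
- apply: skew_lsum_ext => [a b|a b|f n].
  + by rewrite starD skew_evD.
  + by rewrite skew_evD starD.
  rewrite starmono !skew_ev_mono star_mul upow_star // -iS.
  by rewrite (covariant_upow iu).
Qed.

End evaluation.

End skew_algebra.

(** * Existence of the crossed product *)

Section complex_topology.
Variable R : realType.
Local Notation K := R[i].

Lemma cabs_dist (x y : K) : `|cabs x - cabs y| <= cabs (x - y).
Proof.
have h (a b : K) : cabs a - cabs b <= cabs (a - b).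
  by rewrite lerBlDr -{1}(subrK b a) cabsD.
rewrite ler_norml h andbT lerNl opprB.
by have -> : cabs (x - y) = cabs (y - x); [rewrite /cabs distrC | exact: h].
Qed.

Lemma cvg_cabs (T : Type) (F : set_system T) {FF : Filter F} (f : T -> K^o) (y : K^o) :
  f @ F --> y <-> forall e : R, 0 < e -> \forall t \near F, cabs (y - f t : K) <= e.
Proof. exact: cvg_rnorm. Qed.

Lemma cabs_realD (r t : R) : cabs (r%:C - t%:C) = `|r - t|.
Proof.
rewrite -rmorphB /=; apply: complexI; rewrite -cabsE normc_def /=.
by rewrite expr0n addr0 sqrtr_sqr.
Qed.

Lemma cabs_le_ReIm (k : K) : cabs k <= `|complex.Re k| + `|complex.Im k|.
Proof.
case: k => a b; have -> : a +i* b = a%:C + 'i%C * b%:C.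
  by rewrite {1}(complexE (a +i* b)).
apply: le_trans (cabsD _ _) _; rewrite cabsM.
have -> : cabs ('i%C : K) = 1.
  by apply: complexI; rewrite -cabsE normc_def /= expr0n expr1n add0r sqrtr1.
have h (c : R) : cabs c%:C = `|c| by have := cabs_realD c 0; rewrite !subr0.
by rewrite mul1r !h /= !(mul0r, mul1r, mulr0, subr0, addr0, add0r).
Qed.

Lemma Re_le_cabs (k : K) : `|complex.Re k| <= cabs k.
Proof. by rewrite -lecR -cabsE; exact: normc_ge_Re. Qed.

Lemma Im_le_cabs (k : K) : `|complex.Im k| <= cabs k.
Proof.
have -> : complex.Im k = - complex.Re (k * 'i%C) by rewrite ReiNIm opprK.
rewrite normrN; apply: le_trans (Re_le_cabs _) _; rewrite cabsM.
have -> : cabs ('i%C : K) = 1.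
  by apply: complexI; rewrite -cabsE normc_def /= expr0n expr1n add0r sqrtr1.
by rewrite mulr1.
Qed.

Lemma cvg_complex (T : Type) (F : set_system T) {FF : Filter F} (f : T -> K^o) (y : K^o) :
  (fun t => complex.Re (f t)) @ F --> complex.Re (y : K) ->
  (fun t => complex.Im (f t)) @ F --> complex.Im (y : K) -> f @ F --> y.
Proof.
move=> /cvgrPdist_le h1 /cvgrPdist_le h2; apply/cvg_cabs => e e0.
have e2 : 0 < e / 2 by rewrite divr_gt0.
apply: filterS2 (h1 _ e2) (h2 _ e2) => t r1 r2.
apply: le_trans (cabs_le_ReIm _) _.
by rewrite (splitr e) lerD // !raddfB.
Qed.

Lemma cvg_Re (T : Type) (F : set_system T) {FF : Filter F} (f : T -> K^o) (y : K^o) :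
  f @ F --> y -> (fun t => complex.Re (f t)) @ F --> complex.Re (y : K).
Proof.
move=> /cvg_cabs h; apply/cvgrPdist_le => e /h; apply: filterS => t.
by rewrite -raddfB; apply: le_trans; exact: Re_le_cabs.
Qed.

Lemma cvg_Im (T : Type) (F : set_system T) {FF : Filter F} (f : T -> K^o) (y : K^o) :
  f @ F --> y -> (fun t => complex.Im (f t)) @ F --> complex.Im (y : K).
Proof.
move=> /cvg_cabs h; apply/cvgrPdist_le => e /h; apply: filterS => t.
by rewrite -raddfB; apply: le_trans; exact: Im_le_cabs.
Qed.

Fact complex_complete (F : set_system K^o) : ProperFilter F -> cauchy F -> cvg F.
Proof.
move=> FF /cauchyP cF.
have part (g : K -> R) : (forall x y, `|g x - g y| <= cabs (x - y)) ->
    exists l : R, g @ F --> l.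
  move=> gl; suff : cvg (g @ F) by move=> /cvg_ex.
  apply: cauchy_cvg; apply: cauchy_exP => e e0.
  have e0' : 0 < e%:C by rewrite ltcR.
  have [x xF] := cF _ e0'; exists (g x).
  change (F [set y : K^o | ball (g x) e (g y)]).
  apply: filterS xF => y xy; have {}xy : cabs (x - y) < e.
    by rewrite -ltcR -cabsE; exact: xy.
  by rewrite -ball_normE /=; apply: le_lt_trans xy; exact: gl.
have [a ha] := part (@complex.Re R) ltac:(by move=> x y; rewrite -raddfB; exact: Re_le_cabs).
have [b hb] := part (@complex.Im R) ltac:(by move=> x y; rewrite -raddfB; exact: Im_le_cabs).
by apply/cvg_ex; exists (a +i* b : K^o); apply: (@cvg_complex _ F _ id).
Qed.

(* [K^o] itself already carries a completeness instance keyed on real types. *)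
Definition scalars : Type := K^o.
HB.instance Definition _ := NormedModule.copy scalars K^o.
HB.instance Definition _ := Uniform_isComplete.Build scalars complex_complete.

End complex_topology.

(** * Functions on a compact space as combinations of unitaries *)

Section real_functions.
Variables (R : realType) (X : topologicalType).
Local Notation K := R[i].
Local Notation CX := (contfun K X).

Fact real_cf_subproof (f : X -> R) : continuous f ->
  continuous (fun x => (f x)%:C : K^o).
Proof.
move=> cf x; apply: cvg_complex; first exact: cf.
exact: cvg_cst.
Qed.
Definition real_cf (f : X -> R) (cf : continuous f) : CX :=
  mk_contfun (real_cf_subproof cf).

Lemma cts_cf (f : CX) : continuous (f : X -> K^o). Proof. exact: cts_fun. Qed.

Lemma Re_cf_cts (f : CX) : continuous (fun x => complex.Re (f x : K)).
Proof. by move=> x; apply: cvg_Re; exact: cts_cf. Qed.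

Lemma cabs_cf_cts (f : CX) : continuous (fun x => cabs (f x : K)).
Proof.
move=> x; apply/cvgrPdist_le => e e0.
have /cvg_cabs /(_ e e0) := @cts_cf f x; apply: filterS => y; apply: le_trans.
exact: cabs_dist.
Qed.

Hypothesis Xc : compact [set: X].

Lemma compact_real_bounded (f : X -> R) : continuous f ->
  exists2 M, 0 < M & forall x, f x <= M.
Proof.
move=> cf; have : bounded_set (f @` setT).
  apply: compact_bounded; apply: continuous_compact => //.
  exact: continuous_subspaceT.
move=> [M [_ hM]]; exists (Num.max 1 (M + 1)); first by rewrite lt_max ltr01.
move=> x; apply: le_trans (ler_norm _) _.
apply: hM; last by exists x.
by rewrite lt_max ltrDl ltr01 orbT.
Qed.

Lemma cf_bounded (f : CX) : exists2 M : R, 0 < M & forall x, cabs (f x : K) <= M.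
Proof. exact/compact_real_bounded/cabs_cf_cts. Qed.

(** Compactness bounds [f], so its real and imaginary parts scale into [[-1, 1]]. A real [g] in this
    range is the mean of [g + i sqrt (1 - g^2)] and its conjugate. *)
Lemma cf_unitary_span (f : CX) : exists l : seq (K * CX),
  (forall p, p \in l -> forall x, (p.2 x : K)^* * p.2 x = 1) /\
  f = \sum_(p <- l) p.1 *: p.2.
Proof.
have [M M0 hM] := cf_bounded f.
have self (g : CX) : (forall x, `|complex.Re (g x : K)| <= 1) ->
    (forall x, complex.Im (g x : K) = 0) ->
    exists w : CX, (forall x, (w x : K)^* * w x = 1) /\
       (forall x, g x = (2^-1 : K) * (w x + (w x : K)^*)).
  move=> g1 gr.
  pose r x := Num.sqrt (1 - complex.Re (g x : K) ^+ 2).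
  have cr : continuous r.
    move=> x; apply: continuous_comp; last exact: sqrt_continuous.
    apply: continuousB; first exact: cst_continuous.
    apply: (@continuous_comp _ _ _ (fun x => complex.Re (g x : K)) (fun t => t ^+ 2)).
      exact: Re_cf_cts.
    exact: exprn_continuous.
  exists (g + ('i%C : K) *: real_cf cr).
  have wE x : (g + ('i%C : K) *: real_cf cr) x = complex.Re (g x : K) +i* r x.
    rewrite cfD cfZ /=; have := gr x; case: (g x) => a b /= ->.
    by apply/eqP; rewrite eq_complex /= !(mul0r, mul1r, mulr0, subr0, addr0, add0r) !eqxx.
  have rr x : r x ^+ 2 = 1 - complex.Re (g x : K) ^+ 2.
    by rewrite sqr_sqrtr // subr_ge0 -(ger0_norm (sqr_ge0 _)) normrX expr_le1.
  split=> x; rewrite wE.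
    apply/eqP; rewrite eq_complex /=; apply/andP; split; apply/eqP.
      by have := rr x; nra.
    by ring.
  have := gr x; case: (g x) => a b /= ->.
  have -> : (a +i* r x : K) + (a +i* r x)^* = 2 * a%:C.
    by rewrite addcJ.
  by rewrite mulrA mulVf ?mul1r // pnatr_eq0.
have M0' : M%:C != 0 :> K by rewrite fmorph_eq0 gt_eqF.
pose g1 : CX := (2 * M%:C : K)^-1 *: (f + starop f).
pose g2 : CX := (2 * M%:C * 'i%C : K)^-1 *: (f - starop f).
have g1E x : g1 x = (complex.Re (f x : K) / M)%:C.
  rewrite cfZ cfD cfS; have -> : (f x : K) + (f x : K)^* = 2 * (complex.Re (f x : K))%:C.
    exact: addcJ.
  rewrite invfM mulrACA mulVf ?mul1r ?pnatr_eq0 // mulrC.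
  by rewrite rmorphM fmorphV.
have g2E x : g2 x = (complex.Im (f x : K) / M)%:C.
  rewrite cfZ cfD cfN cfS.
  have -> : (f x : K) - (f x : K)^* = 2 * (complex.Im (f x : K))%:C * 'i%C.
    exact: subcJ.
  have i0 : 'i%C != 0 :> K by rewrite eq_complex /= negb_and oner_eq0 orbT.
  rewrite rmorphM fmorphV /=; field.
  by rewrite i0 M0'.
have small (r : R) x : `|r| <= cabs (f x : K) -> `|r / M| <= 1.
  move=> h; rewrite normrM normfV (gtr0_norm M0) ler_pdivrMr // mul1r.
  exact: le_trans h (hM x).
have [w1 [u1 e1]] := self g1 ltac:(by move=> x; rewrite g1E /=; apply: small; exact: Re_le_cabs)
  ltac:(by move=> x; rewrite g1E).
have [w2 [u2 e2]] := self g2 ltac:(by move=> x; rewrite g2E /=; apply: small; exact: Im_le_cabs)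
  ltac:(by move=> x; rewrite g2E).
pose k : K := M%:C / 2.
exists [:: (k, w1); (k, starop w1); (k * 'i%C, w2); (k * 'i%C, starop w2)].
have us (w : CX) : (forall x, (w x : K)^* * w x = 1) ->
    forall x, ((starop w) x : K)^* * (starop w) x = 1.
  by move=> h x; rewrite cfS conjCK mulrC h.
split=> [p|].
  by rewrite !inE => /or4P[] /eqP-> //=; exact: us.
apply: contfunP => x; rewrite cf_sum !big_cons big_nil addr0 /fst /snd.
have -> : (f x : K) = M%:C * (g1 x + 'i%C * g2 x).
  rewrite g1E g2E {1}(complexE (f x)) !rmorphM !fmorphV /=; field.
  by rewrite M0'.
by rewrite e1 e2 !cfZ !cfS /k; field.
Qed.

End real_functions.

Section density.
Variables (R : realType) (V W : normedModType R[i]) (D : set V).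
Hypothesis D_dense : forall x e, 0 < e -> exists2 d, D d & rnorm (x - d) <= e.

Lemma lipschitz_eq (G H : V -> W) (C : R) :
  (forall x y, rnorm (G x - G y) <= C * rnorm (x - y)) ->
  (forall x y, rnorm (H x - H y) <= C * rnorm (x - y)) ->
  (forall d, D d -> G d = H d) -> G =1 H.
Proof.
move=> GC HC GH x; apply/eqP; rewrite -subr_eq0; apply/eqP/rnorm_small => e e0.
have C1 : 0 < `|C| + 1 by rewrite ltr_wpDl.
have [d Dd xd] := D_dense x (divr_gt0 (divr_gt0 e0 (ltr0Sn _ 1)) C1).
have le (F : V -> W) : (forall x y, rnorm (F x - F y) <= C * rnorm (x - y)) ->
    rnorm (F x - F d) <= e / 2.
  move=> FC; apply: le_trans (FC _ _) _.
  apply: le_trans (ler_wpM2r (rnorm_ge0 _) (ler_norm C)) _.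
  move: xd; rewrite ler_pdivlMr // => h; apply: le_trans h.
  by rewrite mulrC ler_wpM2l ?rnorm_ge0 // lerDl.
have -> : G x - H x = (G x - G d) + (H d - H x) by rewrite -(GH _ Dd) addrA subrK.
apply: le_trans (rnormD _ _) _; rewrite [leRHS](splitr e) lerD ?le //.
by rewrite rnormB le.
Qed.

End density.

(** * The completed skew Laurent polynomials and their universal property *)

Section crossed_product.
Variables (R : realType) (X : topologicalType) (s : homeo X X).
Local Notation K := R[i].
Local Notation CX := (contfun K X).
Local Notation skew := (skew_alg K s).
Hypothesis Xc : compact [set: X].

Lemma mono_unitary (w : CX) n : algmul (starop w) w = algone -> algmul w (starop w) = algone ->
  unitary (mono s w n : skew).
Proof.
move=> w1 w2; rewrite /unitary starmono !mulmono; split.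
  by rewrite -translateM w1 translate_one addNr.
by rewrite translateA addrN translate0 w2.
Qed.

Lemma skew_unitary_span (a : skew) : exists l : seq (K * skew),
  (forall p, p \in l -> unitary p.2) /\ a = \sum_(p <- l) p.1 *: p.2.
Proof.
elim/skew_ind: a => [|f n a [l [ul ->]]].
  by exists [::]; split=> //; rewrite big_nil.
have [k [uk ->]] := cf_unitary_span Xc f.
exists ([seq (p.1, mono s p.2 n : skew) | p <- k] ++ l); split=> [p|].
  rewrite mem_cat => /orP[/mapP[q /uk qu ->]|/ul //] /=.
  apply: mono_unitary; apply: contfunP => x; rewrite cfM cfS cf1 ?qu //.
  by rewrite mulrC qu.
rewrite big_cat big_map /=; congr (_ + _).
rewrite (big_morph (fun f : CX => mono s f n) (@monoD _ _ _ n) (mono0 _ _ _)).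
by apply: eq_bigr => p _; rewrite monoZ.
Qed.

Definition cp_seminorm : skew -> R := @full_seminorm R skew.
Definition cp_seminormP : cstar_seminorm cp_seminorm := full_cstar skew_unitary_span.
Definition cp_alg : cstarAlgType K := cstar_completion cp_seminormP.
Definition cp_in (a : skew) : cp_alg := compl_in cp_seminormP a.
Definition cp_fun (f : CX) : cp_alg := cp_in (mono s f 0).
Definition cp_unit : cp_alg := cp_in (mono s algone 1).

Lemma cp_in_morphism : star_morphism cp_in.
Proof. exact: compl_in_morphism. Qed.

Lemma cp_dense (x : cp_alg) (e : R) : 0 < e ->
  exists2 d, range cp_in d & rnorm (x - d) <= e.
Proof. by move=> /(compl_dense x)[a ha]; exists (cp_in a) => //; exists a. Qed.

Lemma cp_covariant : covariant s cp_fun cp_unit.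
Proof.
have [cD cZ cM c1 cS] := cp_in_morphism.
split.
- split=> [f g|k f|f g||f]; rewrite /cp_fun.
  + by rewrite monoD cD.
  + by rewrite monoZ cZ.
  + by rewrite -cM mulmono add0r translate0.
  + exact: c1.
  + by rewrite -cS starmono oppr0 translate0.
- have [h1 h2] : unitary (mono s algone 1 : skew).
    by apply: mono_unitary; apply: contfunP => x; rewrite cfM cfS cf1 conjC1 mulr1.
  by rewrite /unitary /cp_unit -cS -!cM h1 h2 c1.
- move=> f; rewrite /cp_fun /cp_unit -cS -!cM; congr cp_in.
  rewrite starmono !mulmono addr0 addrN; congr mono.
  apply: contfunP => x; rewrite !cfM cf1 mul1r !translateE cfS.
  by rewrite cf1 conjC1 mulr1.
Qed.

Lemma mono_upow n : mono s algone n = upow (mono s algone 1 : skew) n.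
Proof.
have h1 n' m : (mono s algone n' : skew) * mono s algone m = mono s algone (n' + m).
  by rewrite mulmono translate_one algmul1l.
have uu : unitary (mono s algone 1 : skew).
  by apply: mono_unitary; apply: contfunP => x; rewrite cfM cfS cf1 conjC1 mulr1.
elim/int_ind: n => [//|n IH|n IH]; first by rewrite intS -h1 upowS // IH.
have -> : - n.+1%:Z = -1 + - n%:Z by lia.
have e : starop (mono s algone 1 : skew) = mono s algone (-1).
  by rewrite starmono; congr mono; apply: contfunP => x; rewrite translateE cfS cf1 conjC1.
by rewrite (upowP uu) -IH e h1.
Qed.

Lemma cp_in_mono f n : cp_in (mono s f n) = cp_fun f * upow cp_unit n.
Proof.
have cM := star_morphM cp_in_morphism.
rewrite /cp_unit -(star_morphism_upow _ cp_in_morphism) -mono_upow -cM mulmono.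
by rewrite add0r translate0 algmul1r.
Qed.

Section universal.
Variables (B : cstarAlgType K) (j : CX -> B) (v : B).
Hypothesis jv : covariant s j v.

Let ev : skew -> B := skew_ev j v.
Let evP : star_morphism ev := skew_ev_morphism jv.

(** A covariant pair pulls the norm of [B] back to a C*-seminorm on the polynomials, and
    [cp_seminorm] is the largest of these. *)
Lemma cp_ev_le a : rnorm (ev a) <= cp_seminorm a.
Proof.
have [eD eZ eM e1 eS] := evP.
apply: (le_full skew_unitary_span (q := fun a => rnorm (ev a))).
split=> [x y|k x|x y|x].
- by rewrite eD rnormD.
- by rewrite eZ rnormZ.
- by rewrite eM; exact: rnormM.
- by rewrite eM eS; exact: (csn_star (@rnorm_cstar _ B)).
Qed.

Definition cp_lift : cp_alg -> B := compl_ext (V := B) ev.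

Lemma cp_lift_in a : cp_lift (cp_in a) = ev a.
Proof.
by have [eD eZ _ _ _] := evP; apply: compl_ext_in => //; exact: cp_ev_le.
Qed.

Lemma cp_liftD : {morph cp_lift : x y / x + y}.
Proof.
by have [eD eZ _ _ _] := evP; apply: compl_extD => //; exact: cp_ev_le.
Qed.

Lemma cp_liftZ k : {morph cp_lift : x / k *: x}.
Proof.
by have [eD eZ _ _ _] := evP; apply: compl_extZ => //; exact: cp_ev_le.
Qed.

Lemma cp_lift_lip x y : rnorm (cp_lift x - cp_lift y) <= rnorm (x - y).
Proof.
have -> : cp_lift x - cp_lift y = cp_lift (x - y).
  by rewrite cp_liftD -scaleN1r cp_liftZ scaleN1r.
by have [eD eZ _ _ _] := evP; apply: compl_ext_le => //; exact: cp_ev_le.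
Qed.

Lemma cp_lift_morphism : star_morphism cp_lift.
Proof.
have [eD eZ eM e1 eS] := evP; have [cD cZ cM c1 cS] := cp_in_morphism.
have le1 (x y c : cp_alg) : rnorm (cp_lift (x * c) - cp_lift (y * c)) <= rnorm c * rnorm (x - y).
  by apply: le_trans (cp_lift_lip _ _) _; rewrite -mulrBl mulrC rnormM.
have le2 (x y c : cp_alg) : rnorm (cp_lift (c * x) - cp_lift (c * y)) <= rnorm c * rnorm (x - y).
  by apply: le_trans (cp_lift_lip _ _) _; rewrite -mulrBr rnormM.
have z : cp_lift 0 = 0 by rewrite -(scale0r 0) cp_liftZ scale0r.
have lc c : rnorm (cp_lift c) <= rnorm c.
  by have := cp_lift_lip c 0; rewrite z !subr0.
have le3 (x y c : cp_alg) : rnorm (cp_lift x * cp_lift c - cp_lift y * cp_lift c) <= rnorm c * rnorm (x - y).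
  rewrite -mulrBl mulrC; apply: le_trans (rnormM _ _) _.
  by apply: ler_pM; [exact: rnorm_ge0|exact: rnorm_ge0|exact: cp_lift_lip|exact: lc].
have le4 (x y c : cp_alg) : rnorm (cp_lift c * cp_lift x - cp_lift c * cp_lift y) <= rnorm c * rnorm (x - y).
  rewrite -mulrBr; apply: le_trans (rnormM _ _) _.
  by apply: ler_pM; [exact: rnorm_ge0|exact: rnorm_ge0|exact: lc|exact: cp_lift_lip].
split.
- exact: cp_liftD.
- exact: cp_liftZ.
- move=> x y.
  (* Multiplicativity is extended by density in one factor at a time, with the right factor in the
     dense subalgebra at this stage. *)
  have h1 b z' : cp_lift (z' * cp_in b) = cp_lift z' * cp_lift (cp_in b).
    apply: (@lipschitz_eq _ cp_alg B _ cp_dense (fun x : cp_alg => cp_lift (x * cp_in b))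
      (fun x => cp_lift x * cp_lift (cp_in b)) (rnorm (cp_in b))) => [t t'|t t'|_ [a _ <-]].
    + exact: le1.
    + exact: le3.
    by rewrite -cM !cp_lift_in eM.
  apply: (@lipschitz_eq _ cp_alg B _ cp_dense (fun y : cp_alg => cp_lift (x * y))
      (fun y => cp_lift x * cp_lift y) (rnorm x)) => [t t'|t t'|_ [a _ <-]].
  + exact: le2.
  + exact: le4.
  exact: h1.
- by rewrite -c1 cp_lift_in e1.
- move=> x; apply: (@lipschitz_eq _ _ _ _ cp_dense (fun x => cp_lift (starop x)) (fun x => starop (cp_lift x)) 1) => [y z'|y z'|_ [a _ <-]].
  + by rewrite mul1r; apply: le_trans (cp_lift_lip _ _) _; rewrite -starB rnorm_star.
  + by rewrite mul1r -starB rnorm_star cp_lift_lip.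
  by rewrite -cS !cp_lift_in eS.
Qed.

End universal.

Lemma star_morphism_lip (A B : cstarAlgType K) (f : A -> B) : star_morphism f ->
  forall x y, rnorm (f x - f y) <= 1 * rnorm (x - y).
Proof.
move=> fM x y; have -> : f x - f y = f (x - y).
  rewrite (star_morphD fM); congr (_ + _).
  by rewrite -(scaleN1r y) (star_morphZ fM) scaleN1r.
by rewrite mul1r; exact: star_morphism_le.
Qed.

Lemma cp_universal : is_crossed_product s cp_fun cp_unit.
Proof.
split; first exact: cp_covariant.
move=> B j v jv; exists (cp_lift j v); split.
  split; first exact: cp_lift_morphism.
  - apply/funext => f /=; rewrite /cp_fun (cp_lift_in jv) (skew_ev_mono jv).
    by rewrite upow0 mulr1.
  - rewrite /cp_unit (cp_lift_in jv) (skew_ev_mono jv) upow1.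
    by case: jv => -[_ _ _ j1 _] _ _; rewrite [j _]j1 mul1r.
move=> L [LM Li Lu]; apply/funext.
apply: (lipschitz_eq cp_dense (star_morphism_lip (cp_lift_morphism jv)) (star_morphism_lip LM)).
move=> _ [a _ <-]; rewrite (cp_lift_in jv).
have [cD cZ cM c1 cS] := cp_in_morphism.
move: a; apply: skew_lsum_ext => [a b|a b|f n].
- exact: skew_evD.
- by rewrite cD (star_morphD LM).
rewrite (skew_ev_mono jv) cp_in_mono (star_morphM LM) -Li /=; congr (_ * _).
by rewrite (star_morphism_upow _ LM) Lu.
Qed.

(** [state_le_full] lets a state of the polynomials extend to the completion. Only linearity and
    contractivity of the extension are recorded. *)
Lemma cp_state (phi : skew -> K) : state phi -> exists r : cp_alg -> K,
  [/\ {morph r : x y / x + y}, forall k, {morph r : x / k *: x >-> k * x},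
      forall x, cabs (r x) <= rnorm x & forall a, r (cp_in a) = phi a].
Proof.
move=> phiS.
have pD : {morph (phi : skew -> scalars R) : x y / x + y} := stateD phiS.
have pZ k : {morph (phi : skew -> scalars R) : x / k *: x} := stateZ phiS k.
have ple (a : skew) : rnorm (phi a : scalars R) <= cp_seminorm a.
  exact: (state_le_full skew_unitary_span a phiS).
exists (compl_ext (V := scalars R) phi); split.
- exact: (@compl_extD _ _ _ cp_seminormP (scalars R) phi pD pZ ple).
- exact: (@compl_extZ _ _ _ cp_seminormP (scalars R) phi pD pZ ple).
- exact: (@compl_ext_le _ _ _ cp_seminormP (scalars R) phi pD pZ ple).
- exact: (@compl_ext_in _ _ _ cp_seminormP (scalars R) phi pD pZ ple).
Qed.

End crossed_product.

(** * Winding numbers *)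

Section winding.
Variable R : realType.
Local Notation K := R[i].
Implicit Types (t s : R) (G H : R -> K).

Definition circ t : K := cos (2 * pi * t) +i* sin (2 * pi * t).

Lemma circD s t : circ (s + t) = circ s * circ t.
Proof.
rewrite /circ mulrDr cosD sinD; apply/eqP; rewrite eq_complex /=.
by rewrite eqxx /= [X in _ == X]addrC (mulrC (sin _)) eqxx.
Qed.

Lemma circ0 : circ 0 = 1.
Proof. by rewrite /circ mulr0 cos0 sin0. Qed.

Lemma circ1 : circ 1 = 1.
Proof. by rewrite /circ mulr1 mulr2n mulrDl !mul1r -mulr2n cos2pi sin2pi. Qed.

Lemma circN t : circ (- t) = (circ t)^*.
Proof. by rewrite /circ mulrN cosN sinN. Qed.

Lemma circ_conj t : circ t * (circ t)^* = 1.
Proof. by rewrite -circN -circD subrr circ0. Qed.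

Lemma cabs_circ t : cabs (circ t) = 1.
Proof.
apply/eqP; rewrite -(eqrXn2 (n := 2)) ?cabs_ge0 // expr1n.
by rewrite -(inj_eq (@complexI R)) cabs_sqr circ_conj.
Qed.

Lemma circ_int (n : int) : circ n%:~R = 1.
Proof.
elim/int_ind: n => [|n IH|n IH]; first by rewrite circ0.
  by rewrite intS rmorphD circD IH mulr1 circ1.
have -> : - n.+1%:Z = -1 + - n%:Z by lia.
by rewrite rmorphD circD IH mulr1 rmorphN circN circ1 conjC1.
Qed.

Lemma circ_eq1 t : circ t = 1 -> exists n : int, t = n%:~R.
Proof.
move=> h; exists (Num.floor t).
have [f1 f2] : (Num.floor t)%:~R <= t /\ t < (Num.floor t)%:~R + 1.
  by split; [exact: floor_le | rewrite -(intrD1); exact: floorD1_gt].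
set r := t - (Num.floor t)%:~R.
have r0 : 0 <= r < 1 by rewrite subr_ge0 f1 /= ltrBlDl.
suff : r = 0 by move=> /eqP; rewrite subr_eq0 => /eqP.
have : circ r = 1.
  by rewrite /r circD h mul1r -rmorphN circ_int.
move=> [c1 s1]; have pi0 := pi_gt0 R.
case/andP: r0 => r0 r1.
(* the half-angle has sine 0 *)
have s2 : sin (pi * r) ^+ 2 = 0.
  have : cos (pi * r + pi * r) = 1 by rewrite -mulrDl -mulr2n -mulr_natl.
  by rewrite cosD -!expr2 => h1; have := cos2Dsin2 (pi * r); lra.
apply/eqP; rewrite eq_le r0 andbT leNgt; apply/negP => r2.
have : 0 < sin (pi * r).
  by apply: sin_gt0_pi; rewrite mulr_gt0 //= gtr_pMr.
by move/eqP: s2; rewrite sqrf_eq0 => /eqP->; rewrite ltxx.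
Qed.

Lemma circ_surj (w : K) : cabs w = 1 -> exists t, w = circ t.
Proof.
move=> w1; have : (cabs w ^+ 2)%:C = 1 by rewrite w1 expr1n.
rewrite cabs_sqr; case: w w1 => a b _ [ab _].
have {}ab : a ^+ 2 + b ^+ 2 = 1 by rewrite -ab; ring.
have pi0 := pi_gt0 R.
have a1 : -1 <= a <= 1 by apply/andP; split; nra.
have e (x : R) : 2 * pi * (x / (2 * pi)) = x by rewrite mulrC divfK // mulf_neq0 ?pnatr_eq0 // gt_eqF.
have sb : Num.sqrt (1 - a ^+ 2) = `|b|.
  by rewrite -ab addrAC subrr add0r sqrtr_sqr.
have [b0|b0] := leP 0 b.
  exists (acos a / (2 * pi)); rewrite /circ e acosK ?in_itv //= sin_acos // sb.
  by rewrite ger0_norm.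
exists (- acos a / (2 * pi)); rewrite /circ e cosN sinN acosK ?in_itv //= sin_acos // sb.
by rewrite ltr0_norm // opprK.
Qed.

Lemma circ_cts : continuous (fun t => circ t : K^o).
Proof.
move=> t; apply: cvg_complex => /=; apply: continuous_comp.
- by apply: cvgMr; exact: cvg_id.
- exact: continuous_cos.
- by apply: cvgMr; exact: cvg_id.
- exact: continuous_sin.
Qed.

(** The argument on the right half of the unit circle, in units of a full turn. *)
Definition clog (w : K) : R := asin (complex.Im w) / (2 * pi).

Lemma clogK (w : K) : cabs w = 1 -> cabs (w - 1) < 1 -> circ (clog w) = w.
Proof.
move=> w1 h; have : (cabs w ^+ 2)%:C = 1 by rewrite w1 expr1n.
rewrite cabs_sqr; case: w w1 h => a b _ h [ab _].
have {}ab : a ^+ 2 + b ^+ 2 = 1 by rewrite -ab; ring.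
have a0 : 0 < a.
  have := le_lt_trans (Re_le_cabs _) h; rewrite /= ltr_norml => /andP[]; lra.
have pi0 := pi_gt0 R.
have e (x : R) : 2 * pi * (x / (2 * pi)) = x by rewrite mulrC divfK // mulf_neq0 ?pnatr_eq0 // gt_eqF.
have b1 : -1 <= b <= 1 by apply/andP; split; nra.
rewrite /circ /clog e /= asinK ?in_itv //= cos_asin //.
by rewrite -ab addrK sqrtr_sqr gtr0_norm.
Qed.

Lemma clog_cvg (T : Type) (F : set_system T) {FF : Filter F} (f : T -> K^o) (w : K^o) :
  cabs (w : K) = 1 -> cabs (w - 1 : K) < 1 -> f @ F --> w ->
  (fun x => clog (f x)) @ F --> clog w.
Proof.
move=> w1 h fw; rewrite /clog; apply: cvgMl.
apply: (cvg_comp (fun x => complex.Im (f x : K)) _ (cvg_Im fw)).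
apply: continuous_asin.
have : (cabs (w : K) ^+ 2)%:C = 1 by rewrite w1 expr1n.
rewrite cabs_sqr; move: h {w1 fw}; case: (w : K) => a b h [ab _] /=.
have {}ab : a ^+ 2 + b ^+ 2 = 1 by rewrite -ab; ring.
have a0 : 0 < a.
  have := le_lt_trans (Re_le_cabs _) h; rewrite /= ltr_norml => /andP[]; lra.
by apply/andP; split; nra.
Qed.

(** If the two end values differed, the intermediate value theorem would produce the smaller one
    plus one half, which is not an integer. *)
Lemma int_valued_const (D : R -> R) a b : a <= b ->
  (forall t, a <= t <= b -> {for t, continuous D}) ->
  (forall t, a <= t <= b -> circ (D t) = 1) -> D a = D b.
Proof.
move=> ab Dc D1; apply: contrapT => /eqP nD.
have [na ea] := circ_eq1 (D1 a ltac:(by rewrite lexx)).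
have [nb eb] := circ_eq1 (D1 b ltac:(by rewrite lexx andbT)).
pose m : R := Num.min (D a) (D b) + 2^-1.
have mE : exists n : int, m = n%:~R + 2^-1.
  by rewrite /m; case: leP => _; [exists na; rewrite ea|exists nb; rewrite eb].
have hm : Num.min (D a) (D b) <= m <= Num.max (D a) (D b).
  rewrite /m lerDl invr_ge0 ler0n /=; move: nD; rewrite ea eb eqr_int.
  rewrite /Num.min /Num.max !ltr_int.
  case: (ltrgtP na nb) => // h _; move: h; rewrite -lezD1 -(ler_int R) rmorphD /=; lra.
have Dw : {within `[a, b], continuous D}.
  apply: continuous_in_subspaceT => t; rewrite inE /= in_itv /= => tab.
  exact: Dc.
have [c cab Dm] := IVT ab Dw hm.
have [n en] := circ_eq1 (D1 c ltac:(by move: cab; rewrite in_itv)).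
have [k ek] := mE; move: Dm; rewrite en ek => /eqP.
rewrite addrC -subr_eq -intrB => /eqP h.
have h0 : (0 : R) < (n - k)%:~R by rewrite h invr_gt0 ltr0n.
have h1 : (n - k)%:~R < (1 : R) by rewrite h invf_lt1 ?ltr1n ?ltr0n.
by move: h0 h1; rewrite ltr0z ltrz1; lia.
Qed.

Lemma circ_inj_cts (a b : R -> R) (l r : R) : l <= r ->
  (forall t, l <= t <= r -> {for t, continuous a}) ->
  (forall t, l <= t <= r -> {for t, continuous b}) ->
  (forall t, l <= t <= r -> circ (a t) = circ (b t)) -> a r - b r = a l - b l.
Proof.
move=> lr ac bc ab; symmetry.
apply: (@int_valued_const (fun t => a t - b t)) => // t h.
  by apply: cvgB; [exact: ac | exact: bc].
by rewrite circD circN (ab t h) circ_conj.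
Qed.

Definition loop G := [/\ continuous (G : R -> K^o), forall t, cabs (G t) = 1 &
  forall t, G (t + 1) = G t].

Definition degree G (n : int) := exists a : R -> R,
  [/\ continuous a, forall t, a (t + 1) = a t + n%:~R & forall t, G t = circ (a t)].

(** Uniform continuity on [[-L, L]], for the single threshold 1 below which [clog] inverts
    [circ]. *)
Lemma heine (G : R -> K) (L : R) : continuous (G : R -> K^o) ->
  exists2 d : R, 0 < d & forall s t, `|s| <= L -> `|s - t| <= d -> cabs (G s - G t) < 1.
Proof.
move=> Gc.
have : compact `[- L, L] by exact: segment_compact.
move=> /compact_near_coveringP h.
have {}h : \forall d \near (0 : R), `[- L, L] `<=` (fun s => forall t, `|s - t| <= `|d| -> cabs (G s - G t) < 1).
  apply: (h R (nbhs (0 : R)) (fun d s => forall t, `|s - t| <= `|d| -> cabs (G s - G t) < 1)) => x _.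
  have /cvg_cabs /(_ (2^-1 / 2)) := Gc x; rewrite divr_gt0 ?invr_gt0 // => /(_ isT).
  move=> /nbhs_ballP[e /= e0 he].
  exists (ball x (e / 2), ball 0 (e / 2)).
    by split; apply: nbhsx_ballx; rewrite divr_gt0.
  move=> [y d] /= []; rewrite -!ball_normE /= sub0r normrN => xy de t yt.
  have h1 := he y; have h2 := he t; move: h1 h2; rewrite -!ball_normE /=.
  have h3 : `|x - y| < e by lra.
  have h4 : `|x - t| < e.
    have -> : x - t = (x - y) + (y - t) by rewrite addrA subrK.
    by apply: le_lt_trans (ler_normD _ _) _; lra.
  move=> /(_ h3) h1 /(_ h4) h2.
  have -> : G y - G t = (G x - G t) - (G x - G y).
    by rewrite opprB [RHS]addrC addrA subrK.
  apply: le_lt_trans (cabsD _ _) _.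
  have -> : cabs (- (G x - G y)) = cabs (G x - G y) by rewrite /cabs normrN.
  by move: h1 h2; lra.
move: h => /nbhs_ballP[e /= e0 he]; exists (e / 2); first by rewrite divr_gt0.
move=> s t sL st.
have : ball (0 : R) e (e / 2).
  by rewrite -ball_normE /= sub0r normrN gtr0_norm ?divr_gt0 // ltr_pdivrMr // ltr_pMr // ltr1n.
move=> /he /(_ s); rewrite /= in_itv /= -ler_norml => /(_ sL); apply.
by apply: le_trans st _; exact: ler_norm.
Qed.

(** Cut the segment from 0 to [t] into [M.+1] equal steps, short enough for [heine]. The ratio of
    [G t] to [G 0] telescopes into ratios of consecutive values, each at distance less than 1 from
    1; the lift is the sum of their logarithms. *)
Lemma lift_on G (L : R) : continuous (G : R -> K^o) -> (forall t, cabs (G t) = 1) ->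
  exists b : R -> R, [/\ b 0 = 0, forall t, `|t| < L -> {for t, continuous b} &
     forall t, `|t| < L -> G t = G 0 * circ (b t)].
Proof.
move=> Gc G1; have [d d0 hd] := heine L Gc.
have GJ t : G t * (G t)^* = 1 by rewrite -cabs_sqr G1 expr1n.
have [M hM] : exists M : nat, `|L| / d < M.+1%:R.
  exists (Num.bound (`|L| / d)); apply: lt_le_trans (archi_boundP _) _.
    by rewrite divr_ge0 // ltW.
  by rewrite ler_nat.
pose x (j : nat) t := j%:R * t / M.+1%:R.
pose q j t : K := G (x j.+1 t) * (G (x j t))^*.
have M0 : 0 < M.+1%:R :> R by rewrite ltr0n.
have q1 j t : cabs (q j t) = 1 by rewrite cabsM cabs_conj !G1 mulr1.
have qs j t : (j < M.+1)%N -> `|t| < L -> cabs (q j t - 1) < 1.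
  move=> jM tL.
  have -> : q j t - 1 = (G (x j.+1 t) - G (x j t)) * (G (x j t))^*.
    by rewrite mulrBl GJ.
  rewrite cabsM cabs_conj G1 mulr1; apply: hd.
    rewrite /x normrM normfV (gtr0_norm M0) ler_pdivrMr // normrM ger0_norm //.
    rewrite mulrC; apply: ler_pM => //; first exact: ltW.
    by rewrite ler_nat.
  rewrite /x -mulrBl -mulrBl -natrB // subSnn mul1r normrM normfV (gtr0_norm M0).
  rewrite ler_pdivrMr // mulrC -ler_pdivrMr //.
  apply: le_trans (ltW hM); rewrite ler_wpM2r ?invr_ge0 ?(ltW d0) //.
  by apply: le_trans (ltW tL) _; exact: ler_norm.
exists (fun t => \sum_(j < M.+1) clog (q j t)); split.
- rewrite big1 // => j _; rewrite /q /x !mulr0 !mul0r GJ /clog /=.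
  have -> : asin (0 : R) = 0.
    by rewrite -[X in asin X]sin0 sinK // in_itv /= oppr_le0 divr_ge0 ?pi_ge0.
  by rewrite mul0r.
- move=> t tL.
  have cs (r : seq 'I_M.+1) : (forall j : 'I_M.+1, {for t, continuous (fun t => clog (q j t))}) ->
      (fun t => \sum_(j <- r) clog (q j t)) @ t --> \sum_(j <- r) clog (q j t).
    move=> cj; elim: r => [|j r IH].
      by under eq_fun do rewrite big_nil; rewrite big_nil; exact: cvg_cst.
    under eq_fun do rewrite big_cons; rewrite big_cons.
    by apply: cvgD; [exact: cj|exact: IH].
  apply: cs => j; apply: clog_cvg; [exact: q1 | exact: qs|].
  have cx k : {for t, continuous (fun t => G (x k t) : K^o)}.
    apply: (@continuous_comp _ _ _ (x k) (G : R -> K^o)); last exact: Gc.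
    by apply: cvgMl; apply: cvgMr; exact: cvg_id.
  apply: cvgM; first exact: cx.
  apply/cvg_cabs => e e0; have /cvg_cabs /(_ e e0) := cx j.
  by apply: filterS => y; rewrite -cabs_conj rmorphB.
- move=> t tL.
  rewrite (big_morph circ circD circ0).
  under eq_bigr => j _ do rewrite clogK ?q1 ?qs //.
  have -> : G t = G (x M.+1 t) by rewrite /x mulrAC divff ?mul1r // gt_eqF.
  have : forall m : nat, G 0 * \prod_(j < m) q j t = G (x m t).
    elim=> [|m IH]; first by rewrite big_ord0 mulr1 /x !mul0r.
    by rewrite big_ord_recr /= mulrA IH /q mulrCA GJ mulr1.
  by move=> ->.
Qed.

(** The lifts over [|t| < n], normalized at 0, agree where two of them are defined, so each [t] can
    use an [n] of its own. *)
Lemma lift_exists G : continuous (G : R -> K^o) -> (forall t, cabs (G t) = 1) ->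
  exists2 a : R -> R, continuous a & forall t, G t = circ (a t).
Proof.
move=> Gc G1; have [a0 ha0] := circ_surj (G1 0).
have hb (n : nat) := cid (lift_on n%:R Gc G1).
pose B n := sval (hb n).
have BP n : [/\ B n 0 = 0, forall t, `|t| < n%:R -> {for t, continuous (B n)} &
     forall t, `|t| < n%:R -> G t = G 0 * circ (B n t)] by rewrite /B; case: (hb n).
have G00 : G 0 != 0.
  by apply/eqP => g0; have := G1 0; rewrite g0 /cabs normr0 => /eqP; rewrite eq_sym oner_eq0.
have Beq n m t : `|t| < n%:R -> `|t| < m%:R -> B n t = B m t.
  have [n0 nc nG] := BP n; have [m0 mc mG] := BP m.
  move=> tn tm.
  have lt (s : R) (k : nat) : - `|t| <= s <= `|t| -> `|t| < k%:R -> `|s| < k%:R.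
    by rewrite -ler_norml; exact: le_lt_trans.
  have key (l r : R) : l <= r -> - `|t| <= l -> r <= `|t| -> B n r - B m r = B n l - B m l.
    move=> lr l1 r1; apply: circ_inj_cts => // s /andP[s1 s2];
      have hs : - `|t| <= s <= `|t| by rewrite (le_trans l1) //= (le_trans s2).
    - by apply: nc; exact: lt hs tn.
    - by apply: mc; exact: lt hs tm.
    by apply: (mulfI G00); have <- := nG s (lt _ _ hs tn); exact: mG (lt _ _ hs tm).
  apply/eqP; rewrite -subr_eq0; apply/eqP.
  have [t0|t0] := leP 0 t.
    by rewrite (key 0 t t0) ?oppr_le0 ?ler_norm // n0 m0 subrr.
  rewrite -(key t 0 (ltW t0)) ?n0 ?m0 ?subrr //.
  by rewrite lerNl -normrN; exact: ler_norm.
have bd (t : R) : `|t| < (Num.bound `|t|)%:R by apply: archi_boundP.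
exists (fun t => a0 + B (Num.bound `|t|) t).
  move=> t; apply: cvgD; first exact: cvg_cst.
  pose n := (Num.bound `|t|).
  have [_ nc _] := BP n; have := nc t (bd t).
  have e : (fun s => B (Num.bound `|s|) s) @ t --> B n t; last by [].
  apply: cvg_trans (nc t (bd t)).
  apply: near_eq_cvg.
  have : \forall s \near t, `|s| < n%:R.
    apply/nbhs_ballP; exists (n%:R - `|t|); first by rewrite /= subr_gt0 bd.
    move=> s; rewrite -ball_normE /= distrC => st.
    rewrite -(subrK t s); apply: le_lt_trans (ler_normD _ _) _.
    by rewrite -ltrBrDr.
  by apply: filterS => s sn; exact: Beq.
move=> t; rewrite circD -ha0; have [_ _ h] := BP (Num.bound `|t|).
exact: h.
Qed.

(** The increment of a lift over one period is continuous and integer-valued, hence constant. *)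
Lemma degree_exists G : loop G -> exists n, degree G n.
Proof.
move=> [Gc G1 Gp]; have [a ac aG] := lift_exists Gc G1.
have D t : circ (a (t + 1) - a t) = 1.
  by rewrite circD circN -!aG Gp aG circ_conj.
have Dc : continuous (fun t => a (t + 1) - a t).
  move=> t; apply: cvgB; last exact: ac.
  apply: (@continuous_comp _ _ _ (fun t => t + 1) a); last exact: ac.
  by apply: cvgD; [exact: cvg_id|exact: cvg_cst].
have [n en] := circ_eq1 (D 0).
exists n, a; split=> // t; rewrite -en.
suff -> : a (0 + 1) - a 0 = a (t + 1) - a t by rewrite [RHS]addrC subrK.
have [t0|/ltW t0] := leP 0 t.
  by apply: (@int_valued_const (fun t => a (t + 1) - a t)) => // s _; exact: Dc.
by symmetry; apply: (@int_valued_const (fun t => a (t + 1) - a t)) => // s _; exact: Dc.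
Qed.

Lemma degree_uniq G n m : degree G n -> degree G m -> n = m.
Proof.
move=> [a [ac an aG]] [b [bc bm bG]].
have h : a 1 - b 1 = a 0 - b 0.
  by apply: circ_inj_cts => // t _; [exact: ac|exact: bc|rewrite -aG -bG].
apply/eqP; rewrite -(eqr_int R); apply/eqP.
by have := an 0; have := bm 0; rewrite add0r; lra.
Qed.

Lemma degreeM G H n m : degree G n -> degree H m ->
  degree (fun t => G t * H t) (n + m).
Proof.
move=> [a [ac an aG]] [b [bc bm bG]]; exists (fun t => a t + b t); split=> [t|t|t].
- by apply: cvgD; [exact: ac|exact: bc].
- by rewrite an bm rmorphD /= addrACA.
- by rewrite aG bG circD.
Qed.

Lemma degree_circ (n : int) : degree (fun t => circ (n%:~R * t)) n.
Proof.
exists (fun t => n%:~R * t); split=> // [t|t]; last by rewrite mulrDr mulr1.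
by apply: cvgMr; exact: cvg_id.
Qed.

Lemma degree_cst (k : K) : cabs k = 1 -> degree (fun=> k) 0.
Proof.
move=> /circ_surj[a ->]; exists (fun=> a); split=> // t; first exact: cvg_cst.
by rewrite addr0.
Qed.

Lemma degree_loop G n : degree G n -> loop G.
Proof.
move=> [a [ac an aG]]; have -> : G = fun t => circ (a t) by apply/funext.
split=> [t|t|t]; last by rewrite an circD circ_int mulr1.
- apply: (@continuous_comp _ _ _ a (fun t => circ t : K^o)); first exact: ac.
  exact: circ_cts.
- exact: cabs_circ.
Qed.

(** The quotient of [H] by [G] stays at distance less than 1 from 1, so [clog] provides a periodic
    lift of it and its degree is 0. *)
Lemma degree_close G H n : degree G n -> loop H ->
  (forall t, cabs (H t - G t) < 1) -> degree H n.
Proof.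
move=> Gn Hl HG; have [Hc H1 Hp] := Hl; have [Gc G1 Gp] := degree_loop Gn.
have GJ t : G t * (G t)^* = 1 by rewrite -cabs_sqr G1 expr1n.
pose q t := H t * (G t)^*.
have q1 t : cabs (q t) = 1 by rewrite cabsM cabs_conj H1 G1 mulr1.
have qs t : cabs (q t - 1) < 1.
  by rewrite -(GJ t) -mulrBl cabsM cabs_conj G1 mulr1.
have q0 : degree q 0.
  exists (fun t => clog (q t)); split=> t; last by rewrite clogK.
    apply: clog_cvg => //; apply: cvgM; first exact: Hc.
    apply/cvg_cabs => e e0; have /cvg_cabs /(_ e e0) := Gc t.
    by apply: filterS => y; rewrite -cabs_conj rmorphB.
  by rewrite addr0 /q Hp Gp.
have := degreeM q0 Gn; rewrite add0r; congr degree; apply/funext => t.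
by rewrite /q -mulrA [_^* * _]mulrC GJ mulr1.
Qed.

(** A lift gains one and the same integer over every step of length [1/p], and [p] such steps make a
    full period. *)
Lemma degree_periodic G n (p : nat) : degree G n -> (0 < p)%N ->
  (forall t, G (t + p%:R^-1) = G t) ->
  exists a (j : int), [/\ continuous a, forall t, G t = circ (a t),
    forall t, a (t + p%:R^-1) = a t + j%:~R & n = p%:Z * j].
Proof.
move=> [a [ac an aG]] p0 Gp; exists a.
have Dc : continuous (fun t => a (t + p%:R^-1) - a t).
  move=> t; apply: cvgB; last exact: ac.
  apply: (@continuous_comp _ _ _ (fun t => t + p%:R^-1) a); last exact: ac.
  by apply: cvgD; [exact: cvg_id|exact: cvg_cst].
have D t : circ (a (t + p%:R^-1) - a t) = 1.
  by rewrite circD circN -!aG Gp aG circ_conj.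
have [j ej] := circ_eq1 (D 0); exists j.
have aj t : a (t + p%:R^-1) = a t + j%:~R.
  rewrite -ej.
  suff -> : a (0 + p%:R^-1) - a 0 = a (t + p%:R^-1) - a t by rewrite [RHS]addrC subrK.
  have [t0|/ltW t0] := leP 0 t.
    by apply: (@int_valued_const (fun t => a (t + p%:R^-1) - a t)) => // s _; exact: Dc.
  by symmetry; apply: (@int_valued_const (fun t => a (t + p%:R^-1) - a t)) => // s _; exact: Dc.
have am (m : nat) t : a (t + m%:R / p%:R) = a t + (m%:Z * j)%:~R.
  elim: m t => [|m IH] t; first by rewrite !mul0r !addr0.
  rewrite -natr1 mulrDl mul1r addrA aj IH -addrA -rmorphD /=.
  by congr (_ + _%:~R); rewrite intS; ring.
split=> //; apply/eqP; rewrite -(eqr_int R); apply/eqP.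
have := am p 0; rewrite divff ?pnatr_eq0 -?lt0n // an => /addrI ->.
by [].
Qed.

End winding.

(** * Fibre functionals of a crossed product *)

Section weights.
Variables (R : realType) (X : topologicalType) (s : homeo X X).
Local Notation K := R[i].
Local Notation CX := (contfun K X).
Local Notation skew := (skew_alg K s).

(** For [omega] positive definite and supported on the isotropy of [y], the state over [y] which
    [omega] induces. *)
Definition weight_form (omega : int -> K) (y : X) (a : skew) : K :=
  lsum (fun n f => omega n * f y) a.

Lemma weight_additive (omega : int -> K) (y : X) (n : int) :
  {morph (fun f : CX => omega n * f y) : f g / f + g}.
Proof. by move=> f g; rewrite cfD mulrDr. Qed.

Lemma weight_formD omega y : {morph weight_form omega y : a b / a + b}.
Proof. exact: lsumD (weight_additive omega y). Qed.

Lemma weight_form_mono omega y f n :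
  weight_form omega y (mono s f n) = omega n * f y.
Proof. exact: lsum_mono (weight_additive omega y) _ _. Qed.

Lemma weight_formZ omega y k :
  {morph weight_form omega y : a / k *: a >-> k * a}.
Proof.
apply: skew_lsum_ext => [a b|a b|f n].
- by rewrite scalerDr weight_formD.
- by rewrite weight_formD mulrDr.
by rewrite -monoZ !weight_form_mono cfZ mulrCA.
Qed.

Lemma weight_state omega y : omega 0 = 1 ->
  (forall n, omega n != 0 -> int_iter s n y = y) ->
  (forall (r : seq int) (c : int -> K),
     0 <= \sum_(n <- r) \sum_(m <- r) omega (m - n) * ((c n)^* * c m)) ->
  state (weight_form omega y).
Proof.
move=> o0 oS pos; split.
- exact: weight_formD.
- exact: weight_formZ.
- move=> a; rewrite {1 2}(skewE a) star_sum mulr_suml.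
  under eq_bigr do rewrite mulr_sumr.
  have -> (F : int -> int -> skew) :
     weight_form omega y (\sum_(n <- skew_supp a) \sum_(m <- skew_supp a) F n m) =
     \sum_(n <- skew_supp a) \sum_(m <- skew_supp a) weight_form omega y (F n m).
    rewrite /weight_form (lsum_sum (weight_additive omega y)); apply: eq_bigr => n _.
    exact: (lsum_sum (weight_additive omega y)).
  (* Evaluating [starop a * a] at [y] reads both coefficients at [s^n y]. Where [omega (m - n)] is
     nonzero, [s^n y = s^m y], so the [m]-th one may be read at [s^m y]. *)
  have := pos (skew_supp a) (fun n => a n (int_iter s n y)).
  congr (0 <= _); apply: eq_bigr => n _; apply: eq_bigr => m _.
  rewrite starmono mulmono weight_form_mono [- n + m]addrC.
  have [->|o] := eqVneq (omega (m - n)) 0; first by rewrite !mul0r.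
  rewrite cfM !translateE opprK cfS; congr (_ * (_ * a m _)).
  by rewrite -{1}(subrK n m) addrC int_iterD oS.
- by rewrite -(mono_one K s) weight_form_mono o0 mul1r.
Qed.

(* The double sum splits over the fibres of [key], each contributing the
   squared modulus of a sum. *)
Lemma key_sum_ge0 (I T : eqType) (key : I -> T) (r : seq I) (c : I -> K) :
  0 <= \sum_(i <- r) \sum_(j <- r) (key i == key j)%:R * ((c i)^* * c j).
Proof.
pose S := undup (map key r).
have -> : \sum_(i <- r) \sum_(j <- r) (key i == key j)%:R * ((c i)^* * c j) =
    \sum_(t <- S) (\sum_(i <- r) (key i == t)%:R * c i)^* *
       (\sum_(j <- r) (key j == t)%:R * c j).
  transitivity (\sum_(t <- S) \sum_(i <- r) \sum_(j <- r)
        (key i == t)%:R * (key j == t)%:R * ((c i)^* * c j)).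
    rewrite [RHS]exchange_big; apply: eq_big_seq => i ir.
    rewrite [RHS]exchange_big; apply: eq_big_seq => j jr.
    rewrite -mulr_suml; congr (_ * _).
    rewrite (bigD1_seq (key i)) ?undup_uniq //= ?mem_undup ?map_f //.
    rewrite eqxx mul1r eq_sym big1 ?addr0 // => t.
    by rewrite eq_sym => /negbTE->; rewrite mul0r.
  apply: eq_bigr => t _; rewrite rmorph_sum mulr_suml; apply: eq_bigr => i _.
  rewrite mulr_sumr; apply: eq_bigr => j _.
  by rewrite rmorphM rmorph_nat mulrACA.
by apply: sumr_ge0 => t _; rewrite mulrC mul_conjC_ge0.
Qed.

Definition stab (y : X) (n : int) : bool := int_iter s n y == y.

Lemma stabP y n : reflect (int_iter s n y = y) (stab y n). Proof. exact: eqP. Qed.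

Lemma stab0 y : stab y 0. Proof. exact/stabP. Qed.

Lemma stabD y n m : stab y n -> stab y m -> stab y (n + m).
Proof. by move=> /stabP hn /stabP hm; apply/stabP; rewrite int_iterD hm hn. Qed.

Lemma stabN y n : stab y n -> stab y (- n).
Proof. by move=> /stabP hn; apply/stabP; rewrite -{1}hn int_iterK. Qed.

Lemma stab_sub y n m : stab y (m - n) = (int_iter s n y == int_iter s m y).
Proof.
apply/stabP/eqP => [h|h].
  by rewrite -(subrK n m) addrC int_iterD h.
by rewrite addrC int_iterD -h int_iterK.
Qed.

Definition circz (n : int) (t : R) : K := circ (n%:~R * t).

Lemma circzD n m t : circz (n + m) t = circz n t * circz m t.
Proof. by rewrite /circz intrD mulrDl circD. Qed.

Lemma circz0 t : circz 0 t = 1.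
Proof. by rewrite /circz mul0r circ0. Qed.

Lemma circzN n t : circz (- n) t = (circz n t)^*.
Proof. by rewrite /circz intrN mulNr circN. Qed.

Lemma cabs_circz n t : cabs (circz n t) = 1. Proof. exact: cabs_circ. Qed.

(** Evaluation at [y] after the conditional expectation onto the functions. The exponent is its own
    key, so only the diagonal terms remain. *)
Lemma coefficient_state y : state (weight_form (fun n => (n == 0)%:R) y).
Proof.
apply: weight_state => [//|n /=|r c]; first by case: (n =P 0) => [->|_]; rewrite ?eqxx.
have := key_sum_ge0 id r c; congr (0 <= _).
by apply: eq_bigr => n _; apply: eq_bigr => m _; rewrite subr_eq0 eq_sym.
Qed.

(** The state attached to a character of the isotropy of [y]. Two exponents interact exactly when
    they send [y] to the same point, which serves as key. *)
Lemma point_state y t : state (weight_form (fun n => (stab y n)%:R * circz n t) y).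
Proof.
apply: weight_state => [|n|r c].
- by rewrite stab0 circz0 mulr1.
- by case: stabP => // _; rewrite mul0r eqxx.
have := key_sum_ge0 (fun n => int_iter s n y) r (fun n => circz n t * c n).
congr (0 <= _).
apply: eq_bigr => n _; apply: eq_bigr => m _.
by rewrite stab_sub circzD circzN rmorphM; ring.
Qed.

(* The coefficient [max (0, 1 - |n| / N)], written as a count of pairs so that
   positivity of [fejer_state] is an instance of [key_sum_ge0]. *)
Definition fejer (N : nat) (n : int) : K :=
  N%:R^-1 * \sum_(i < N) \sum_(j < N) ((i : nat)%:Z - (j : nat)%:Z == n)%:R.

Lemma fejer0 N : (0 < N)%N -> fejer N 0 = 1.
Proof.
move=> N0; rewrite /fejer.
have -> : \sum_(i < N) \sum_(j < N) ((i : nat)%:Z - (j : nat)%:Z == 0)%:R = N%:R :> K.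
  rewrite -[in RHS](card_ord N) -sumr_const; apply: eq_bigr => i _.
  rewrite (bigD1 i) //= subrr eqxx big1 ?addr0 // => j ji.
  rewrite subr_eq0; case: eqP => // -[/esym/val_inj/eqP].
  by rewrite (negbTE ji).
by rewrite mulVf // pnatr_eq0 -lt0n.
Qed.

Lemma fejer_supp N n : (N <= `|n|)%N -> fejer N n = 0.
Proof.
move=> Nn; rewrite /fejer big1 ?mulr0 // => i _; rewrite big1 // => j _.
by case: eqP => // e; have := ltn_ord i; have := ltn_ord j; lia.
Qed.

Lemma count_below N k : (\sum_(j < N) (j < k) <= k)%N.
Proof.
suff : (\sum_(j < N) (j < k) <= minn N k)%N by move/leq_trans; apply; exact: geq_minr.
elim: N => [|N IH]; first by rewrite big_ord0.
rewrite big_ord_recr /=; apply: leq_trans (leq_add IH (leqnn _)) _.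
by case: ltnP => h; lia.
Qed.

(** [N * (1 - fejer R N n)] counts the [j < N] for which [j + n] leaves [[0, N)]; there are at most
    [|n|] of them. *)
Lemma fejer_count N n : (0 < N)%N -> cabs (1 - fejer N n) <= `|n|%N%:R / N%:R.
Proof.
move=> N0; have N0' : N%:R != 0 :> K by rewrite pnatr_eq0 -lt0n.
pose good (j : nat) := (0 <= j%:Z + n < N%:Z).
have e1 : \sum_(i < N) \sum_(j < N) ((i : nat)%:Z - (j : nat)%:Z == n)%:R =
    (\sum_(j < N) good j)%N%:R :> K.
  rewrite exchange_big natr_sum; apply: eq_bigr => j _.
  case: (boolP (good j)) => [|] h /=; rewrite /good in h.
    have lt : (absz (j%:Z + n)%R < N)%N by lia.
    rewrite (bigD1 (Ordinal lt)) //= big1 ?addr0; last first.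
      move=> i; rewrite -val_eqE /= => ne; case: eqP => // e; move: ne; lia.
    by case: eqP => //; lia.
  rewrite big1 // => i _; case: eqP => // e; have := ltn_ord i; lia.
have e2 : (\sum_(j < N) good j + \sum_(j < N) ~~ good j)%N = N.
  rewrite -big_split /= -[RHS](card_ord N) -sum1_card; apply: eq_bigr => j _.
  by case: (good j).
have e3 : (\sum_(j < N) ~~ good j <= `|n|)%N.
  case: (leP 0 n) => n0.
    rewrite (reindex_inj rev_ord_inj) /=; apply: leq_trans (count_below N _).
    by apply: leq_sum => j _; rewrite /good; have := ltn_ord j; lia.
  apply: leq_trans (count_below N _).
  by apply: leq_sum => j _; rewrite /good; have := ltn_ord j; lia.
have -> : 1 - fejer N n = ((\sum_(j < N) ~~ good j)%N%:R / N%:R)%:C.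
  rewrite /fejer e1 rmorphM fmorphV /= !rmorph_nat -{1}(mulVf N0') -mulrBr mulrC.
  by congr (_ * _); rewrite -{1}e2 natrD addrAC subrr add0r.
rewrite cabs_real ?divr_ge0 // ler_wpM2r ?invr_ge0 //.
by rewrite ler_nat.
Qed.

Lemma fejer_le N n : (0 < N)%N -> cabs (fejer N n) <= 1.
Proof.
move=> N0; have N0' : 0 < N%:R :> R by rewrite ltr0n.
have -> : fejer N n = (N%:R^-1 * (\sum_(i < N) \sum_(j < N) (((i : nat)%:Z - (j : nat)%:Z)%R == n))%N%:R)%:C.
  rewrite rmorphM fmorphV /= !rmorph_nat natr_sum; congr (_ * _).
  by apply: eq_bigr => i _; rewrite natr_sum.
rewrite cabs_real ?mulr_ge0 ?invr_ge0 // ler_pdivrMl // mulr1 ler_nat.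
rewrite -[leqRHS](card_ord N) -sum1_card; apply: leq_sum => i _.
have [lt|ge] := boolP (absz ((i : nat)%:Z - n)%R < N)%N; last first.
  rewrite big1 // => j _; apply/eqP; rewrite eqb0; apply/eqP => e.
  have := ltn_ord j; lia.
rewrite (bigD1 (Ordinal lt)) //= big1 ?addn0 ?leq_b1 // => j.
rewrite -val_eqE /= => ne; apply/eqP; rewrite eqb0; apply/eqP => e.
move: ne; lia.
Qed.

(** A product of two positive definite weights. Indexing by pairs [(n, j)] with [j < N] and taking
    [(n - j, s^n y)] as key makes it one instance of [key_sum_ge0]. *)
Lemma fejer_state N y t : (0 < N)%N ->
  state (weight_form (fun n => fejer N n * ((stab y n)%:R * circz n t)) y).
Proof.
move=> N0; apply: weight_state => [|n|r c].
- by rewrite fejer0 // stab0 circz0 !mulr1.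
- by case: stabP => // _; rewrite mul0r mulr0 eqxx.
pose r2 := [seq (n, j) | n <- r, j <- index_enum 'I_N].
have := key_sum_ge0 (fun p : int * 'I_N => (p.1 - (p.2 : nat)%:Z, int_iter s p.1 y)) r2
  (fun p => circz p.1 t * c p.1).
move=> h; rewrite (_ : \sum_(n <- r) _ = N%:R^-1 *
   \sum_(p <- r2) \sum_(q <- r2) ((p.1 - (p.2 : nat)%:Z, int_iter s p.1 y) == (q.1 - (q.2 : nat)%:Z, int_iter s q.1 y))%:R * ((circz p.1 t * c p.1)^* * (circz q.1 t * c q.1))).
  by rewrite mulr_ge0 // invr_ge0.
rewrite big_allpairs mulr_sumr; apply: eq_bigr => n _.
under [in RHS]eq_bigr do rewrite big_allpairs.
rewrite [in RHS]exchange_big mulr_sumr; apply: eq_bigr => m _.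
rewrite /fejer -!mulrA; congr (_ * _).
rewrite exchange_big mulr_suml; apply: eq_bigr => j _.
rewrite mulr_suml; apply: eq_bigr => i _ /=.
rewrite xpair_eqE -stab_sub.
have -> : (n - (j : nat)%:Z == m - (i : nat)%:Z) = ((i : nat)%:Z - (j : nat)%:Z == m - n).
  by apply/eqP/eqP; lia.
by rewrite -mulnb natrM circzD circzN rmorphM; ring.
Qed.

End weights.

Lemma circz_cts (R : realType) (n : int) : continuous (fun t : R => circz n t : R[i]^o).
Proof.
move=> t; apply: (@continuous_comp _ _ _ (fun t : R => n%:~R * t) (fun t => circ t : R[i]^o)).
  by apply: cvgMr; exact: cvg_id.
exact: circ_cts.
Qed.

(** * States on an arbitrary crossed product *)

Section crossed_product_theory.
Variables (R : realType) (X : topologicalType) (s : homeo X X).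
Local Notation K := R[i].
Local Notation CX := (contfun K X).
Local Notation skew := (skew_alg K s).
Hypothesis Xc : compact [set: X].
Variables (A : cstarAlgType K) (i : CX -> A) (u : A).
Hypothesis HA : is_crossed_product s i u.

Let iu : covariant s i u := HA.1.
Let uu : unitary u. Proof. by case: iu. Qed.
Let ev : skew -> A := skew_ev i u.
Let evP : star_morphism ev := skew_ev_morphism iu.

(** The two universal properties give maps in both directions, and uniqueness for endomorphisms of
    [A] makes [L] undo [M]. Thus every crossed product inherits density and states from the explicit
    one. *)
Lemma cp_compare : exists (M : A -> cp_alg R s Xc) (L : cp_alg R s Xc -> A),
  [/\ star_morphism M, star_morphism L, cancel M L, 
      forall a, L (cp_in Xc a) = ev a & forall a, M (ev a) = cp_in Xc a].
Proof.
have cpu := cp_universal R s Xc.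
have [M [[MP Mi Mu] _]] := HA.2 _ _ _ cpu.1.
have [L [[LP Li Lu] _]] := cpu.2 _ _ _ iu.
exists M, L; split=> //.
- move=> a; have [N [_ Nuniq]] := HA.2 _ _ _ iu.
  have e1 : N = id.
    by apply: Nuniq; split=> //; split=> //.
  have e2 : N = L \o M.
    apply: Nuniq; split.
    + split=> [x y|k x|x y||x] /=.
      * by rewrite (star_morphD MP) (star_morphD LP).
      * by rewrite (star_morphZ MP) (star_morphZ LP).
      * by rewrite (star_morphM MP) (star_morphM LP).
      * by rewrite (star_morph1 MP) (star_morph1 LP).
      * by rewrite (star_morph_star MP) (star_morph_star LP).
    + by rewrite -compA Mi Li.
    + by rewrite /= Mu Lu.
  by rewrite -[RHS]/(id a) -e1 e2.
- apply: skew_lsum_ext => [a b|a b|f n].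
  + by rewrite (star_morphD (cp_in_morphism R s Xc)) (star_morphD LP).
  + exact: (star_morphD evP).
  rewrite cp_in_mono /ev (skew_ev_mono iu) (star_morphM LP) (star_morphism_upow _ LP) Lu.
  by rewrite -Li.
- apply: skew_lsum_ext => [a b|a b|f n].
  + by rewrite (star_morphD evP) (star_morphD MP).
  + exact: (star_morphD (cp_in_morphism R s Xc)).
  rewrite cp_in_mono /ev (skew_ev_mono iu) (star_morphM MP) (star_morphism_upow _ MP) Mu.
  by rewrite -Mi.
Qed.

Lemma ev_dense (a : A) (e : R) : 0 < e -> exists2 d, range ev d & rnorm (a - d) <= e.
Proof.
have [M [L [MP LP ML Lin _]]] := cp_compare => e0.
have [_ [l _ <-] h] := cp_dense (M a) e0.
exists (ev l); first by exists l.
rewrite -Lin -[a in leLHS]ML; apply: le_trans h.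
by apply: le_trans (star_morphism_lip LP _ _) _; rewrite mul1r.
Qed.

Definition functional (r : A -> K) : Prop :=
  [/\ {morph r : x y / x + y}, forall k, {morph r : x / k *: x >-> k * x} &
      forall x, cabs (r x) <= rnorm x].

Lemma ev_state (phi : skew -> K) : state phi ->
  exists2 r : A -> K, functional r & forall a, r (ev a) = phi a.
Proof.
move=> /(cp_state Xc)[r [rD rZ rle rphi]].
have [M [L [MP LP _ _ Mev]]] := cp_compare.
exists (r \o M) => [|a]; last by rewrite /= Mev.
split=> [x y|k x|x] /=.
- by rewrite (star_morphD MP) rD.
- by rewrite (star_morphZ MP) rZ.
- by apply: le_trans (rle _) _; exact: star_morphism_le.
Qed.

(** The identities for [psi] and [coef] are checked on the generators [i f * upow u n] and extended
    by this lemma. The bound [C] is free because the maps compared may involve multiplications and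
    finite sums, which need not be contractive. *)
Lemma functional_ext (F G : A -> K) (C : R) :
  {morph F : x y / x + y} -> {morph G : x y / x + y} ->
  (forall x, cabs (F x) <= C * rnorm x) -> (forall x, cabs (G x) <= C * rnorm x) ->
  (forall f n, F (i f * upow u n) = G (i f * upow u n)) -> F =1 G.
Proof.
move=> FD GD FC GC FG.
have lip (H : A -> K) : {morph H : x y / x + y} ->
    (forall x, cabs (H x) <= C * rnorm x) ->
    forall x y, rnorm (H x - H y : K^o) <= C * rnorm (x - y).
  move=> HD HC x y; apply: le_trans (HC (x - y)).
  have -> : H x = H (x - y) + H y by rewrite -HD subrK.
  by rewrite addrK.
apply: (@lipschitz_eq R A K^o _ ev_dense F G C (lip _ FD FC) (lip _ GD GC)).
move=> _ [a _ <-]; move: a; apply: skew_lsum_ext => [a b|a b|f n].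
- by rewrite (star_morphD evP) FD.
- by rewrite (star_morphD evP) GD.
by rewrite /ev (skew_ev_mono iu).
Qed.

Lemma functional_ext1 (F G : A -> K) : functional F -> functional G ->
  (forall f n, F (i f * upow u n) = G (i f * upow u n)) -> F =1 G.
Proof.
move=> [FD _ Fl] [GD _ Gl]; apply: (@functional_ext F G 1) => // x; by rewrite mul1r.
Qed.

Lemma ev_weight (omega : int -> K) y : state (weight_form (s := s) omega y) ->
  exists2 r : A -> K, functional r & forall f n, r (i f * upow u n) = omega n * f y.
Proof.
move=> /ev_state[r rF h]; exists r => // f n.
by rewrite -(skew_ev_mono iu) h weight_form_mono.
Qed.

(* Value at the character [u^n |-> circ (n t)] of the isotropy of [y], and
   constant Fourier coefficient at [y]. *)
Definition psi y t : A -> K := s2val (cid2 (ev_weight (point_state s y t))).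
Definition coef y : A -> K := s2val (cid2 (ev_weight (coefficient_state R s y))).

Lemma psiF y t : functional (psi y t).
Proof. by rewrite /psi; case: cid2. Qed.
Lemma psi_mono y t f n :
  psi y t (i f * upow u n) = (stab s y n)%:R * circz n t * f y.
Proof. by rewrite /psi; case: cid2 => /=. Qed.
Lemma coefF y : functional (coef y).
Proof. by rewrite /coef; case: cid2. Qed.
Lemma coef_mono y f n : coef y (i f * upow u n) = (n == 0)%:R * f y.
Proof. by rewrite /coef; case: cid2 => /=. Qed.

Lemma functionalB (r : A -> K) : functional r -> forall x y, r (x - y) = r x - r y.
Proof.
by move=> [rD rZ _] x y; rewrite rD -scaleN1r rZ mulN1r.
Qed.

Lemma iM f g : i (algmul f g) = i f * i g.
Proof. by case: iu => -[_ _ h _ _] _ _; exact: h. Qed.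

Lemma i1 : i algone = 1.
Proof. by case: iu => -[_ _ _ h _] _ _; exact: h. Qed.

Lemma monoMr f n g : i f * upow u n * i g = i (algmul f (translate s n g)) * upow u n.
Proof. by rewrite -mulrA (covariant_upow iu) mulrA -iM. Qed.

Lemma monoMl f g n : i f * (i g * upow u n) = i (algmul f g) * upow u n.
Proof. by rewrite mulrA -iM. Qed.

Lemma upowMl n f m : upow u n * (i f * upow u m) = i (translate s n f) * upow u (n + m).
Proof. by rewrite mulrA (covariant_upow iu) -mulrA -upowD. Qed.

Lemma rnorm_upow n : rnorm (upow u n) <= 1.
Proof. exact: (csn_unitary (@rnorm_cstar _ A) (upow_unitary uu n)). Qed.

Lemma functional_lmul (F : A -> K) (b : A) (C : R) : functional F -> rnorm b <= C ->
  {morph (fun x => F (b * x)) : x y / x + y} /\ forall x, cabs (F (b * x)) <= C * rnorm x.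
Proof.
move=> [FD _ Fl] bC; split=> [x y|x]; first by rewrite mulrDr FD.
apply: le_trans (Fl _) _; apply: le_trans (rnormM _ _) _.
by rewrite ler_wpM2r ?rnorm_ge0.
Qed.

Lemma functional_rmul (F : A -> K) (b : A) (C : R) : functional F -> rnorm b <= C ->
  {morph (fun x => F (x * b)) : x y / x + y} /\ forall x, cabs (F (x * b)) <= C * rnorm x.
Proof.
move=> [FD _ Fl] bC; split=> [x y|x]; first by rewrite mulrDl FD.
apply: le_trans (Fl _) _; apply: le_trans (rnormM _ _) _.
by rewrite mulrC ler_wpM2r ?rnorm_ge0.
Qed.

Lemma functional_scale (F : A -> K) (k : K) (C : R) : functional F -> cabs k <= C ->
  {morph (fun x => k * F x) : x y / x + y} /\ forall x, cabs (k * F x) <= C * rnorm x.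
Proof.
move=> [FD _ Fl] kC; split=> [x y|x]; first by rewrite FD mulrDr.
rewrite cabsM; apply: ler_pM; rewrite ?cabs_ge0 //.
Qed.

Lemma psi_imul y t f b : psi y t (i f * b) = f y * psi y t b.
Proof.
pose C := rnorm (i f) + cabs (f y : K).
have [h1 h2] := @functional_lmul _ (i f) C (psiF y t) ltac:(by rewrite lerDl cabs_ge0).
have [h3 h4] := @functional_scale _ (f y) C (psiF y t) ltac:(by rewrite lerDr rnorm_ge0).
move: b; apply: (functional_ext h1 h3 h2 h4) => g n.
by rewrite monoMl !psi_mono cfM mulrCA.
Qed.

Lemma psi_muli y t f b : psi y t (b * i f) = psi y t b * f y.
Proof.
rewrite mulrC.
pose C := rnorm (i f) + cabs (f y : K).
have [h1 h2] := @functional_rmul _ (i f) C (psiF y t) ltac:(by rewrite lerDl cabs_ge0).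
have [h3 h4] := @functional_scale _ (f y) C (psiF y t) ltac:(by rewrite lerDr rnorm_ge0).
move: b; apply: (functional_ext h1 h3 h2 h4) => g n.
rewrite monoMr !psi_mono cfM translateE.
have [/stabN/stabP ->|] := boolP (stab s y n); first by rewrite mulrC mulrA [f y * _]mulrC; ring.
by rewrite !mul0r mulr0.
Qed.

Lemma psi_upowr y t m b : stab s y m -> psi y t (b * upow u m) = circz m t * psi y t b.
Proof.
move=> sm.
have [h1 h2] := functional_rmul (psiF y t) (rnorm_upow m).
have [h3 h4] := @functional_scale _ (circz m t) 1 (psiF y t) ltac:(by rewrite cabs_circz).
move: b; apply: (functional_ext h1 h3 h2 h4) => g n.
rewrite -mulrA -upowD // !psi_mono circzD.
have -> : stab s y (n + m) = stab s y n.
  apply/idP/idP => h; last exact: stabD.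
  by rewrite -(addrK m n); apply: stabD => //; exact: stabN.
by ring.
Qed.

(** Conjugation by [u^m] moves the base point along its orbit. All points of an orbit have the same
    isotropy, so the parameter [t] is kept. *)
Lemma psi_conj y t m b :
  psi y t (upow u m * b * upow u (- m)) = psi (int_iter s (- m) y) t b.
Proof.
have [rD rZ rl] := psiF y t.
have h1 : {morph (fun b => psi y t (upow u m * b * upow u (- m))) : x y / x + y}.
  by move=> x z; rewrite mulrDr mulrDl rD.
have h2 x : cabs (psi y t (upow u m * x * upow u (- m))) <= 1 * rnorm x.
  apply: le_trans (rl _) _; rewrite mul1r.
  apply: le_trans (rnormM _ _) _; rewrite -[leRHS]mulr1.
  apply: ler_pM; rewrite ?rnorm_ge0 ?rnorm_upow //.
  apply: le_trans (rnormM _ _) _; rewrite -[leRHS]mul1r.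
  by rewrite ler_wpM2r ?rnorm_ge0 ?rnorm_upow.
have [h3 _ h4] := psiF (int_iter s (- m) y) t.
move: b; apply: (functional_ext h1 h3 h2) => [x|g n]; first by rewrite mul1r.
rewrite upowMl -mulrA -upowD // addrAC addrN add0r !psi_mono translateE.
suff -> : stab s (int_iter s (- m) y) n = stab s y n by [].
apply/stabP/stabP => h; last first.
  by rewrite -int_iterD addrC int_iterD h.
have := congr1 (int_iter s m) h; rewrite -int_iterD [m + n]addrC int_iterD.
by rewrite int_iterKN.
Qed.

Lemma psi1 y t : psi y t 1 = 1.
Proof.
have := psi_mono y t algone 0; rewrite upow0 mulr1 i1 => ->.
by rewrite stab0 circz0 cf1 !mulr1.
Qed.

Lemma coef_imul y f b : coef y (i f * b) = f y * coef y b.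
Proof.
pose C := rnorm (i f) + cabs (f y : K).
have [h1 h2] := @functional_lmul _ (i f) C (coefF y) ltac:(by rewrite lerDl cabs_ge0).
have [h3 h4] := @functional_scale _ (f y) C (coefF y) ltac:(by rewrite lerDr rnorm_ge0).
move: b; apply: (functional_ext h1 h3 h2 h4) => g n.
by rewrite monoMl !coef_mono cfM mulrCA.
Qed.

Lemma coef_muli y f b : coef y (b * i f) = coef y b * f y.
Proof.
rewrite mulrC.
pose C := rnorm (i f) + cabs (f y : K).
have [h1 h2] := @functional_rmul _ (i f) C (coefF y) ltac:(by rewrite lerDl cabs_ge0).
have [h3 h4] := @functional_scale _ (f y) C (coefF y) ltac:(by rewrite lerDr rnorm_ge0).
move: b; apply: (functional_ext h1 h3 h2 h4) => g n.
rewrite monoMr !coef_mono cfM.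
have [->|] := eqVneq n 0; last by rewrite !mul0r mulr0.
by rewrite translate0; ring.
Qed.

Lemma coef1 y : coef y 1 = 1.
Proof.
have := coef_mono y algone 0; rewrite upow0 mulr1 i1 => ->.
by rewrite cf1 eqxx mulr1.
Qed.

Lemma approx_ev (a : A) (e : R) : 0 < e -> exists l : skew, rnorm (a - ev l) <= e.
Proof. by move=> /(ev_dense a)[_ [l _ <-]]; exists l. Qed.

Lemma evE (l : skew) : ev l = \sum_(n <- skew_supp l) i (l n) * upow u n.
Proof.
by apply: eq_bigr.
Qed.

Lemma functional_sum (r : A -> K) (I : Type) (l : seq I) (F : I -> A) :
  functional r -> r (\sum_(n <- l) F n) = \sum_(n <- l) r (F n).
Proof.
move=> [rD rZ _]; apply: (big_morph r rD).
by rewrite -(scale0r 0) rZ mul0r.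
Qed.

(** On a polynomial in [u] this is a trigonometric polynomial in [t]; contractivity makes the
    approximation uniform in [t]. *)
Lemma psi_cts y b : continuous (fun t => psi y t b : K^o).
Proof.
move=> t; apply/cvg_cabs => e e0.
have [l hl] := approx_ev b (divr_gt0 e0 (ltr0Sn _ 2)).
have c : continuous (fun t => psi y t (ev l) : K^o).
  have E t1 : psi y t1 (ev l) = \sum_(n <- skew_supp l) (stab s y n)%:R * circz n t1 * (l n) y.
    rewrite evE (functional_sum _ _ (psiF y t1)).
    by apply: eq_bigr => n _; rewrite psi_mono.
  rewrite (_ : (fun t => psi y t (ev l)) = fun t1 => \sum_(n <- skew_supp l) (stab s y n)%:R * circz n t1 * (l n) y); last exact/funext.
  move=> t0; rewrite /continuous_at.
  elim: (skew_supp l) => [|n r IH].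
    by under eq_fun do rewrite big_nil; rewrite big_nil; exact: cvg_cst.
  under eq_fun do rewrite big_cons; rewrite big_cons.
  apply: (@cvgD K K^o); last exact: IH.
  apply: cvgMl; apply: cvgMr.
  exact: circz_cts.
have /cvg_cabs /(_ (e / 3)) := c t; rewrite divr_gt0 // => /(_ isT).
apply: filterS => t' h.
have d t1 : cabs (psi y t1 b - psi y t1 (ev l)) <= e / 3.
  rewrite -(functionalB (psiF y t1)); apply: le_trans hl.
  by case: (psiF y t1).
have -> : psi y t b - psi y t' b = (psi y t b - psi y t (ev l)) +
   (psi y t (ev l) - psi y t' (ev l)) - (psi y t' b - psi y t' (ev l)) by ring.
apply: le_trans (cabsD _ _) _.
have -> : cabs (- (psi y t' b - psi y t' (ev l))) = cabs (psi y t' b - psi y t' (ev l)).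
  by rewrite /cabs normrN.
have h1 := cabsD (psi y t b - psi y t (ev l)) (psi y t (ev l) - psi y t' (ev l)).
have h2 := d t; have h3 := d t'; lra.
Qed.

Lemma psi_periodic y t b (q : R) :
  (forall n, stab s y n -> circ (n%:~R * q) = 1) -> psi y (t + q) b = psi y t b.
Proof.
move=> hq; apply: (functional_ext1 (psiF y (t + q)) (psiF y t)) => f n.
rewrite !psi_mono; have [sn|] := boolP (stab s y n); last by rewrite !mul0r.
by rewrite /circz mulrDr circD hq // mulr1.
Qed.

(** A uniform limit of the 0-th coefficients of approximating polynomials. The support of [psi]
    jumps with the isotropy of [y]; that of [coef] does not. *)
Lemma coef_cts b : continuous (fun y => coef y b : K^o).
Proof.
move=> y; apply/cvg_cabs => e e0.
have [l hl] := approx_ev b (divr_gt0 e0 (ltr0Sn _ 2)).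
have E y' : coef y' (ev l) = l 0 y'.
  rewrite evE (functional_sum _ _ (coefF y')).
  under eq_bigr do rewrite coef_mono.
  have [h|h] := boolP (0 \in skew_supp l).
    rewrite (bigD1_seq 0) ?skew_supp_uniq //= mul1r big1 ?addr0 // => n /negbTE->.
    by rewrite mul0r.
  rewrite (skew_suppP h) cf0 big_seq big1 // => n nl.
  by case: eqP nl h => [-> ->//|]; rewrite mul0r.
have /cvg_cabs /(_ (e / 3)) := @cts_cf _ _ (l 0) y; rewrite divr_gt0 // => /(_ isT).
apply: filterS => y' h.
have d y1 : cabs (coef y1 b - l 0 y1) <= e / 3.
  rewrite -E -(functionalB (coefF y1)); apply: le_trans hl.
  by case: (coefF y1).
have -> : coef y b - coef y' b = (coef y b - l 0 y) +
   (l 0 y - l 0 y') - (coef y' b - l 0 y') by ring.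
apply: le_trans (cabsD _ _) _.
have -> : cabs (- (coef y' b - l 0 y')) = cabs (coef y' b - l 0 y').
  by rewrite /cabs normrN.
have h1 := cabsD (coef y b - l 0 y) (l 0 y - l 0 y').
have h2 := d y; have h3 := d y'; lra.
Qed.

End crossed_product_theory.

Lemma cabs0 (R : realType) : cabs (0 : R[i]) = 0.
Proof. by apply: complexI; rewrite -cabsE normr0. Qed.

Lemma cabs1 (R : realType) : cabs (1 : R[i]) = 1.
Proof. by apply: complexI; rewrite -cabsE normr1. Qed.

(** * Degrees of normalizers *)

Lemma bump_function (R : realType) (X : topologicalType) :
  compact [set: X] -> hausdorff_space X -> forall (C : set X) (y : X),
  closed C -> ~ C y ->
  exists f : contfun R[i] X, (forall x, C x -> f x = 0) /\ f y = 1.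
Proof.
move=> Xc Xh C y Cc Cy.
have /normal_separatorP nX := compact_normal Xh Xc.
have /(@uniform_separatorP _ R)[f [cf _ f0 f1]] : @uniform_separator X C [set y].
  apply: (nX R) => //.
    exact: accessible_closed_set1 (hausdorff_accessible Xh) _.
  by apply/seteqP; split=> // x [Cx xy]; apply: Cy; rewrite -xy.
exists (real_cf cf); split=> [x Cx|].
  by rewrite -[LHS]/((f x)%:C) (_ : f x = 0) //; apply: f0; exists x.
by rewrite -[LHS]/((f y)%:C) (_ : f y = 1) //; apply: f1; exists y.
Qed.

Lemma separating_function (R : realType) (X : topologicalType) :
  compact [set: X] -> hausdorff_space X -> forall x y : X, x != y ->
  exists f : contfun R[i] X, f x = 0 /\ f y = 1.
Proof.
move=> Xc Xh x y xy; have [|xy'|f [f0 f1]] := @bump_function R X Xc Xh [set x] y.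
- exact: accessible_closed_set1 (hausdorff_accessible Xh) _.
- by move/eqP: xy; apply.
by exists f; split=> //; exact: f0.
Qed.

Lemma points_separated (R : realType) (X : topologicalType) :
  compact [set: X] -> hausdorff_space X -> forall x y : X,
  (forall f : contfun R[i] X, f x = f y) -> x = y.
Proof.
move=> Xc Xh x y h; apply/eqP; case: (eqVneq x y) => // xy.
have [f [f0 f1]] := separating_function R Xc Xh xy.
by have := h f; rewrite f0 f1 => /esym/eqP; rewrite oner_eq0.
Qed.

Section normalizers.
Variables (R : realType) (X : topologicalType) (s : homeo X X).
Local Notation K := R[i].
Local Notation CX := (contfun K X).
Hypothesis Xc : compact [set: X].
Hypothesis Xh : hausdorff_space X.
Variables (A : cstarAlgType K) (i : CX -> A) (u : A).
Hypothesis HA : is_crossed_product s i u.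

Let iu : covariant s i u := HA.1.
Let uu : unitary u. Proof. by case: iu. Qed.
Local Notation psi := (psi Xc HA).
Local Notation coef := (coef Xc HA).

Lemma functional_ge1 (r : A -> K) b : functional r -> unitary b -> cabs (r b) <= 1.
Proof.
move=> [_ _ rl] bu; apply: le_trans (rl _) _.
exact: (csn_unitary (@rnorm_cstar _ A) bu).
Qed.

Definition int_range (N : nat) : seq int :=
  [seq k%:Z - N%:Z | k <- iota 0 N.*2].

Lemma int_range_uniq N : uniq (int_range N).
Proof. by rewrite map_inj_uniq ?iota_uniq // => a b /eqP; lia. Qed.

Lemma mem_int_range (N : nat) n : (n \in int_range N) = (- N%:Z <= n < N%:Z).
Proof.
apply/mapP/idP => [[k + ->]|nN]; first by rewrite mem_iota; lia.
exists (absz (n + N%:Z)); last by lia.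
by rewrite mem_iota; lia.
Qed.

(** Since [fejer R N] has finite support, the extended state is a finite combination of the Fourier
    coefficients [coef y (b * upow u (- n))]: both sides are bounded and agree on generators. *)
Lemma fejer_functional N y t : (0 < N)%N ->
  exists2 r : A -> K, functional r &
    (forall f n, r (i f * upow u n) = fejer R N n * ((stab s y n)%:R * circz n t) * f y) /\
    (forall b, r b = \sum_(n <- int_range N)
      fejer R N n * ((stab s y n)%:R * circz n t) * coef y (b * upow u (- n))).
Proof.
move=> N0; have [r rF rE] := ev_weight Xc HA (fejer_state s y t N0).
exists r => //; split=> //.
pose w n : K := fejer R N n * ((stab s y n)%:R * circz n t).
pose G l b : K := \sum_(n <- l) w n * coef y (b * upow u (- n)).
have w1 n : cabs (w n) <= 1.
  rewrite /w cabsM -[leRHS]mulr1; apply: ler_pM; rewrite ?cabs_ge0 ?fejer_le //.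
  rewrite cabsM cabs_circz mulr1; case: stab; rewrite ?cabs1 ?cabs0 //.
have GD l : {morph G l : x y / x + y}.
  move=> a b; rewrite /G -big_split /=; apply: eq_bigr => m _.
  by rewrite mulrDl; have [-> _ _] := coefF Xc HA y; rewrite mulrDr.
have Gle l b : cabs (G l b) <= (size l)%:R * rnorm b.
  elim: l => [|n l IH]; first by rewrite /G big_nil cabs0 mul0r.
  rewrite /G big_cons /= -natr1 mulrDl mul1r addrC; apply: le_trans (cabsD _ _) _.
  apply: lerD => //; rewrite cabsM -[leRHS]mul1r; apply: ler_pM; rewrite ?cabs_ge0 //.
  have [_ _ h] := coefF Xc HA y; apply: le_trans (h _) _.
  apply: le_trans (rnormM _ _) _; rewrite -[leRHS]mulr1.
  by apply: ler_wpM2l; [exact: rnorm_ge0|exact: (rnorm_upow HA)].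
have [rD _ rl] := rF.
apply: (functional_ext Xc HA (C := (size (int_range N)).+1%:R) rD (GD _)).
- move=> x; apply: le_trans (rl _) _; rewrite -[leLHS]mul1r ler_wpM2r ?rnorm_ge0 //.
  by rewrite ler1n.
- move=> x; apply: le_trans (Gle _ _) _; rewrite ler_wpM2r ?rnorm_ge0 //.
  by rewrite ler_nat.
move=> f m; rewrite rE /G.
have E n : coef y (i f * upow u m * upow u (- n)) = (m == n)%:R * f y.
  by rewrite -mulrA -upowD // coef_mono subr_eq0.
under eq_bigr do rewrite E.
have [h|h] := boolP (m \in int_range N).
  rewrite (bigD1_seq m) ?int_range_uniq //= eqxx mul1r big1 ?addr0 // => n.
  by rewrite eq_sym => /negbTE ->; rewrite mul0r mulr0.
rewrite fejer_supp; last first.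
  by move: h; rewrite mem_int_range; lia.
rewrite !mul0r big_seq big1 // => n nl.
by case: eqP nl h => [-> ->//|]; rewrite mul0r mulr0.
Qed.

(** A Fejer theorem uniform in [y] and [t]. On a polynomial [l] the error is at most the sum of
    [|n| |l n y|] divided by [N], by [fejer_count], and compactness bounds the sum in [y]. The
    passage to [b] costs [e / 3] for each of the two contractive functionals. *)
Lemma fejer_approx b (e : R) : 0 < e -> exists2 N, (0 < N)%N & forall y t,
  cabs (psi y t b - \sum_(n <- int_range N)
     fejer R N n * ((stab s y n)%:R * circz n t) * coef y (b * upow u (- n))) <= e.
Proof.
move=> e0; have e3 : 0 < e / 3 by rewrite divr_gt0.
have [l hl] := approx_ev Xc HA b e3.
have [M M0 HM] : exists2 M : R, 0 < M & forall y,
    \sum_(n <- skew_supp l) `|n|%N%:R * cabs (l n y : K) <= M.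
  elim: (skew_supp l) => [|n r [M M0 HM]]; first by exists 1 => // y; rewrite big_nil ler01.
  have [M' M'0 HM'] := cf_bounded Xc (l n).
  exists (`|n|%N%:R * M' + M) => [|y].
    by rewrite ltr_wpDl // mulr_ge0 // ltW.
  by rewrite big_cons lerD // ler_wpM2l.
have [N N0 HN] : exists2 N, (0 < N)%N & M / N%:R <= e / 3.
  exists (Num.truncn (M / (e / 3))).+1 => //.
  rewrite ler_pdivrMr ?ltr0n // mulrC -ler_pdivrMr //; apply/ltW.
  exact: truncnS_gt.
exists N => // y t; have [r rF [rm rE]] := fejer_functional y t N0.
rewrite -rE.
have h1 : cabs (psi y t (b - skew_ev i u l)) <= e / 3.
  by apply: le_trans hl; case: (psiF Xc HA y t).
have h2 : cabs (r (b - skew_ev i u l)) <= e / 3.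
  by apply: le_trans hl; case: rF.
rewrite (functionalB (psiF Xc HA y t)) in h1; rewrite (functionalB rF) in h2.
have h3 : cabs (psi y t (skew_ev i u l) - r (skew_ev i u l)) <= e / 3.
  apply: le_trans HN; rewrite evE (functional_sum _ _ (psiF Xc HA y t)) (functional_sum _ _ rF).
  rewrite -sumrB ler_pdivlMr ?ltr0n //; apply: le_trans (HM y).
  rewrite -ler_pdivlMr ?ltr0n // mulr_suml.
  elim: (skew_supp l) => [|n q IH]; first by rewrite !big_nil cabs0.
  rewrite !big_cons; apply: le_trans (cabsD _ _) _; apply: lerD => //.
  rewrite psi_mono rm.
  have -> : (stab s y n)%:R * circz n t * l n y - fejer R N n * ((stab s y n)%:R * circz n t) * l n y
     = (stab s y n)%:R * circz n t * ((1 - fejer R N n) * l n y) by ring.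
  rewrite !cabsM cabs_circz mulr1.
  apply: (@le_trans _ _ (cabs (1 - fejer R N n) * cabs (l n y : K))).
    by case: stab; rewrite ?cabs1 ?cabs0 ?mul1r // mul0r mulr_ge0 ?cabs_ge0.
  by rewrite mulrAC ler_wpM2r ?cabs_ge0 //; exact: fejer_count.
have -> : psi y t b - r b = (psi y t b - psi y t (skew_ev i u l)) +
   (psi y t (skew_ev i u l) - r (skew_ev i u l)) - (r b - r (skew_ev i u l)) by ring.
apply: le_trans (cabsD _ _) _.
have -> : cabs (- (r b - r (skew_ev i u l))) = cabs (r b - r (skew_ev i u l)).
  by rewrite /cabs normrN.
have h4 := cabsD (psi y t b - psi y t (skew_ev i u l)) (psi y t (skew_ev i u l) - r (skew_ev i u l)).
lra.
Qed.

(** Continuity of [rho] is expressed through the functions [g] only. In this convention [upow u n]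
    induces [s^-n], and products reverse the order of composition. *)
Definition normalizes (w : A) (rho : X -> X) : Prop :=
  unitary w /\ forall f : CX, exists2 g : CX,
    (forall x, g x = f (rho x)) & w * i f = i g * w.

Lemma normalizesM w w' rho rho' : normalizes w rho -> normalizes w' rho' ->
  normalizes (w * w') (rho' \o rho).
Proof.
move=> [[w1 w2] wi] [[w'1 w'2] w'i]; split.
  rewrite /unitary star_mul; split.
    by rewrite mulrA -[starop w' * _ * _]mulrA w1 mulr1.
  by rewrite mulrA -[w * w' * _]mulrA w'2 mulr1.
move=> f; have [g gE gw] := w'i f; have [h hE hw] := wi g.
exists h => [x|]; first by rewrite hE gE.
by rewrite -mulrA gw !mulrA hw.
Qed.

Lemma normalizes_upow n : normalizes (upow u n) (int_iter s (- n)).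
Proof.
split; first exact: upow_unitary.
by move=> f; exists (translate s n f) => //; exact: covariant_upow.
Qed.

Lemma normalizes_upowr w rho n : normalizes w rho ->
  normalizes (w * upow u n) (int_iter s (- n) \o rho).
Proof. by move=> wn; apply: normalizesM => //; exact: normalizes_upow. Qed.

(** Moving [i f] across [d] gives [f (rho y) * coef y d = f y * coef y d] for every [f], and
    functions separate points. The same reasoning serves for [psi]. *)
Lemma coef_normalizer d rho y : normalizes d rho -> coef y d != 0 -> rho y = y.
Proof.
move=> [_ dn] h; apply: (@points_separated R _ Xc Xh) => f.
have [g gE gd] := dn f.
apply: (mulIf h); rewrite -gE -coef_imul -gd coef_muli mulrC //.
Qed.

Lemma psi_normalizer d rho y t : normalizes d rho -> psi y t d != 0 -> rho y = y.
Proof.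
move=> [_ dn] h; apply: (@points_separated R _ Xc Xh) => f.
have [g gE gd] := dn f.
apply: (mulIf h); rewrite -gE -psi_imul -gd psi_muli mulrC //.
Qed.

(** It suffices to take [b] a generator with exponent [n]. If [u^n] fixes [y], it comes out as a
    scalar. Otherwise [d * upow u n] moves [y], so both sides vanish by [psi_normalizer]. *)
Lemma psiM d rho y t b : normalizes d rho -> rho y = y ->
  psi y t (d * b) = psi y t d * psi y t b.
Proof.
move=> dn dy; have [du di] := dn.
have d1 : rnorm d <= 1 := csn_unitary (@rnorm_cstar _ A) du.
have [h1 h2] := functional_lmul (psiF Xc HA y t) d1.
have [h3 h4] := functional_scale (C := 1) (psiF Xc HA y t)
  (functional_ge1 (psiF Xc HA y t) du).
move: b; apply: (functional_ext Xc HA h1 h3 h2 h4) => f n.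
have [g gE gd] := di f; rewrite mulrA gd -mulrA psi_imul gE dy psi_mono.
have [sn|sn] := boolP (stab s y n); first by rewrite psi_upowr // mul1r [RHS]mulrC -mulrA [RHS]mulrCA.
suff -> : psi y t (d * upow u n) = 0 by rewrite !mul0r !mulr0.
apply/eqP; apply: contraR sn => /(psi_normalizer (normalizes_upowr n dn)) /=.
by rewrite dy => /stabP/stabN; rewrite opprK.
Qed.

(** The values at [d] and at [starop d] have product 1 by [psiM], and neither exceeds 1 in
    modulus. *)
Lemma psi_unimodular d rho y t : normalizes d rho -> rho y = y ->
  cabs (psi y t d) = 1.
Proof.
move=> dn dy; have [[d1 d2] _] := dn.
have := psiM t (starop d) dn dy; rewrite d2 psi1 => /(congr1 (@cabs R)); rewrite cabs1 cabsM.
have h1 := functional_ge1 (psiF Xc HA y t) (conj d1 d2).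
have h2 : cabs (psi y t (starop d)) <= 1.
  by apply: functional_ge1; [exact: psiF|split; rewrite staropK].
have h3 := cabs_ge0 (psi y t d); have h4 := cabs_ge0 (psi y t (starop d)).
by move=> /esym e; apply/eqP; rewrite eq_le h1 /=; nra.
Qed.

Lemma psi_loop d rho y : normalizes d rho -> rho y = y ->
  loop (fun t => psi y t d).
Proof.
move=> dn dy; split=> [|t|t].
- exact: psi_cts.
- exact: psi_unimodular dn dy.
- apply: psi_periodic => n _; rewrite mulr1; exact: circ_int.
Qed.

(** Let [l] be a polynomial within 1/2 of [d]. Then [coef y] cannot vanish at [l * starop d], as it
    is 1 at [d * starop d]. So some exponent [n] of [l] has a nonzero coefficient of
    [upow u n * starop d] at [y], and it moves [y] as [d] does. The finite list is independent of
    [y]. *)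
Lemma normalizer_orbit d rho : normalizes d rho ->
  exists r : seq int, forall y, exists2 n, n \in r & int_iter s (- n) y = rho y.
Proof.
move=> [[d1 d2] dn].
have [l hl] := approx_ev Xc HA d (ltac:(by rewrite invr_gt0) : 0 < 2^-1 :> R).
exists (skew_supp l) => y.
have cne : coef y (skew_ev i u l * starop d) != 0.
  apply/eqP => c0; have := cabs1 R.
  have -> : 1 = coef y ((d - skew_ev i u l) * starop d).
    by rewrite mulrBl d2 (functionalB (coefF Xc HA y)) coef1 c0 subr0.
  have [_ _ h] := coefF Xc HA y; move: (h ((d - skew_ev i u l) * starop d)).
  have d'1 : rnorm (starop d) <= 1.
    by apply: (csn_unitary (@rnorm_cstar _ A)); split; rewrite staropK.
  have := rnormM (d - skew_ev i u l) (starop d).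
  have := rnorm_ge0 (d - skew_ev i u l); have := rnorm_ge0 (starop d).
  nra.
move: cne; rewrite evE mulr_suml (functional_sum _ _ (coefF Xc HA y)) => cne.
have [n nl] : exists2 n, n \in skew_supp l & coef y (upow u n * starop d) != 0.
  apply: contrapT => h; move/eqP: cne; apply.
  rewrite big_seq big1 // => n nl; rewrite -mulrA coef_imul.
  suff -> : coef y (upow u n * starop d) = 0 by rewrite mulr0.
  by apply/eqP; apply: contrapT => /negP h'; apply: h; exists n.
move=> cn; exists n => //; apply: (@points_separated R _ Xc Xh) => f.
have [g gE gd] := dn f.
apply: (mulIf cn); rewrite -gE -translateE -coef_imul mulrA -covariant_upow // -mulrA.
rewrite mulrC -coef_muli -mulrA; congr (coef y (_ * _)).
have := congr1 (fun x => starop d * x * starop d) gd.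
by rewrite /= !mulrA d1 mul1r -[_ * d * starop d]mulrA d2 mulr1.
Qed.

End normalizers.

Section degrees.
Variables (R : realType) (X : topologicalType) (s : homeo X X).
Local Notation K := R[i].
Local Notation CX := (contfun K X).
Hypothesis Xc : compact [set: X].
Hypothesis Xh : hausdorff_space X.
Variables (A : cstarAlgType K) (i : CX -> A) (u : A).
Hypothesis HA : is_crossed_product s i u.

Let iu : covariant s i u := HA.1.
Let uu : unitary u. Proof. by case: iu. Qed.
Local Notation psi := (psi Xc HA).
Local Notation coef := (coef Xc HA).

(** Subgroups of the integers are cyclic; [p = 0] stands for an aperiodic point. *)
Lemma stab_period y : exists p : nat, forall n, stab s y n = (p%:Z %| n)%Z.
Proof.
have [[n [n0 sn]]|h] := pselect (exists n : nat, (0 < n)%N /\ stab s y n).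
  have ex : exists n, (0 < n)%N && stab s y n%:Z by exists n; apply/andP.
  case: (ex_minnP ex) => p /andP[p0 sp] pmin; exists p.
  have sM m : stab s y (m * p%:Z).
    have sMn (k : nat) : stab s y (k%:Z * p%:Z).
      elim: k => [|k IH]; first by rewrite mul0r stab0.
      by rewrite intS mulrDl mul1r stabD.
    case: m => k; first exact: sMn.
    by rewrite NegzE mulNr stabN.
  move=> m; apply/idP/dvdzP => [sm|[q ->]]; last exact: sM.
  exists (m %/ p%:Z)%Z; rewrite {1}(divz_eq m p%:Z).
  suff -> : (m %% p%:Z)%Z = 0 by rewrite addr0.
  have p0' : p%:Z != 0 by lia.
  have : stab s y (m %% p%:Z)%Z.
    rewrite [X in stab _ _ X](_ : _ = m + - ((m %/ p%:Z)%Z * p%:Z)); last first.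
      by rewrite {2}(divz_eq m p%:Z); ring.
    by apply: stabD => //; apply: stabN.
  have := modz_ge0 m p0'; have : (m %% p%:Z)%Z < p%:Z by rewrite ltz_pmod; lia.
  case: (m %% p%:Z)%Z => // k kp _ sk.
  case: (posnP k) => [->//|k0].
  have := pmin k; rewrite k0 sk => /(_ isT); lia.
exists 0%N => n; rewrite dvd0z; apply/idP/eqP => [sn|->]; last exact: stab0.
apply: contrapT => n0; apply: h; exists `|n|%N; split; first by lia.
case: (ltrP n 0) => n1.
  by rewrite (_ : `|n|%N%:Z = - n); [exact: stabN|lia].
by rewrite (_ : `|n|%N%:Z = n) //; lia.
Qed.

Lemma psi_period y (p : nat) : (forall n, stab s y n = (p%:Z %| n)%Z) ->
  (0 < p)%N -> forall b t, psi y (t + p%:R^-1) b = psi y t b.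
Proof.
move=> sp p0 b t; apply: psi_periodic => n; rewrite sp => /dvdzP[q ->].
have -> : (q * p%:Z)%:~R / p%:R = q%:~R :> R; last exact: circ_int.
by rewrite intrM mulfK // -pmulrn pnatr_eq0 -lt0n.
Qed.

Lemma psi_aperiodic y : (forall n, stab s y n = (0%:Z %| n)%Z) ->
  forall b t, psi y t b = psi y 0 b.
Proof.
move=> sp b t; rewrite -(add0r t); apply: psi_periodic => n.
by rewrite sp dvd0z => /eqP ->; rewrite mul0r circ0.
Qed.

(** At a point of period [p] the loop has period [1/p], so its degree is a multiple of [p]; at an
    aperiodic point the loop is constant. *)
Lemma psi_degree_stab d rho y k : normalizes i d rho -> rho y = y ->
  degree (fun t => psi y t d) k -> stab s y k.
Proof.
move=> dn dy dk; have [p sp] := stab_period y.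
have [p0|p0] := posnP p.
  rewrite p0 in sp; have -> : k = 0; last exact: stab0.
  apply: degree_uniq dk _.
  rewrite (_ : (fun t => _) = fun=> psi y 0 d); last by apply/funext => t; exact: psi_aperiodic.
  by apply: degree_cst; exact: (psi_unimodular Xc Xh HA _ dn dy).
have [a [j [_ _ _ ->]]] := degree_periodic dk p0 (psi_period sp p0 d).
by rewrite sp dvdz_mulr.
Qed.

(* The normalizer [w] represents at [y] the groupoid arrow of degree [n]: it
   moves [y] as [u ^ n] does, and [w u^-n] has winding number 0 on the isotropy
   of [y].  The second clause selects [n] when [y] is periodic. *)
Definition deg_at (w : A) (rho : X -> X) (y : X) (n : int) : Prop :=
  int_iter s (- n) y = rho y /\ degree (fun t => psi y t (w * upow u (- n))) 0.

Lemma deg_at_fix (rho : X -> X) y n : int_iter s (- n) y = rho y ->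
  int_iter s (- - n) (rho y) = y.
Proof. by move=> <-; rewrite opprK int_iterKN. Qed.

Lemma degree_psi_shift w y m k : stab s y m ->
  degree (fun t => psi y t w) k -> degree (fun t => psi y t (w * upow u m)) (m + k).
Proof.
move=> sm wk; rewrite (_ : (fun t => _) = fun t => circz m t * psi y t w).
  by apply: degreeM => //; exact: degree_circ.
by apply/funext => t; exact: psi_upowr.
Qed.

(** An exponent [n0] that moves [y] correctly is amended by the winding number [k] of
    [w * upow u (- n0)]. As [k] lies in the isotropy of [y], [n0 + k] moves [y] in the same way. *)
Lemma deg_at_exists w rho y : normalizes i w rho -> exists n, deg_at w rho y n.
Proof.
move=> wn; have [r /(_ y)[n0 _ n0y]] := normalizer_orbit Xc Xh HA wn.
have dn := normalizes_upowr HA (- n0) wn.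
have dy : (int_iter s (- - n0) \o rho) y = y by exact: deg_at_fix n0y.
have [k dk] := degree_exists (psi_loop Xc Xh HA dn dy).
have sk := psi_degree_stab dn dy dk.
exists (n0 + k); split.
  by rewrite opprD int_iterD; have /stabP -> := stabN sk.
have := degree_psi_shift (stabN sk) dk; rewrite addNr; congr degree.
by apply/funext => t; rewrite -mulrA -upowD // opprD.
Qed.

(** Two candidates differ by an element of the isotropy, and multiplying by that power of [u] shifts
    the winding number by exactly this difference. *)
Lemma deg_at_uniq w rho y n m : deg_at w rho y n -> deg_at w rho y m -> n = m.
Proof.
move=> [ny dn] [my dm].
have sm : stab s y (n - m).
  rewrite (_ : n - m = - m - - n); last by ring.
  by rewrite stab_sub ny my.
have := degree_psi_shift sm dn; rewrite addr0.
rewrite (_ : (fun t => _) = fun t => psi y t (w * upow u (- m))).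
  by move=> /degree_uniq/(_ dm)/eqP; rewrite subr_eq0 => /eqP.
apply/funext => t; rewrite -mulrA -upowD //; congr (psi y t (_ * upow u _)); ring.
Qed.

(** [psi_conj] carries the loop at [rho y] over to [y], where [psiM] multiplies it with the loop of
    the first factor. *)
Lemma deg_atM w w' rho rho' y n n' : normalizes i w rho -> normalizes i w' rho' ->
  deg_at w rho y n -> deg_at w' rho' (rho y) n' ->
  deg_at (w * w') (rho' \o rho) y (n + n').
Proof.
move=> wn wn' [ny dn] [ny' dn']; split.
  by rewrite opprD addrC int_iterD ny.
have := degreeM dn dn'; rewrite addr0; congr degree; apply/funext => t.
have n0 := normalizes_upowr HA (- n) wn.
rewrite -ny -psi_conj -(psiM Xc Xh HA _ _ n0); last exact: deg_at_fix ny.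
congr (psi y t _); rewrite -!mulrA (mulrA (upow u (- n)) (upow u n)) -upowD // addNr upow0 mul1r.
by rewrite -upowD // opprD [- n + _]addrC.
Qed.

Lemma deg_at_upow y n : deg_at (upow u n) (int_iter s (- n)) y n.
Proof.
split=> //; rewrite -upowD // addrN.
rewrite (_ : (fun t => _) = fun=> 1); last by apply/funext => t; exact: psi1.
by apply: degree_cst; exact: cabs1.
Qed.

(* the Fejer means of the fibres [psi y _ d] extend continuously in [y] *)
Lemma psi_near d rho y : normalizes i d rho -> rho y = y ->
  \forall y' \near y, rho y' = y' ->
    forall t, cabs (psi y' t d - psi y t d) < 1.
Proof.
move=> dn dy.
have [N N0 HN] := fejer_approx Xc HA d (ltac:(by rewrite invr_gt0) : 0 < 4^-1 :> R).
pose F x t := \sum_(n <- int_range N) fejer R N n * circz n t * coef x (d * upow u (- n)).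
have FE x t : rho x = x -> cabs (psi x t d - F x t) <= 4^-1.
  move=> xx; have -> : F x t = \sum_(n <- int_range N)
     fejer R N n * ((stab s x n)%:R * circz n t) * coef x (d * upow u (- n)); last exact: HN.
  apply: eq_bigr => n _.
  have [->|c0] := eqVneq (coef x (d * upow u (- n))) 0; first by rewrite !mulr0.
  have /= := coef_normalizer Xh (normalizes_upowr HA (- n) dn) c0.
  by rewrite xx opprK => /stabP ->; rewrite mul1r.
have : \forall y' \near y, forall t, cabs (F y' t - F y t) <= 4^-1.
  have : \forall y' \near y,
     \sum_(n <- int_range N) cabs (coef y' (d * upow u (- n)) - coef y (d * upow u (- n))) <= 4^-1.
    have sum_near (e : R) (r : seq int) : 0 < e -> \forall y' \near y,
        \sum_(n <- r) cabs (coef y' (d * upow u (- n)) - coef y (d * upow u (- n))) <= (size r)%:R * e.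
      move=> e0; elim: r => [|n r IH].
        by apply: filterS filterT => z _; rewrite big_nil mul0r.
      have /cvg_cabs /(_ e e0) c1 := @coef_cts _ _ _ Xc _ _ _ HA (d * upow u (- n)) y.
      apply: filterS2 c1 IH => z h1 h2.
      rewrite big_cons /= -natr1 mulrDl mul1r addrC lerD //.
      by rewrite (_ : cabs _ = cabs (coef y (d * upow u (- n)) - coef z (d * upow u (- n)))) // /cabs distrC.
    have S0 : 0 < (size (int_range N)).+1%:R :> R by rewrite ltr0n.
    have e0 : 0 < 4^-1 / (size (int_range N)).+1%:R :> R by rewrite divr_gt0 // invr_gt0.
    apply: filterS (sum_near _ (int_range N) e0) => z h.
    apply: le_trans h _; rewrite mulrCA -[leRHS]mulr1 ler_pM2l ?invr_gt0 //.
    by rewrite ler_pdivrMr // mul1r ler_nat.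
  apply: filterS => y' h t; apply: le_trans h.
  rewrite /F -sumrB; elim: (int_range N) => [|n r IH]; first by rewrite !big_nil cabs0.
  rewrite !big_cons; apply: le_trans (cabsD _ _) _; apply: lerD => //.
  rewrite -mulrBr cabsM -[leRHS]mul1r ler_wpM2r ?cabs_ge0 //.
  by rewrite cabsM cabs_circz mulr1 fejer_le.
apply: filterS => y' h y'y t.
have h1 := FE _ t dy; have h2 := FE _ t y'y; have h3 := h t.
have -> : psi y' t d - psi y t d = (psi y' t d - F y' t) + (F y' t - F y t) - (psi y t d - F y t) by ring.
apply: le_lt_trans (cabsD _ _) _.
have -> : cabs (- (psi y t d - F y t)) = cabs (psi y t d - F y t) by rewrite /cabs normrN.
have h4 := cabsD (psi y' t d - F y' t) (F y' t - F y t); lra.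
Qed.

(** A function [f] separating the two points still separates them nearby, because [f \o rho] is
    continuous. *)
Lemma orbit_near d rho y m : normalizes i d rho -> int_iter s (- m) y != rho y ->
  \forall y' \near y, int_iter s (- m) y' != rho y'.
Proof.
move=> [_ dn] ne; have [f [f0 f1]] := separating_function R Xc Xh ne.
have [g gE _] := dn f.
have /cvg_cabs/(_ 4^-1) := @cts_cf _ _ g y; rewrite invr_gt0 => /(_ (ltr0n _ _)) hg.
have /cvg_cabs/(_ 4^-1) := @cts_cf _ _ (translate s m f) y; rewrite invr_gt0 => /(_ (ltr0n _ _)) hf.
near=> y'; apply/eqP => e.
have : cabs (g y - g y' : K) <= 4^-1 by near: y'.
have : cabs (translate s m f y - translate s m f y' : K) <= 4^-1 by near: y'.
rewrite !translateE !gE f0 f1 e sub0r => h1 h2.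
have := cabsD (1 - f (rho y')) (f (rho y') : K); rewrite subrK cabs1.
have -> : cabs (f (rho y') : K) = cabs (- (f (rho y') : K)) by rewrite /cabs normrN.
lra.
Unshelve. all: by end_near. Qed.

(** Near [y], the motion of [w] is that of some [m] in a finite list. An [m] that fails at [y] fails
    nearby by [orbit_near]. For any other, the loop of [w * upow u (- m)] keeps its degree [n - m]
    by [psi_near], and correcting [m] by this degree gives [n] again. *)
Lemma deg_at_near w rho y n : normalizes i w rho -> deg_at w rho y n ->
  \forall y' \near y, deg_at w rho y' n.
Proof.
move=> wn [ny dn].
have [r Hr] := normalizer_orbit Xc Xh HA wn.
have : \forall y' \near y, forall m, m \in r -> int_iter s (- m) y' = rho y' ->
   deg_at w rho y' n.
  have good m : \forall y' \near y, int_iter s (- m) y' = rho y' -> deg_at w rho y' n.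
    have dm := normalizes_upowr HA (- m) wn.
    have [my|my] := eqVneq (int_iter s (- m) y) (rho y); last first.
      by apply: filterS (orbit_near wn my) => y' /eqP.
    have sm : stab s y (n - m).
      rewrite (_ : n - m = - m - - n); last by ring.
      by rewrite stab_sub ny my.
    have dmy : degree (fun t => psi y t (w * upow u (- m))) (n - m).
      have := degree_psi_shift sm dn; rewrite addr0; congr degree.
      apply/funext => t; rewrite -mulrA -upowD //; congr (psi y t (_ * upow u _)); ring.
    have := psi_near dm (deg_at_fix my); apply: filterS => y' /= h my'.
    have dy' := deg_at_fix my'.
    have dmy' := degree_close dmy (psi_loop Xc Xh HA dm dy') (h dy').
    have sk := stabN (psi_degree_stab dm dy' dmy'); split.
      rewrite -my' (_ : - n = - m + - (n - m)); last by ring.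
      by rewrite int_iterD; move/stabP: sk => ->.
    have := degree_psi_shift sk dmy'; rewrite addNr; congr degree.
    apply/funext => t; rewrite -mulrA -upowD //; congr (psi y' t (_ * upow u _)); ring.
  elim: r {Hr} => [|m r IH]; first by apply: filterS filterT => y' _ m.
  apply: filterS2 (good m) IH => y' h1 h2 m'.
  by rewrite inE => /orP[/eqP ->|]; [exact: h1|exact: h2].
by apply: filterS => y' h; have [m mr my] := Hr y'; exact: h mr my.
Qed.

End degrees.

(** * From an isomorphism of crossed products to a cocycle *)

Definition orbit_cocycle (X : topologicalType) (s s' : homeo X X)
    (c : X -> int -> int) : Prop :=
  [/\ forall x k, int_iter s' (c x k) x = int_iter s k x,
      forall x k l, c x (k + l) = c x k + c (int_iter s k x) l &
      forall k x, \forall y \near x, c y k = c x k].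

Definition cocycle_equivalent (X : topologicalType) (s s' : homeo X X) : Prop :=
  exists c c' : X -> int -> int,
    [/\ orbit_cocycle s s' c, orbit_cocycle s' s c',
        forall x j, c x (c' x j) = j & forall x k, c' x (c x k) = k].

Section transfer.
Variables (R : realType) (X : topologicalType) (s s' : homeo X X).
Local Notation K := R[i].
Local Notation CX := (contfun K X).
Hypothesis Xc : compact [set: X].
Hypothesis Xh : hausdorff_space X.
Variables (A : cstarAlgType K) (i : CX -> A) (u u' : A).
Hypothesis HA : is_crossed_product s i u.
Hypothesis HA' : is_crossed_product s' i u'.

Let iu : covariant s i u := HA.1.
Let uu : unitary u. Proof. by case: iu. Qed.
Local Notation psi' := (psi Xc HA').
Local Notation psi := (psi Xc HA).

Lemma psi'_upow_mul y t (p : nat) theta : stab s y p -> psi' y t (upow u p) = circ theta ->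
  forall q : int, psi' y t (upow u (q * p%:Z)) = circ (q%:~R * theta).
Proof.
move=> sp h.
have step b : psi' y t (upow u p * b) = circ theta * psi' y t b.
  rewrite -h; apply: (psiM Xc Xh HA' _ _ (normalizes_upow HA p)).
  exact/stabP/stabN.
elim/int_ind => [|n IH|n IH]; first by rewrite !mul0r upow0 circ0 psi1.
  by rewrite intS mulrDl mul1r upowD // step IH -circD intrD mulrDl mul1r.
have := step (upow u (- n.+1%:Z * p%:Z)); rewrite -upowD //.
rewrite (_ : p%:Z + _ = - n%:Z * p%:Z); last by rewrite intS; ring.
rewrite IH => /(congr1 (fun z => circ (- theta) * z)).
rewrite mulrA -!circD addNr circ0 mul1r => <-; congr circ.
by rewrite intS opprD intrD mulrDl mulN1r.
Qed.

(** Over a point of period [p] for [s], a character of the isotropy is determined by its value at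
    [u^p]; an argument [theta] of this value corresponds to the parameter [theta / p]. *)
Lemma psi'E y t (p : nat) theta : (0 < p)%N -> (forall n, stab s y n = (p%:Z %| n)%Z) ->
  psi' y t (upow u p) = circ theta -> psi' y t =1 psi y (theta / p%:R).
Proof.
move=> p0 sp h; apply: (functional_ext1 Xc HA (psiF Xc HA' y t) (psiF Xc HA _ _)) => f n.
rewrite psi_imul psi_mono [RHS]mulrC; congr (_ * _).
have [sn|sn] := boolP (stab s y n).
  have := sn; rewrite sp => /dvdzP[q ->].
  rewrite (psi'_upow_mul _ h) ?sp // mul1r /circz; congr circ.
  by rewrite intrM -pmulrn -mulrA; congr (_ * _); rewrite mulrCA divff ?mulr1 // pnatr_eq0 -lt0n.
rewrite mul0r; apply/eqP; apply: contraR sn => /(psi_normalizer Xh (normalizes_upow HA n)).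
by move=> /stabP/stabN; rewrite opprK.
Qed.

(* If [y] has period [p] for [s], the loop over [s'] is the loop over [s],
   reparametrized by an argument of [psi' y t (u ^ p)] divided by [p]; the
   loop over [s] has a [1/p]-periodic lift when its degree is 0. *)
Lemma degree0_transfer d rho y : normalizes i d rho -> rho y = y ->
  degree (fun t => psi y t d) 0 -> degree (fun t => psi' y t d) 0.
Proof.
move=> dn dy d0; have [p sp] := stab_period s y.
have [p0|p0] := posnP p.
  rewrite p0 in sp.
  rewrite (_ : (fun t => _) = fun=> psi' y 0 d).
    by apply: degree_cst; exact: (psi_unimodular Xc Xh HA' _ dn dy).
  apply/funext => t.
  apply: (functional_ext1 Xc HA (psiF Xc HA' y t) (psiF Xc HA' _ _)) => f n.
  rewrite !psi_imul; congr (_ * _).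
  have [sn|sn] := boolP (stab s y n).
    by move: sn; rewrite sp dvd0z => /eqP ->; rewrite !upow0 !psi1.
  have z t1 : psi' y t1 (upow u n) = 0; last by rewrite !z.
  apply/eqP; apply: contraR sn => /(psi_normalizer Xh (normalizes_upow HA n)).
  by move=> /stabP/stabN; rewrite opprK.
have sp' : stab s y p by rewrite sp.
have pn := normalizes_upow HA p.
have py : int_iter s (- p%:Z) y = y by exact/stabP/stabN.
have [c [b [bc bn bE]]] := degree_exists (psi_loop Xc Xh HA' pn py).
have [a [j [ac aE aj jp]]] := degree_periodic d0 p0 (psi_period Xc HA sp p0 d).
have j0 : j = 0 by move/esym/eqP: jp; rewrite mulf_eq0 => /orP[|/eqP//]; lia.
have am (m : int) t : a (t + m%:~R / p%:R) = a t.
  have am1 t1 : a (t1 + p%:R^-1) = a t1 by rewrite aj j0 addr0.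
  elim/int_ind: m t => [|m IH|m IH] t; first by rewrite mul0r addr0.
    by rewrite intS intrD mulrDl mul1r addrA IH am1.
  rewrite -(am1 (t + _)) -addrA intS opprD intrD mulrDl mulN1r.
  by rewrite addrAC addNr add0r IH.
exists (fun t => a (b t / p%:R)); split=> t.
- apply: (@continuous_comp _ _ _ (fun t => b t / p%:R) a); last exact: ac.
  by apply: cvgMl; exact: bc.
- by rewrite bn mulrDl am addr0.
- by rewrite (psi'E p0 sp (bE t)) aE.
Qed.

(** Write [w] as [(w u^-k) u^k]. The first factor fixes [y] and has degree 0 for [s], hence also for
    [s'], and degrees add. *)
Lemma deg_at_transfer w rho y k m : normalizes i w rho ->
  deg_at Xc HA w rho y k -> deg_at Xc HA' (upow u k) (int_iter s (- k)) y m ->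
  deg_at Xc HA' w rho y m.
Proof.
move=> wn [ky dk] km.
have dn := normalizes_upowr HA (- k) wn.
have dy := deg_at_fix ky.
have d0 := degree0_transfer dn dy dk.
have dd : deg_at Xc HA' (w * upow u (- k)) (int_iter s (- - k) \o rho) y 0.
  by split; [rewrite /= dy|rewrite upow0 mulr1].
have := deg_atM Xh dn (normalizes_upow HA k) dd _.
rewrite [X in deg_at _ _ _ _ X]/= dy => /(_ _ km); rewrite add0r -mulrA -upowD // addNr upow0 mulr1.
by move=> [h1 h2]; split=> //; rewrite h1 /= dy.
Qed.

End transfer.

Section crossed_product_cocycle.
Variables (R : realType) (X : topologicalType).
Local Notation K := R[i].
Local Notation CX := (contfun K X).
Hypothesis Xc : compact [set: X].
Hypothesis Xh : hausdorff_space X.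
Variables (A : cstarAlgType K) (i : CX -> A).

(** [upow u (- k)] sends [x] to [s^k x], so the number of steps of [s'] that do the same is minus
    its degree for [u']. *)
Lemma crossed_product_cocycle s s' u u' (HA : is_crossed_product s i u)
    (HA' : is_crossed_product s' i u') :
  exists2 c : X -> int -> int, orbit_cocycle s s' c &
    forall x k, deg_at Xc HA' (upow u (- k)) (int_iter s (- - k)) x (- c x k).
Proof.
have ex x k : exists n, deg_at Xc HA' (upow u (- k)) (int_iter s (- - k)) x (- n).
  have [n hn] := deg_at_exists Xc Xh HA' x (normalizes_upow HA (- k)).
  by exists (- n); rewrite (opprK n).
pose c x k := sval (cid (ex x k)).
have cE x k : deg_at Xc HA' (upow u (- k)) (int_iter s (- - k)) x (- c x k).
  by rewrite /c; case: cid.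
exists c => //; have uu : unitary u by case: HA => -[].
split=> [x k|x k l|k x].
- by have [h _] := cE x k; rewrite !opprK in h.
- have h := deg_atM Xh (normalizes_upow HA (- k)) (normalizes_upow HA (- l)) (cE x k) (cE _ l).
  rewrite /= opprK -upowD // -opprD in h.
  have h' : deg_at Xc HA' (upow u (- (k + l))) (int_iter s (- - (k + l))) x
     (- (c x k + c (int_iter s k x) l)).
    rewrite (opprD (c x k)); rewrite !opprK in h *; case: h => h1 h2; split=> //.
    by rewrite h1 /= addrC int_iterD.
  by apply: oppr_inj; exact: deg_at_uniq (cE _ _) h'.
- apply: filterS (deg_at_near Xh (normalizes_upow HA (- k)) (cE x k)) => y h.
  by apply: oppr_inj; exact: deg_at_uniq (cE _ _) h.
Qed.

(** By [deg_at_transfer], passing from a power of [u'] to its degree for [u], and back, returns the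
    degree of that power for [u'] itself. *)
Lemma crossed_products_cocycle_equivalent s s' u u' :
  is_crossed_product s i u -> is_crossed_product s' i u' ->
  cocycle_equivalent s s'.
Proof.
move=> HA HA'.
have [c cc cE] := crossed_product_cocycle HA HA'.
have [c' cc' cE'] := crossed_product_cocycle HA' HA.
exists c, c'; split=> // x j.
- have := deg_at_transfer Xh (normalizes_upow HA' (- j)) (cE' x j) (cE _ _).
  move=> /deg_at_uniq/(_ (deg_at_upow _ _ _ _))/oppr_inj; exact.
- have := deg_at_transfer Xh (normalizes_upow HA (- j)) (cE x j) (cE' _ _).
  move=> /deg_at_uniq/(_ (deg_at_upow _ _ _ _))/oppr_inj; exact.
Qed.

End crossed_product_cocycle.

(** * Duality between morphisms of function algebras and continuous maps *)

Section spectrum.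
Variables (R : realType) (X Y : topologicalType).
Local Notation K := R[i].
Local Notation CX := (contfun K X).
Local Notation CY := (contfun K Y).
Hypothesis Xc : compact [set: X].
Hypothesis Xh : hausdorff_space X.
Variables (T : CX -> CY).
Hypothesis TP : star_morphism T.

Let T0 : T 0 = 0. Proof. by rewrite -(scale0r 0) (star_morphZ TP) scale0r. Qed.

(* if no point represents [f |-> T f y], finitely many squares [|f - T f y|^2]
   add up to an invertible function in the kernel of that character *)
Lemma character_point y : exists x, forall f, T f y = f x.
Proof.
apply: contrapT => h.
pose D := [set g : CX | (T g y : K) = 0 /\ forall x, 0 <= (g x : K)].
pose F (g : CX) := [set x | 0 < complex.Re (g x : K)].
have [[x0 _]|noX] := pselect (exists x : X, True); last first.
  have : T algone y = 0 :> K.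
    have -> : algone = 0 :> CX by apply: contfunP => x; exfalso; apply: noX; exists x.
    by rewrite T0 cf0.
  by rewrite (star_morph1 TP) cf1 => /eqP; rewrite oner_eq0.
have : finite_subset_cover D F [set: X].
  pose X' : ptopologicalType := HB.pack X (isPointed.Build X x0).
  have : @cover_compact X' [set: X'] by rewrite -compact_cover; exact: Xc.
  apply.
    move=> g _; have := @Re_cf_cts _ _ g => /continuousP/(_ _ (@open_gt _ _)).
    exact.
  move=> x _; have [f hf] : exists f : CX, T f y <> f x.
    by apply: contrapT => h'; apply: h; exists x => f; apply: contrapT => h''; apply: h'; exists f.
  pose k : K := T f y; pose g := f - k *: algone.
  have gE z : g z = f z - k :> K by rewrite cfD cfN cfZ cf1 mulr1.
  exists (algmul g (starop g)).
    split=> [|z].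
      rewrite (star_morphM TP) cfM.
      have -> : T g y = 0 :> K; last by rewrite mul0r.
      rewrite (star_morphD TP) -scaleN1r !(star_morphZ TP) (star_morph1 TP) cfD !cfZ cf1.
      by rewrite mulr1 mulN1r subrr.
    by rewrite cfM cfS mul_conjC_ge0.
  have : 0 < (algmul g (starop g)) x :> K.
    rewrite cfM cfS mul_conjC_gt0 gE subr_eq0; apply/eqP => e; exact: hf.
  by rewrite ltcE /= => /andP[].
move=> [D' D'D cov].
have [l [lu lD lcov]] : exists l : seq CX,
    [/\ uniq l, forall g, g \in l -> D g & forall x, exists2 g, g \in l & F g x].
  exists (finmap.enum_fset D'); split=> [|g gl|x]; first exact: finmap.fset_uniq.
    exact/set_mem/(D'D _ gl).
  by have [g gD gx] := cov x I; exists g.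
pose G : CX := \sum_(g <- l) g.
have GE x : G x = \sum_(g <- l) (g x : K) :> K by exact: cf_sum.
have G0 x : G x != 0 :> K.
  have [g gD gx] := lcov x.
  have g0 (f : CX) : f \in l -> 0 <= (f x : K).
    by move=> /lD[_]; apply.
  have gx0 : 0 < (g x : K).
    rewrite lt_neqAle g0 // andbT; apply/eqP => e.
    by move: gx; rewrite /F /= -e ltxx.
  apply: lt0r_neq0; rewrite GE (bigD1_seq g) //=.
  rewrite ltr_wpDr // big_seq_cond; apply: sumr_ge0 => f /andP[fD _]; exact: g0.
have Gc : continuous (fun x => ((G x : K)^-1 : K^o)).
  by move=> x; exact: (@cvgV K X (nbhs x) _ G (G x) (G0 x) (@cts_cf _ _ G x)).
have e : algmul (mk_contfun Gc) G = algone.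
  by apply: contfunP => x; rewrite cfM cf1 /= mulVf.
have : T algone y = 0 :> K.
  rewrite -e (star_morphM TP) cfM; apply/eqP; rewrite mulf_eq0; apply/orP; right.
  rewrite /G (big_morph T (star_morphD TP) T0) cf_sum big_seq big1 // => g gD.
  by have [] := lD _ gD.
by rewrite (star_morph1 TP) cf1 => /eqP; rewrite oner_eq0.
Qed.

(** For continuity at [y], take [f] equal to 1 at [k y] and 0 off the given neighbourhood: where
    [T f] is within 1/2 of 1, the image under [k] cannot leave it. *)
Lemma dual_map : exists2 k : Y -> X, continuous k & forall f y, T f y = f (k y).
Proof.
pose k y := sval (cid (character_point y)).
have kE f y : T f y = f (k y) by rewrite /k; case: cid.
exists k => // y U; rewrite /= nbhsE => -[V [Vo Vy] VU].
have [f [f0 f1]] := @bump_function R X Xc Xh (~` V) (k y) (open_closedC Vo) (fun h => h Vy).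
have /cvg_cabs/(_ 2^-1) := @cts_cf _ _ (T f) y.
rewrite invr_gt0 => /(_ (ltr0n _ _)); rewrite nbhs_filterE; apply: filterS => z.
rewrite !kE f1 => hz; apply: VU; apply: contrapT => /f0 e.
by move: hz; rewrite e subr0 cabs1; lra.
Qed.

End spectrum.

(** * Transport along a homeomorphism *)

Section transport.
Variables (X Y : topologicalType) (h : homeo X Y) (t : homeo Y Y).

Definition homeo_comp (Z : topologicalType) (g : homeo Y Z) : homeo X Z.
Proof.
apply: (@Homeo _ _ (g \o h) (homeo_inv h \o homeo_inv g)).
- by move=> x; rewrite /= !homeo_funK.
- by move=> z; rewrite /= !homeo_invK.
- by move=> x; apply: continuous_comp; exact: homeo_fun_cts.
- by move=> z; apply: continuous_comp; exact: homeo_inv_cts.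
Defined.

End transport.

(** The map [h^-1 t h], as [homeo_comp] applies its first argument first. *)
Definition homeo_conj (X Y : topologicalType) (h : homeo X Y) (t : homeo Y Y) : homeo X X :=
  homeo_comp h (homeo_comp t (homeo_sym h)).

Section transport_crossed_product.
Variables (K : numClosedFieldType) (X Y : topologicalType) (h : homeo X Y) (t : homeo Y Y).
Variables (A B : cstarAlgType K) (j : contfun K Y -> B) (v : B).
Variables (Psi : B -> A) (Phi : A -> B).
Hypotheses (PsiP : star_morphism Psi) (PhiK : cancel Psi Phi) (PsiK : cancel Phi Psi).

Lemma star_morphism_inv : star_morphism Phi.
Proof.
have inj := can_inj PhiK.
split=> [a b|k a|a b||a]; apply: inj.
- by rewrite (star_morphD PsiP) !PsiK.
- by rewrite (star_morphZ PsiP) !PsiK.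
- by rewrite (star_morphM PsiP) !PsiK.
- by rewrite (star_morph1 PsiP) !PsiK.
- by rewrite (star_morph_star PsiP) !PsiK.
Qed.

Lemma star_morphism_comp (A1 A2 A3 : starAlgType K) (f : A1 -> A2) (g : A2 -> A3) :
  star_morphism f -> star_morphism g -> star_morphism (g \o f).
Proof.
move=> fP gP; split=> [a b|k a|a b||a] /=.
- by rewrite (star_morphD fP) (star_morphD gP).
- by rewrite (star_morphZ fP) (star_morphZ gP).
- by rewrite (star_morphM fP) (star_morphM gP).
- by rewrite (star_morph1 fP) (star_morph1 gP).
- by rewrite (star_morph_star fP) (star_morph_star gP).
Qed.

Lemma contfun_pull_morphism (Z W : topologicalType) (g : homeo Z W) :
  star_morphism (fun f : contfun K W => contfun_pull f g).
Proof. by split=> [f f'|k f|f f'||f]; apply: contfunP. Qed.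

Lemma contfun_pullK (f : contfun K X) : contfun_pull (contfun_pull f (homeo_sym h)) h = f.
Proof. by apply: contfunP => x; rewrite -[LHS]/(f (homeo_inv h (h x))) homeo_funK. Qed.

Lemma contfun_pullKV (g : contfun K Y) : contfun_pull (contfun_pull g h) (homeo_sym h) = g.
Proof. by apply: contfunP => y; rewrite -[LHS]/(g (h (homeo_inv h y))) homeo_invK. Qed.

Lemma covariant_pull (C : starAlgType K) (j1 : contfun K X -> C) (v1 : C) :
  covariant (homeo_conj h t) j1 v1 ->
  covariant t (fun f => j1 (contfun_pull f h)) v1.
Proof.
move=> [j1P v1u c]; split=> //.
  exact: star_morphism_comp (contfun_pull_morphism h) j1P.
move=> f; rewrite c; congr j1; apply: contfunP => x.
by rewrite -[LHS]/(f (h (homeo_inv h (homeo_inv t (h x))))) homeo_invK.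
Qed.

(** Moves a crossed product over [Y] onto the algebra [A] and the space [X], so that it can be
    compared with another structure there. *)
Lemma is_crossed_product_transport : is_crossed_product t j v ->
  is_crossed_product (homeo_conj h t)
    (fun f => Psi (j (contfun_pull f (homeo_sym h)))) (Psi v).
Proof.
move=> [[jP [v1 v2] jv] U]; have PhiP := star_morphism_inv; split.
  split=> [||f].
  - apply: (@star_morphism_comp _ _ _ (fun f => j (contfun_pull f (homeo_sym h)))) => //.
    exact: star_morphism_comp (contfun_pull_morphism _) jP.
  - by split; rewrite -(star_morph_star PsiP) -(star_morphM PsiP) ?v1 ?v2 (star_morph1 PsiP).
  - rewrite -(star_morph_star PsiP) -!(star_morphM PsiP) jv; congr (Psi (j _)).
    apply: contfunP => y.
    rewrite -[RHS]/(f (homeo_inv h (homeo_inv t (h (homeo_inv h y))))).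
    by rewrite homeo_invK.
move=> C j1 v1' cov.
have [L [[LP Lj Lv] Lu]] := U _ _ _ (covariant_pull cov).
exists (L \o Phi); split.
  split.
  - exact: star_morphism_comp PhiP LP.
  - apply/funext => f /=; rewrite PhiK.
    rewrite -[L (j _)]/((L \o j) _) Lj; congr j1.
    exact: contfun_pullK.
  - by rewrite /= PhiK.
move=> N [NP Ni Nv]; have -> : L = N \o Psi.
  apply: Lu; split.
  - exact: star_morphism_comp PsiP NP.
  - apply/funext => g /=; rewrite -Ni /=; congr (N (Psi (j _))).
    by rewrite contfun_pullKV.
  - by [].
by apply/funext => a /=; rewrite PsiK.
Qed.

End transport_crossed_product.

(** The functional [coef] at [x] recovers [f x] from [i f]. *)
Lemma crossed_product_injective (R : realType) (X : topologicalType) (s : homeo X X)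
    (A : cstarAlgType R[i]) (i : contfun R[i] X -> A) (u : A) :
  compact [set: X] -> is_crossed_product s i u -> injective i.
Proof.
move=> Xc HA f g e; apply: contfunP => x.
have E k : coef Xc HA x (i k) = k x.
  by have := coef_mono Xc HA x k 0; rewrite upow0 mulr1 eqxx mul1r.
by rewrite -!E e.
Qed.

Lemma crossed_products_isomorphic_cocycle (R : realType) (X Y : topologicalType)
    (s : homeo X X) (t : homeo Y Y) :
  compact [set: X] -> hausdorff_space X -> compact [set: Y] -> hausdorff_space Y ->
  crossed_products_isomorphic R[i] s t ->
  exists h : homeo X Y, cocycle_equivalent s (homeo_conj h t).
Proof.
move=> Xc Xh Yc Yh [A [i [u [B [j [v [HA HB [Phi [PhiP [Psi PhiK PsiK] Phiij]]]]]]]]].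
have PsiP := star_morphism_inv PhiP PhiK PsiK.
have ii := crossed_product_injective Xc HA.
have ji := crossed_product_injective Yc HB.
have iP : star_morphism i by case: HA => -[].
have jP : star_morphism j by case: HB => -[].
have exT f : exists g, j g = Phi (i f).
  have : (Phi @` range i) (Phi (i f)) by exists (i f) => //; exists f.
  by rewrite Phiij => -[g _ <-]; exists g.
have exT' g : exists f, i f = Psi (j g).
  have : range j (j g) by exists g.
  by rewrite -Phiij => -[_ [f _ <-] <-]; exists f; rewrite PhiK.
pose T f := sval (cid (exT f)); pose T' g := sval (cid (exT' g)).
have TE f : j (T f) = Phi (i f) by rewrite /T; case: cid.
have TE' g : i (T' g) = Psi (j g) by rewrite /T'; case: cid.
have TP : star_morphism T.
  split=> [a b|k a|a b||a]; apply: ji; rewrite !TE.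
  - by rewrite (star_morphD iP) (star_morphD PhiP) (star_morphD jP) !TE.
  - by rewrite (star_morphZ iP) (star_morphZ PhiP) (star_morphZ jP) !TE.
  - by rewrite (star_morphM iP) (star_morphM PhiP) (star_morphM jP) !TE.
  - by rewrite (star_morph1 iP) (star_morph1 PhiP) (star_morph1 jP).
  - by rewrite (star_morph_star iP) (star_morph_star PhiP) (star_morph_star jP) !TE.
have TP' : star_morphism T'.
  split=> [a b|k a|a b||a]; apply: ii; rewrite !TE'.
  - by rewrite (star_morphD jP) (star_morphD PsiP) (star_morphD iP) !TE'.
  - by rewrite (star_morphZ jP) (star_morphZ PsiP) (star_morphZ iP) !TE'.
  - by rewrite (star_morphM jP) (star_morphM PsiP) (star_morphM iP) !TE'.
  - by rewrite (star_morph1 jP) (star_morph1 PsiP) (star_morph1 iP).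
  - by rewrite (star_morph_star jP) (star_morph_star PsiP) (star_morph_star iP) !TE'.
have TK f : T' (T f) = f by apply: ii; rewrite TE' TE PhiK.
have TK' g : T (T' g) = g by apply: ji; rewrite TE TE' PsiK.
have [k kc kE] := dual_map Xc Xh TP.
have [k' kc' kE'] := dual_map Yc Yh TP'.
have kk' : cancel k' k.
  by move=> x; apply: (points_separated (R := R) Xc Xh) => f; rewrite -kE -kE' TK.
have k'k : cancel k k'.
  by move=> y; apply: (points_separated (R := R) Yc Yh) => f; rewrite -kE' -kE TK'.
(* With this [h], the inclusion transported from [B] is [i] itself, so both structures share one
   function algebra. *)
pose h := Homeo kk' k'k kc' kc; exists h.
have := is_crossed_product_transport h PsiP PsiK PhiK HB.
rewrite (_ : (fun f => _) = i); last first.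
  apply/funext => f; rewrite -[RHS]PhiK -TE; congr (Psi (j _)).
  by apply: contfunP => y /=; rewrite kE.
exact: crossed_products_cocycle_equivalent HA.
Qed.

(** * From a cocycle to a conjugacy *)

Definition clopen_invariant (Y : topologicalType) (t : homeo Y Y) (P : set Y) : Prop :=
  [/\ open P, open (~` P) & forall y, P (t y) <-> P y].

Section twist.
Variables (Y : topologicalType) (t : homeo Y Y) (P : set Y).
Hypothesis HP : clopen_invariant t P.

Lemma clopen_invariant_inv y : P (homeo_inv t y) <-> P y.
Proof. by case: HP => _ _ /(_ (homeo_inv t y)); rewrite homeo_invK => h; split=> /h. Qed.

Lemma clopen_invariant_iter n y : P (int_iter t n y) <-> P y.
Proof.
case: HP => _ _ h.
elim/int_ind: n y => [|n IH|n IH] y //; first by rewrite intS int_iterS h.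
by rewrite intS opprD int_iterP clopen_invariant_inv.
Qed.

Definition glue (f g : Y -> Y) (y : Y) : Y := if `[< P y >] then f y else g y.

Lemma glue_in f g y : P y -> glue f g y = f y.
Proof. by rewrite /glue => Py; case: asboolP. Qed.

Lemma glue_out f g y : ~ P y -> glue f g y = g y.
Proof. by rewrite /glue => Py; case: asboolP. Qed.

Lemma glue_cts f g : continuous f -> continuous g -> continuous (glue f g).
Proof.
move=> fc gc y; have [Po Po' _] := HP; have [Py|Py] := pselect (P y).
  have e : \near y, f y = glue f g y.
    by apply: filterS (open_nbhs_nbhs (conj Po Py)) => z Pz; rewrite glue_in.
  rewrite /continuous_at (glue_in _ _ Py).
  exact: cvg_trans (near_eq_cvg e) (fc y).
have e : \near y, g y = glue f g y.
  by apply: filterS (open_nbhs_nbhs (conj Po' Py)) => z Pz; rewrite glue_out.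
rewrite /continuous_at (glue_out _ _ Py).
exact: cvg_trans (near_eq_cvg e) (gc y).
Qed.

Lemma glue_funK : cancel (glue t (homeo_inv t)) (glue (homeo_inv t) t).
Proof.
case: HP => _ _ h y; have [Py|Py] := pselect (P y).
  by rewrite [glue t _ _]glue_in // glue_in ?homeo_funK // h.
by rewrite [glue t _ _]glue_out // glue_out ?homeo_invK // clopen_invariant_inv.
Qed.

Lemma glue_invK : cancel (glue (homeo_inv t) t) (glue t (homeo_inv t)).
Proof.
case: HP => _ _ h y; have [Py|Py] := pselect (P y).
  by rewrite [glue _ t _]glue_in // glue_in ?homeo_invK // clopen_invariant_inv.
by rewrite [glue _ t _]glue_out // glue_out ?homeo_funK // h.
Qed.

Definition twist : homeo Y Y :=
  Homeo glue_funK glue_invK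
    (glue_cts (@homeo_fun_cts _ _ t) (@homeo_inv_cts _ _ t))
    (glue_cts (@homeo_inv_cts _ _ t) (@homeo_fun_cts _ _ t)).

Lemma twist_in y : P y -> twist y = t y. Proof. exact: glue_in. Qed.
Lemma twist_out y : ~ P y -> twist y = homeo_inv t y. Proof. exact: glue_out. Qed.
Lemma twist_inv_in y : P y -> homeo_inv twist y = homeo_inv t y. Proof. exact: glue_in. Qed.
Lemma twist_inv_out y : ~ P y -> homeo_inv twist y = t y. Proof. exact: glue_out. Qed.

Lemma twist_invariant y : P (twist y) <-> P y.
Proof.
have [_ _ h] := HP; have [Py|Py] := pselect (P y); first by rewrite twist_in.
by rewrite twist_out // clopen_invariant_inv.
Qed.

Lemma int_iter_twist_in n y : P y -> int_iter twist n y = int_iter t n y.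
Proof.
move=> Py; have h m : P (int_iter t m y) by apply/clopen_invariant_iter.
elim/int_ind: n => [|n IH|n IH] //; first by rewrite intS !int_iterS IH twist_in.
by rewrite intS opprD !int_iterP IH twist_inv_in.
Qed.

Lemma int_iter_twist_out n y : ~ P y -> int_iter twist n y = int_iter t (- n) y.
Proof.
move=> Py; have h m : ~ P (int_iter t m y) by move/clopen_invariant_iter.
elim/int_ind: n => [|n IH|n IH] //.
  by rewrite intS opprD int_iterS int_iterP IH twist_out.
rewrite [- - n.+1%:Z](_ : _ = 1 + - - n%:Z); last by lia.
by rewrite int_iterS -IH intS opprD int_iterP twist_inv_out // IH.
Qed.

End twist.

Definition twist_conjugate (X Y : topologicalType) (s : homeo X X) (t : homeo Y Y) : Prop :=
  exists (h : homeo X Y) (P : set Y) (HP : clopen_invariant t P),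
    forall x, h (s x) = twist HP (h x).

(** * Straightening a cocycle that preserves orientation *)

Section oriented_cocycle.
Variables (X : topologicalType) (s s' : homeo X X) (c c' : X -> int -> int).
Hypotheses (cc : orbit_cocycle s s' c) (cc' : orbit_cocycle s' s c').
Hypothesis ccK : forall x j, c x (c' x j) = j.
Hypothesis ccK' : forall x k, c' x (c x k) = k.
Variables (L M : nat).
Hypothesis c1M : forall x, `|c x 1| <= M%:Z.
Hypothesis cpos : forall x k, L%:Z <= k -> M%:Z <= c x k.
Hypothesis cneg : forall x k, k <= - L%:Z -> c x k < - M%:Z.
Hypothesis c'L : forall x j, `|j| <= M%:Z -> `|c' x j| < L%:Z.

(** For [|r| <= M] the window [[-L, L)] suffices: by [cpos] and [cneg], every [k] above it satisfies
    [r <= c x k] and none below it does. *)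
Definition tail_count x (r : int) : int := \sum_(k <- int_range L) (r <= c x k)%R%:Z.

(* [#{k < 0 | c x k >= 0} - #{k >= 0 | c x k < 0}]: how far [c x] is from
   mapping the nonnegative integers onto themselves. *)
Definition drift x : int := tail_count x 0 - L%:Z.

(** The value [r] is taken exactly once, at [c' x r], and [c'L] places this point in the window. *)
Lemma tail_count1 x r : `|r| <= M%:Z -> tail_count x r = tail_count x (r + 1) + 1.
Proof.
move=> rM; have k0 : c' x r \in int_range L by rewrite mem_int_range; have := c'L x rM; lia.
rewrite /tail_count (bigD1_seq (c' x r)) ?int_range_uniq //=.
rewrite [in RHS](bigD1_seq (c' x r)) ?int_range_uniq //= ccK lexx.
have -> : (r + 1 <= r) = false by lia.
rewrite /= add0r addrC; congr (_ + _); apply: eq_bigr => k kr.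
have : c x k != r by apply: contra kr => /eqP <-; rewrite ccK'.
by move=> ne; congr (nat_of_bool _)%:Z; lia.
Qed.

Lemma tail_count_shift x r : `|r| <= M%:Z -> tail_count x r = tail_count x 0 - r.
Proof.
have up (n : nat) : (n <= M)%N -> tail_count x n%:Z = tail_count x 0 - n%:Z.
  elim: n => [|n IH] nM; first by rewrite subr0.
  have e : tail_count x n%:Z = tail_count x (n%:Z + 1) + 1 by apply: tail_count1; lia.
  have := IH ltac:(lia); rewrite e (_ : n.+1%:Z = n%:Z + 1); lia.
have dn (n : nat) : (n <= M)%N -> tail_count x (- n%:Z) = tail_count x 0 + n%:Z.
  elim: n => [|n IH] nM; first by rewrite oppr0 addr0.
  rewrite tail_count1; last by lia.
  rewrite (_ : - n.+1%:Z + 1 = - n%:Z); last by lia.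
  rewrite IH; lia.
case: (lerP 0 r) => r0 rM.
  by rewrite -[r]gez0_abs // up //; lia.
have := dn `|r|%N ltac:(lia); rewrite (_ : - `|r|%N%:Z = r); lia.
Qed.

Lemma sum_int_range_shift (F : int -> int) (N : nat) :
  \sum_(k <- int_range N) F (k + 1) = \sum_(k <- int_range N) F k + F N%:Z - F (- N%:Z).
Proof.
rewrite !big_map -[N.*2]subn0 -/(index_iota 0 N.*2).
have h n : \sum_(0 <= k < n) F (k%:Z - N%:Z + 1) =
    \sum_(0 <= k < n) F (k%:Z - N%:Z) + F (n%:Z - N%:Z) - F (- N%:Z).
  elim: n => [|n IH]; first by rewrite !big_geq // sub0r add0r subrr.
  rewrite !big_nat_recr //= IH.
  have -> : n.+1%:Z - N%:Z = n%:Z - N%:Z + 1 by lia.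
  by ring.
by rewrite h (_ : N.*2%:Z - N%:Z = N%:Z) //; lia.
Qed.

(** Passing to [s x] shifts the window by one, which gains the term at [L], equal to 1, and loses
    the one at [-L], equal to 0. It also moves the threshold from 0 to [c x 1], which changes the
    count by [- c x 1]. *)
Lemma driftS x : drift (s x) = drift x - c x 1 + 1.
Proof.
case: cc => cE cD _.
have cs k : c (s x) k = c x (k + 1) - c x 1.
  by rewrite [k + 1]addrC cD int_iter1; lia.
rewrite /drift /tail_count.
rewrite (eq_bigr (fun k => (c x 1 <= c x (k + 1))%R%:Z)); last first.
  by move=> k _; rewrite cs subr_ge0.
rewrite (sum_int_range_shift (fun k => (c x 1 <= c x k)%R%:Z)).
have h1 := c1M x.
have -> : (c x 1 <= c x L) = true by have := cpos x (lexx L%:Z); lia.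
have -> : (c x 1 <= c x (- L%:Z)) = false by have := cneg x (lexx (- L%:Z)); lia.
rewrite -/(tail_count x (c x 1)) -/(tail_count x 0) tail_count_shift //=; lia.
Qed.

Lemma drift_iter x m : drift (int_iter s m x) = drift x - c x m + m.
Proof.
case: cc => cE cD _.
have c0 : c x 0 = 0 by have := cD x 0 0; rewrite addr0 /=; lia.
elim/int_ind: m => [|m IH|m IH]; first by rewrite c0 subr0 addr0.
  by rewrite intS int_iterS driftS IH addrC [1 + _]addrC cD; lia.
have := driftS (int_iter s (- m.+1%:Z) x).
rewrite -int_iterS (_ : 1 + - m.+1%:Z = - m%:Z); last by lia.
have := cD x (- m.+1%:Z) 1; rewrite (_ : - m.+1%:Z + 1 = - m%:Z); last by lia.
rewrite IH; lia.
Qed.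

(** The drift involves finitely many values [c x k], each locally constant in [x]. *)
Lemma drift_near x : \forall y \near x, drift y = drift x.
Proof.
case: cc => _ _ loc.
have : \forall y \near x, forall k, k \in int_range L -> c y k = c x k.
  elim: (int_range L) => [|k r IH]; first by apply: filterS filterT.
  apply: filterS2 (loc k x) IH => y h1 h2 k'.
  by rewrite inE => /orP[/eqP ->//|]; exact: h2.
apply: filterS => y h; rewrite /drift /tail_count; congr (_ - _).
by apply: eq_big_seq => k /h ->.
Qed.

Lemma drift_iter_cts (f : homeo X X) (g : int -> int) :
  continuous (fun x => int_iter f (g (drift x)) x).
Proof.
move=> x; have e : \near x, int_iter f (g (drift x)) x = int_iter f (g (drift x)) x.
  by apply: filterE.
have e' : \forall y \near x, int_iter f (g (drift x)) y = int_iter f (g (drift y)) y.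
  by apply: filterS (drift_near x) => y ->.
exact: cvg_trans (near_eq_cvg e') (@int_iter_cts _ f (g (drift x)) x).
Qed.

(** Put [g x = s'^(drift x) x]. By [driftS], [g (s x)] is [s'] to the power [drift x - c x 1 + 1],
    applied to [s x = s'^(c x 1) x], that is, [s' (g x)]. The inverse [x |-> s^(- drift x) x] comes
    from [drift_iter]. *)
Lemma oriented_cocycle_conjugate : exists g : homeo X X,
  (forall x, g (s x) = s' (g x)) /\ forall x, exists n, g x = int_iter s' n x.
Proof.
have [cE cD cl] := cc; have [cE' _ _] := cc'.
pose g x := int_iter s' (drift x) x; pose g' x := int_iter s (- drift x) x.
have gK : cancel g g'.
  move=> x; rewrite /g' /g -{2}(cE' x) -{1}(cE' x) drift_iter ccK.
  by rewrite subrr add0r int_iterK.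
have g'K : cancel g' g.
  move=> x; rewrite /g /g' drift_iter -(cE x) -int_iterD.
  rewrite (_ : _ + _ = 0) //; lia.
have gc : continuous g by exact: (@drift_iter_cts s' id).
have g'c : continuous g' by exact: (@drift_iter_cts s -%R).
exists (Homeo gK g'K gc g'c); split=> x /=; last by exists (drift x).
rewrite /g driftS -int_iterS -[s x]int_iter1 -(cE x) -int_iterD; congr int_iter; lia.
Qed.

End oriented_cocycle.

(** * Orientation of a cocycle on a compact space *)

Section orientation.
Variables (R : realType) (X : topologicalType) (Xc : compact [set: X]).
Variables (s s' : homeo X X).

Lemma locally_constant_bounded (f : X -> int) :
  (forall x, \forall y \near x, f y = f x) -> exists M : nat, forall x, `|f x| <= M%:Z.
Proof.
move=> fl; have fc : continuous (fun x => `|f x|%:~R : R).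
  move=> x; have e : \forall y \near x, (fun=> `|f x|%:~R : R) y = `|f y|%:~R.
    by apply: filterS (fl x) => y ->.
  exact: cvg_trans (near_eq_cvg e) (@cvg_cst _ _ _ _ _).
have [M M0 HM] := compact_real_bounded Xc fc.
exists (Num.truncn M).+1 => x; rewrite -(ler_int R).
apply: le_trans (HM x) _; apply/ltW; exact: truncnS_gt.
Qed.

Lemma cocycle_lipschitz (f g : homeo X X) c : orbit_cocycle f g c -> forall M : nat,
  (forall x, `|c x 1| <= M%:Z) -> forall x k, `|c x k| <= M%:Z * `|k|.
Proof.
move=> [_ cD _] M h x.
have c0 y : c y 0 = 0 by have := cD y 0 0; rewrite addr0 /=; lia.
elim/int_ind => [|m IH|m IH]; first by rewrite c0; lia.
  have := cD x m 1; have := h (int_iter f m x); rewrite (_ : m%:Z + 1 = m.+1%:Z); last by lia.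
  lia.
have := cD x (- m.+1%:Z) 1; have := h (int_iter f (- m.+1%:Z) x).
rewrite (_ : - m.+1%:Z + 1 = - m%:Z); last by lia.
lia.
Qed.

Lemma same_sign (a b m : int) : m < `|a| -> m < `|b| -> `|a - b| <= m -> (0 < b) = (0 < a).
Proof. by move=> h1 h2 h3; case: (ltrP 0 a) => ha; case: (ltrP 0 b) => hb //; lia. Qed.

Lemma cocycle_equivalent_twist : cocycle_equivalent s s' -> twist_conjugate s s'.
Proof.
move=> [c [c' [cc cc' ccK ccK']]].
have [cE cD cl] := cc; have [cE' cD' cl'] := cc'.
have [M1 HM1] := locally_constant_bounded (cl 1).
have [M2 HM2] := locally_constant_bounded (cl' 1).
pose M := (maxn M1 M2).+1.
have c1M x : `|c x 1| <= M%:Z by have := HM1 x; lia.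
have c1M' x : `|c' x 1| <= M%:Z by have := HM2 x; lia.
have lip := cocycle_lipschitz cc c1M; have lip' := cocycle_lipschitz cc' c1M'.
(* The increments of [c'] are at most [M], so [|k| = |c' x (c x k)|] is at most [M |c x k|]; thus
   [|k| > M^2] forces [|c x k| > M]. *)
pose L := (M * M).+1.
have big x k : L%:Z <= `|k| -> M%:Z < `|c x k|.
  move=> kL; have := lip' x (c x k); rewrite ccK'; rewrite /L in kL; nia.
have step x k : `|c x (k + 1) - c x k| <= M%:Z.
  by have := c1M (int_iter s k x); rewrite cD; lia.
(* Beyond [L] the cocycle jumps by at most [M] between values larger than [M] in modulus, so it
   cannot change sign. *)
have up x (n : nat) : (0 < c x L) = (0 < c x (L%:Z + n%:Z)).
  elim: n => [|n ->]; first by rewrite addr0.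
  rewrite (_ : L%:Z + n.+1%:Z = L%:Z + n%:Z + 1); last by lia.
  exact: same_sign (big x (L%:Z + n%:Z + 1) ltac:(lia)) (big x (L%:Z + n%:Z) ltac:(lia)) (step _ _).
have dn x (n : nat) : (0 < c x (- L%:Z)) = (0 < c x (- L%:Z - n%:Z)).
  elim: n => [|n ->]; first by rewrite subr0.
  have := step x (- L%:Z - n.+1%:Z).
  rewrite (_ : - L%:Z - n.+1%:Z + 1 = - L%:Z - n%:Z); last by lia.
  have := big x (- L%:Z - n%:Z) ltac:(lia); have := big x (- L%:Z - n.+1%:Z) ltac:(lia).
  lia.
have up' x k : L%:Z <= k -> (0 < c x k) = (0 < c x L).
  by move=> kL; rewrite (up x (absz (k - L%:Z))) (_ : L%:Z + _ = k) //; lia.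
have dn' x k : k <= - L%:Z -> (0 < c x k) = (0 < c x (- L%:Z)).
  by move=> kL; rewrite (dn x (absz (k + L%:Z))) (_ : - L%:Z - _ = k) //; lia.
(* A value of modulus [M L + 1] is not taken for [|k| <= L], hence is taken on one of the two tails.
   As both signs must occur, the tails have opposite signs. *)
have far x : (0 < c x (- L%:Z)) = ~~ (0 < c x L).
  have key (j : int) : `|j| = M%:Z * L%:Z + 1 -> exists k, c x k = j /\ (L%:Z <= k \/ k <= - L%:Z).
    move=> jE; exists (c' x j); rewrite ccK; split=> //.
    have := lip x (c' x j); rewrite ccK jE; nia.
  apply/idP/idP => [h|h].
    apply/negP => h'.
    have [k [ck [kL|kL]]] := key (- (M%:Z * L%:Z + 1)) ltac:(lia).
      by have := up' x k kL; rewrite ck h'; lia.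
    by have := dn' x k kL; rewrite ck h; lia.
  have [k [ck [kL|kL]]] := key (M%:Z * L%:Z + 1) ltac:(lia).
    by have := up' x k kL; rewrite ck; lia.
  by have := dn' x k kL; rewrite ck; lia.
pose P := [set x | 0 < c x L].
have Ps x : P (s x) <-> P x.
  rewrite /P /=.
  have e : c (s x) L = c x (1 + L%:Z) - c x 1 by rewrite cD int_iter1; lia.
  have h1 := big x (1 + L%:Z) ltac:(lia); have h2 := c1M x.
  have h3 := up' x (1 + L%:Z) ltac:(lia).
  by rewrite e; lia.
have Pn x n : P (int_iter s n x) <-> P x.
  elim/int_ind: n => [|n IH|n IH] //; first by rewrite intS int_iterS Ps.
  by rewrite -Ps -int_iterS (_ : 1 + _ = - n%:Z) //; lia.
have Ps' x : P (s' x) <-> P x.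
  by rewrite -[s' x]int_iter1 -(cE' x) Pn.
have Po : open P.
  by rewrite openE => x Px; apply: filterS (cl L x) => y /= e; rewrite /P /= e.
have Po' : open (~` P).
  by rewrite openE => x Px; apply: filterS (cl L x) => y /= e; rewrite /P /= e.
have HP : clopen_invariant s' P by split.
pose sg x : int := if `[< P x >] then 1 else -1.
have sgin x : P x -> sg x = 1 by rewrite /sg; case: asboolP.
have sgout x : ~ P x -> sg x = -1 by rewrite /sg; case: asboolP.
have sgE x : sg x = 1 /\ P x \/ sg x = -1 /\ ~ P x.
  by have [h|h] := pselect (P x); [left; rewrite sgin|right; rewrite sgout].
have sgn x y : (P x <-> P y) -> sg x = sg y.
  by case: (sgE x) => -[-> hx]; case: (sgE y) => -[-> hy] // h; exfalso; tauto.
(* Reversing the sign off [P] turns [c] into a cocycle for the twisted map that is oriented on all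
   of [X]. *)
pose e x k := sg x * c x k; pose e' x j := c' x (sg x * j).
have it x n : int_iter (twist HP) (sg x * n) x = int_iter s' n x.
  case: (sgE x) => -[-> hx]; first by rewrite mul1r int_iter_twist_in.
  by rewrite mulN1r int_iter_twist_out // opprK.
have sgsg x : sg x * sg x = 1 by case: (sgE x) => -[-> _].
have it' x n : int_iter (twist HP) n x = int_iter s' (sg x * n) x.
  by rewrite -(it x) mulrA sgsg mul1r.
have sgl x : \forall y \near x, sg y = sg x.
  by apply: filterS (cl L x) => y ey; apply: sgn; rewrite /P /= ey.
have ee : orbit_cocycle s (twist HP) e.
  split=> [x k|x k l|k x].
  - by rewrite /e it.
  - by rewrite /e cD (sgn _ _ (Pn x k)) mulrDr.
  - by apply: filterS2 (sgl x) (cl k x) => y; rewrite /e => -> ->.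
have ee' : orbit_cocycle (twist HP) s e'.
  split=> [x k|x k l|k x].
  - by rewrite /e' cE' it'.
  - rewrite /e' mulrDr cD' it'; congr (_ + c' _ (_ * _)).
    by apply: sgn; rewrite clopen_invariant_iter.
  - by apply: filterS2 (sgl x) (cl' (sg x * k) x) => y; rewrite /e' => -> ->.
have eK x j : e x (e' x j) = j by rewrite /e /e' ccK mulrA sgsg mul1r.
have eK' x k : e' x (e x k) = k by rewrite /e /e' mulrA sgsg mul1r ccK'.
have e1 x : `|e x 1| <= M%:Z.
  by have := c1M x; rewrite /e; case: (sgE x) => -[-> _]; lia.
have epos x k : L%:Z <= k -> M%:Z <= e x k.
  move=> kL; have := big x k ltac:(lia); have := up' x k kL; rewrite /e.
  by case: (sgE x) => -[-> +]; rewrite /P /=; lia.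
have eneg x k : k <= - L%:Z -> e x k < - M%:Z.
  move=> kL; have := big x k ltac:(lia); have := dn' x k kL; rewrite far /e.
  by case: (sgE x) => -[-> +]; rewrite /P /=; lia.
have e'L x j : `|j| <= M%:Z -> `|e' x j| < L%:Z.
  move=> jM; have := lip' x (sg x * j); rewrite /e' /L.
  have -> : `|sg x * j| = `|j| by case: (sgE x) => -[-> _]; lia.
  nia.
have [g [gE _]] := oriented_cocycle_conjugate ee ee' eK eK' e1 epos eneg e'L.
by exists g, P, HP.
Qed.

End orientation.

(** * Groupoids *)

Lemma int_iter_sub (X : topologicalType) (s : homeo X X) (n m : nat) (x y : X) :
  iter n s x = iter m s y <-> int_iter s (n%:Z - m%:Z) x = y.
Proof.
have e : int_iter s (n%:Z - m%:Z) x = int_iter s (- m%:Z) (iter n s x).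
  by rewrite addrC int_iterD.
rewrite e; split=> [->|<-]; first exact: (int_iterK s m).
by rewrite -[RHS]/(int_iter s m _) int_iterKN.
Qed.

Section groupoid_arrows.
Variables (X : topologicalType) (s : homeo X X).
Local Notation G := (DRgroupoid s).
Implicit Types (g : G) (x : X) (k : int).

Lemma dr_srcE g : dr_src g = int_iter s (dr_deg g) (dr_rng g).
Proof. by have [n [m [-> /int_iter_sub]]] := dr_axiom g. Qed.

Lemma dr_eq g g' : dr_rng g = dr_rng g' -> dr_deg g = dr_deg g' -> g = g'.
Proof.
move=> er ed; have es : dr_src g = dr_src g' by rewrite !dr_srcE er ed.
case: g g' er ed es => [x p y a] [x' p' y' a'] /= er ed es; subst x' p' y'.
by congr DRarrow; exact: Prop_irrelevance.
Qed.

Fact arrow_subproof x k : exists n m : nat,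
  k = n%:Z - m%:Z /\ iter n s x = iter m s (int_iter s k x).
Proof.
have [n [m e]] : exists n m : nat, k = n%:Z - m%:Z.
  case: k => n; first by exists n, 0%N; rewrite subr0.
  by exists 0%N, n.+1; rewrite sub0r NegzE.
by exists n, m; split=> //; apply/int_iter_sub; rewrite -e.
Qed.

(** Together with [dr_eq], the identification of the groupoid with the transformation groupoid: an
    arrow is a range and a degree. *)
Definition arrow x k : G := DRarrow (arrow_subproof x k).

Lemma dr_open (U : set G) g : open U -> U g ->
  exists b, [/\ dr_index b, dr_basic b g & dr_basic b `<=` U].
Proof.
move=> [D DD <-] [b Db bg]; exists b; split=> //; first exact: DD.
by move=> g' bg'; exists b.
Qed.

Lemma dr_nbhs (U : set G) g : (exists b, [/\ dr_index b, dr_basic b g & dr_basic b `<=` U]) ->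
  nbhs g U.
Proof.
move=> [b [bi bg bU]]; rewrite nbhsE; exists (dr_basic b) => //; split=> //.
by exists [set b] => [_ ->//|]; rewrite bigcup_set1.
Qed.

Lemma arrow_cts k : continuous (arrow^~ k : X -> G).
Proof.
move=> x U; rewrite /= nbhsE => -[V [Vo Vx] VU].
have [[[A B] [n m]] [[/= Ao Bo] [/= Ax Bx dx ex] bV]] := dr_open Vo Vx.
have hA : nbhs x A by apply: open_nbhs_nbhs.
have hB : \forall y \near x, B (int_iter s k y).
  by apply: int_iter_cts; apply: open_nbhs_nbhs.
apply: filterS2 hA hB => y Ay By; apply/VU/bV; split=> //=.
by apply/int_iter_sub; rewrite -dx.
Qed.

Lemma rng_cts : continuous (@dr_rng X s).
Proof.
move=> g U; rewrite /= nbhsE => -[V [Vo Vx] VU]; apply: dr_nbhs.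
have [n [m [dg eg]]] := dr_axiom g.
exists (V, setT, (n, m)); split; first by split=> //; exact: openT.
  by split.
by move=> g' [/= Vg' _ _ _]; exact: VU.
Qed.

Lemma deg_near g : \forall g' \near g, dr_deg g' = dr_deg g.
Proof.
apply: dr_nbhs; have [n [m [dg eg]]] := dr_axiom g.
exists (setT, setT, (n, m)); split; first by split; exact: openT.
  by split.
by move=> g' [_ _ /= -> _].
Qed.

End groupoid_arrows.

Lemma arrow_map_cts (T : topologicalType) (Y : topologicalType) (t : homeo Y Y)
    (f : T -> Y) (d : T -> int) :
  continuous f -> (forall x, \forall y \near x, d y = d x) ->
  continuous (fun x => arrow t (f x) (d x)).
Proof.
move=> fc dl x.
have e : \forall y \near x, arrow t (f y) (d x) = arrow t (f y) (d y).
  by apply: filterS (dl x) => y ->.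
apply: cvg_trans (near_eq_cvg e) _.
by apply: (@continuous_comp _ _ _ f (fun y => arrow t y (d x))); [exact: fc|exact: arrow_cts].
Qed.

Section groupoid_morphism.
Variables (X Y : topologicalType) (s : homeo X X) (t : homeo Y Y).
Variable F : DRgroupoid s -> DRgroupoid t.
Hypothesis Fc : continuous F.
Hypothesis Fcomp : forall g g', dr_src g = dr_rng g' -> dr_src (F g) = dr_rng (F g').
Hypothesis Fdeg : forall g g' (e : dr_src g = dr_rng g'),
  dr_deg (F (dr_mul e)) = dr_deg (F g) + dr_deg (F g').

Definition base_map (x : X) : Y := dr_rng (F (arrow s x 0)).
Definition base_cocycle (x : X) (k : int) : int := dr_deg (F (arrow s x k)).

(** A unit is idempotent, so the degree [d] of its image satisfies [d = d + d]. *)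
Lemma base_unit x : F (arrow s x 0) = arrow t (base_map x) 0.
Proof.
apply: dr_eq => //=; have e : dr_src (arrow s x 0) = dr_rng (arrow s x 0) by [].
have := Fdeg e; rewrite (_ : dr_mul e = arrow s x 0); last exact: dr_eq.
lia.
Qed.

Lemma base_rng g : dr_rng (F g) = base_map (dr_rng g).
Proof.
have := @Fcomp (arrow s (dr_rng g) 0) g erefl.
by rewrite base_unit dr_srcE /= => <-.
Qed.

Lemma base_src g : dr_src (F g) = base_map (dr_src g).
Proof. exact: (@Fcomp g (arrow s (dr_src g) 0)). Qed.

Lemma base_arrow x k : F (arrow s x k) = arrow t (base_map x) (base_cocycle x k).
Proof. by apply: dr_eq => //; rewrite base_rng. Qed.

Lemma base_map_cts : continuous base_map.
Proof.
move=> x; apply: (@continuous_comp _ _ _ (fun x => F (arrow s x 0)) (@dr_rng Y t)).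
  by apply: (@continuous_comp _ _ _ (arrow s ^~ 0) F); [exact: arrow_cts|exact: Fc].
exact: rng_cts.
Qed.

Lemma base_cocycle_iter x k : int_iter t (base_cocycle x k) (base_map x) = base_map (int_iter s k x).
Proof. by have := base_src (arrow s x k); rewrite dr_srcE base_rng. Qed.

Lemma base_cocycleD x k l :
  base_cocycle x (k + l) = base_cocycle x k + base_cocycle (int_iter s k x) l.
Proof.
have e : dr_src (arrow s x k) = dr_rng (arrow s (int_iter s k x) l) by [].
by rewrite -(Fdeg e); congr (dr_deg (F _)); exact: dr_eq.
Qed.

Lemma base_cocycle_near k x : \forall y \near x, base_cocycle y k = base_cocycle x k.
Proof.
have c : {for x, continuous (fun x => F (arrow s x k))}.
  by apply: (@continuous_comp _ _ _ (arrow s ^~ k) F); [exact: arrow_cts|exact: Fc].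
exact: c _ (deg_near _).
Qed.

End groupoid_morphism.

Lemma int_iter_conj (X Y : topologicalType) (h : homeo X Y) (t : homeo Y Y) n x :
  int_iter (homeo_conj h t) n x = homeo_inv h (int_iter t n (h x)).
Proof.
elim/int_ind: n => [|n IH|n IH]; first by rewrite /= homeo_funK.
  by rewrite intS !int_iterS IH /= homeo_invK.
by rewrite intS opprD !int_iterP IH /= homeo_invK.
Qed.

Lemma groupoid_isomorphic_cocycle (X Y : topologicalType) (s : homeo X X) (t : homeo Y Y) :
  DRgroupoid_isomorphic s t ->
  exists h : homeo X Y, cocycle_equivalent s (homeo_conj h t).
Proof.
move=> [phi [comp [mul _]]].
have Fcomp g g' : dr_src g = dr_rng g' -> dr_src (phi g) = dr_rng (phi g').
  by move/comp.
have Fdeg g g' (e : dr_src g = dr_rng g') :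
    dr_deg (phi (dr_mul e)) = dr_deg (phi g) + dr_deg (phi g').
  by rewrite (mul _ _ e (Fcomp _ _ e)).
pose psi := homeo_inv phi.
have Gcomp g g' : dr_src g = dr_rng g' -> dr_src (psi g) = dr_rng (psi g').
  by move=> e; apply/comp; rewrite !homeo_invK.
have Gdeg g g' (e : dr_src g = dr_rng g') :
    dr_deg (psi (dr_mul e)) = dr_deg (psi g) + dr_deg (psi g').
  have e' := Gcomp _ _ e; suff -> : psi (dr_mul e) = dr_mul e' by [].
  apply: (can_inj (homeo_funK phi)); rewrite (mul _ _ _ (Fcomp _ _ e')) homeo_invK.
  by apply: dr_eq => /=; rewrite !homeo_invK.
pose f := base_map phi; pose k := base_map psi.
have fk : cancel f k.
  by move=> x; rewrite /k {1}/base_map -(base_unit Fdeg) /psi homeo_funK.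
have kf : cancel k f.
  by move=> y; rewrite /f {1}/base_map -(base_unit Gdeg) /psi homeo_invK.
pose h := Homeo fk kf (base_map_cts (@homeo_fun_cts _ _ phi)) (base_map_cts (@homeo_inv_cts _ _ phi)).
(* The inverse isomorphism has its cocycle on [Y]; reading it at [f x] brings it to [X]. *)
exists h, (base_cocycle phi), (fun x => base_cocycle psi (f x)); split.
- split=> [x j|x j l|j x].
  + by rewrite int_iter_conj /= base_cocycle_iter // fk.
  + exact: base_cocycleD.
  + exact: base_cocycle_near (@homeo_fun_cts _ _ phi) _ _.
- split=> [x j|x j l|j x].
  + have := base_cocycle_iter Gcomp Gdeg (f x) j; rewrite -/k fk => ->.
    by rewrite int_iter_conj.
  + rewrite base_cocycleD // int_iter_conj /= -/f kf //.
  + exact: (base_map_cts (@homeo_fun_cts _ _ phi)) _ (base_cocycle_near (@homeo_inv_cts _ _ phi) j (f x)).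
- move=> x j; have := base_arrow Gcomp Gdeg (f x) j; rewrite -/k fk => e.
  by rewrite /base_cocycle -e homeo_invK.
- move=> x j; have := base_arrow Fcomp Fdeg x j; rewrite -/f => e.
  by rewrite {1}/base_cocycle -e /psi homeo_funK.
Qed.

Section twist_groupoid.
Variables (X Y : topologicalType) (s : homeo X X) (t : homeo Y Y).
Variables (h : homeo X Y) (P : set Y) (HP : clopen_invariant t P).
Hypothesis hst : forall x, h (s x) = twist HP (h x).

Let hs n x : h (int_iter s n x) = int_iter (twist HP) n (h x).
Proof.
elim/int_ind: n => [|n IH|n IH] //; first by rewrite intS !int_iterS hst IH.
rewrite intS opprD !int_iterP -IH; apply: (can_inj (homeo_funK (twist HP))).
by rewrite homeo_invK -hst homeo_invK.
Qed.

Definition side (y : Y) : int := if `[< P y >] then 1 else -1.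

Let sideE y : side y = 1 /\ P y \/ side y = -1 /\ ~ P y.
Proof. by rewrite /side; case: asboolP; [left|right]. Qed.

Let side2 y : side y * side y = 1.
Proof. by case: (sideE y) => -[-> _]. Qed.

Let side_iff y z : (P y <-> P z) -> side y = side z.
Proof. by case: (sideE y) => -[-> hx]; case: (sideE z) => -[-> hy] // e; exfalso; tauto. Qed.

Let side_near y : \forall z \near y, side z = side y.
Proof.
have [Po Po' _] := HP; case: (sideE y) => -[_ Py].
  by apply: filterS (open_nbhs_nbhs (conj Po Py)) => z Pz; apply: side_iff.
by apply: filterS (open_nbhs_nbhs (conj Po' Py)) => z Pz; apply: side_iff.
Qed.

Let iter_side n y : int_iter (twist HP) n y = int_iter t (side y * n) y.
Proof.
case: (sideE y) => -[-> Py]; first by rewrite mul1r int_iter_twist_in.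
by rewrite mulN1r int_iter_twist_out.
Qed.

Let side_iter n y : side (int_iter t n y) = side y.
Proof. by apply: side_iff; rewrite clopen_invariant_iter. Qed.

Let F (g : DRgroupoid s) : DRgroupoid t :=
  arrow t (h (dr_rng g)) (side (h (dr_rng g)) * dr_deg g).

Let G (g : DRgroupoid t) : DRgroupoid s :=
  arrow s (homeo_inv h (dr_rng g)) (side (dr_rng g) * dr_deg g).

Let FK : cancel F G.
Proof.
by move=> g; apply: dr_eq; rewrite /= ?homeo_funK // mulrA side2 mul1r.
Qed.

Let GK : cancel G F.
Proof.
by move=> g; apply: dr_eq; rewrite /= ?homeo_invK // mulrA side2 mul1r.
Qed.

Let hr_cts : continuous (fun g : DRgroupoid s => h (dr_rng g)).
Proof.
move=> g; apply: (@continuous_comp _ _ _ (@dr_rng X s) h); first exact: rng_cts.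
exact: homeo_fun_cts.
Qed.

Let Fcts : continuous F.
Proof.
apply: arrow_map_cts => // g.
have e : \forall g' \near g, side (h (dr_rng g')) = side (h (dr_rng g)).
  exact: hr_cts (side_near _).
by apply: filterS2 e (deg_near g) => g' -> ->.
Qed.

Let Gcts : continuous G.
Proof.
apply: arrow_map_cts => [g|g].
  apply: (@continuous_comp _ _ _ (@dr_rng Y t) (homeo_inv h)); first exact: rng_cts.
  exact: homeo_inv_cts.
have e : \forall g' \near g, side (dr_rng g') = side (dr_rng g).
  exact: rng_cts (side_near _).
by apply: filterS2 e (deg_near g) => g' -> ->.
Qed.

Let Fsrc g : dr_src (F g) = h (dr_src g).
Proof. by rewrite /F dr_srcE /= -iter_side -hs dr_srcE. Qed.

Lemma twist_groupoid_isomorphic : DRgroupoid_isomorphic s t.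
Proof.
exists (Homeo FK GK Fcts Gcts); split=> [g g'|]; last split=> [g g' e e'|g].
- change (dr_src g = dr_rng g' <-> dr_src (F g) = h (dr_rng g')).
  by rewrite Fsrc; split=> [->//|/(can_inj (homeo_funK h))].
- apply: dr_eq => //=; rewrite mulrDr; congr (_ + _ * _).
  by rewrite -e dr_srcE hs iter_side side_iter.
- apply: dr_eq; first by rewrite -[RHS]/(dr_src (F g)) Fsrc.
  by rewrite /= mulrN dr_srcE hs iter_side side_iter.
Qed.

End twist_groupoid.

(** * Decompositions *)

Section piecewise.
Variables (X Y : topologicalType).

Lemma set_val_cts (A : set X) : continuous (val : set_type A -> X).
Proof. exact: initial_continuous. Qed.

Lemma glue_set_types (A B : set X) (f : set_type A -> Y) (g : set_type B -> Y) :
  open A -> open B -> A `|` B = setT -> A `&` B = set0 ->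
  continuous f -> continuous g ->
  exists k : X -> Y, [/\ continuous k, forall a, k (val a) = f a & forall b, k (val b) = g b].
Proof.
move=> Ao Bo AB AB0 fc gc.
have cover x : ~ x \in A -> x \in B.
  move=> xA; apply/mem_set; have : (A `|` B) x by rewrite AB.
  by case=> // /mem_set.
pose k x := match pselect (x \in A) with
  | left p => f (exist _ x p)
  | right p => g (exist _ x (cover x p)) end.
have kA a : k (val a) = f a.
  rewrite /k; case: pselect => p; first by congr f; exact: val_inj.
  by exfalso; apply: p; exact: valP.
have kB b : k (val b) = g b.
  rewrite /k; case: pselect => p; last by congr g; exact: val_inj.
  exfalso; have : (A `&` B) (val b) by split; apply/set_mem => //; exact: valP.
  by rewrite AB0.
exists k; split=> // x.
have near_val (C : set X) (q : set_type C -> Y) (c : set_type C) : open C -> continuous q ->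
    (forall c, k (val c) = q c) -> x = val c -> k @ x --> k x.
  move=> Co qc kq xc U; rewrite xc kq => /(qc c) -[V [[W Wo <-] /= Wc] WU].
  have Cx : C (val c) by apply/set_mem/valP.
  apply: filterS2 (open_nbhs_nbhs (conj Wo Wc)) (open_nbhs_nbhs (conj Co Cx)) => z Wz Cz.
  have /= := WU (exist _ z (mem_set Cz)) Wz.
  by rewrite -kq.
have [xA|/cover xB] := pselect (x \in A).
  exact: (near_val A f (exist _ x xA)).
exact: (near_val B g (exist _ x xB)).
Qed.

Fact restrict_subproof (A : set X) (B : set Y) (h : X -> Y) :
  (forall x, x \in A -> h x \in B) -> continuous h ->
  forall hA : forall a : set_type A, h (val a) \in B,
  continuous (fun a : set_type A => exist _ (h (val a)) (hA a) : set_type B).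
Proof.
move=> _ hc hA; apply: (@continuous_comp_initial _ _ _ (val : set_type B -> Y)).
move=> a; apply: (@continuous_comp _ _ _ (val : set_type A -> X) h); first exact: set_val_cts.
exact: hc.
Qed.

End piecewise.

Section decompositions.
Variables (X Y : topologicalType) (s : homeo X X) (t : homeo Y Y).

Lemma invariant_iff (A : set Y) : invariant t A -> forall y, A (t y) <-> A y.
Proof.
move=> iA y; split=> [|Ay]; last by rewrite -iA; exists y.
by rewrite -{1}iA => -[z Az /(can_inj (homeo_funK t)) <-].
Qed.

Lemma iff_invariant (Z : topologicalType) (f : homeo Z Z) (A : set Z) :
  (forall z, A (f z) <-> A z) -> invariant f A.
Proof.
move=> fA; apply/seteqP; split=> [_ [z Az <-]|z Az]; first by apply/fA.
by exists (homeo_inv f z); [apply/fA; rewrite homeo_invK|rewrite homeo_invK].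
Qed.

(** The two conjugacies are pasted along the open pieces, and [Y1] plays the role of the clopen
    invariant set. *)
Lemma piecewise_twist : piecewise_flip_conjugate s t -> twist_conjugate s t.
Proof.
move=> [X1 [X2 [Y1 [Y2 [sX1 [sX2 [tY1 [tY2 [[oX1 oX2 X12 X0]]]]]]]]]].
move=> [[oY1 oY2 Y12 Y0] [[h1 h1E] [h2 h2E]]].
have valc (A : set X) (B : set Y) (h : homeo (set_type A) (set_type B)) :
    continuous (fun a => val (h a)).
  move=> a; apply: (@continuous_comp _ _ _ h val); first exact: homeo_fun_cts.
  exact: set_val_cts.
have valc' (A : set X) (B : set Y) (h : homeo (set_type A) (set_type B)) :
    continuous (fun b => val (homeo_inv h b)).
  move=> a; apply: (@continuous_comp _ _ _ (homeo_inv h) val); first exact: homeo_inv_cts.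
  exact: set_val_cts.
have [k [kc k1 k2]] := glue_set_types oX1 oX2 X12 X0 (valc _ _ h1) (valc _ _ h2).
have [l [lc l1 l2]] := glue_set_types oY1 oY2 Y12 Y0 (valc' _ _ h1) (valc' _ _ h2).
have casesX x : (exists a : set_type X1, x = val a) \/ (exists b : set_type X2, x = val b).
  have : (X1 `|` X2) x by rewrite X12.
  by case=> /mem_set xA; [left|right]; exists (exist _ x xA).
have casesY y : (exists a : set_type Y1, y = val a) \/ (exists b : set_type Y2, y = val b).
  have : (Y1 `|` Y2) y by rewrite Y12.
  by case=> /mem_set xA; [left|right]; exists (exist _ y xA).
have kl : cancel k l.
  by move=> x; case: (casesX x) => -[a ->]; rewrite ?k1 ?l1 ?k2 ?l2 homeo_funK.
have lk : cancel l k.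
  by move=> y; case: (casesY y) => -[a ->]; rewrite ?l1 ?k1 ?l2 ?k2 homeo_invK.
have Y2E : Y2 = ~` Y1.
  apply/seteqP; split=> y yY; last first.
    have : (Y1 `|` Y2) y by rewrite Y12.
    by case.
  by move=> yY1; have : (Y1 `&` Y2) y by []; rewrite Y0.
have HP : clopen_invariant t Y1.
  by split=> //; [rewrite -Y2E|exact: invariant_iff].
exists (Homeo kl lk kc lc), Y1, HP => x.
rewrite -[LHS]/(k (s x)) -[RHS]/(twist HP (k x)).
case: (casesX x) => -[a ->].
  have -> : s (val a) = val (restriction (invariant_fun sX1) a) by [].
  rewrite !k1 twist_in; last by apply/set_mem/valP.
  by have /= -> := h1E a.
have -> : s (val a) = val (restriction (invariant_fun sX2) a) by [].
rewrite !k2 twist_out; last by have /set_mem := valP (h2 a); rewrite {1}Y2E.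
by have /= -> := h2E a.
Qed.

Lemma restrict_conjugate (A : set X) (B : set Y) (h : homeo X Y)
    (f : X -> X) (g : Y -> Y)
    (fA : forall x, x \in A -> f x \in A) (gB : forall y, y \in B -> g y \in B) :
  (forall x, A x <-> B (h x)) -> (forall x, A x -> h (f x) = g (h x)) ->
  conjugate (restriction fA) (restriction gB).
Proof.
move=> AB hfg.
have hA (a : set_type A) : h (val a) \in B by apply/mem_set/AB/set_mem/valP.
have hB (b : set_type B) : homeo_inv h (val b) \in A.
  by apply/mem_set/AB; rewrite homeo_invK; apply/set_mem/valP.
pose k (a : set_type A) : set_type B := exist _ (h (val a)) (hA a).
pose l (b : set_type B) : set_type A := exist _ (homeo_inv h (val b)) (hB b).
have kl : cancel k l by move=> a; apply: val_inj; rewrite /= homeo_funK.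
have lk : cancel l k by move=> b; apply: val_inj; rewrite /= homeo_invK.
have kc : continuous k.
  by apply: restrict_subproof (@homeo_fun_cts _ _ h) _ => x /set_mem/AB/mem_set.
have lc : continuous l.
  apply: restrict_subproof (@homeo_inv_cts _ _ h) _ => y /set_mem yB.
  by apply/mem_set/AB; rewrite homeo_invK.
exists (Homeo kl lk kc lc) => a; apply: val_inj => /=.
by apply: hfg; apply/set_mem/valP.
Qed.

Lemma twist_piecewise : twist_conjugate s t -> piecewise_flip_conjugate s t.
Proof.
move=> [h [P [HP hst]]]; have [Po Po' Pt] := HP.
have sX1 : invariant s (h @^-1` P).
  by apply: iff_invariant => x; rewrite /= hst twist_invariant.
have sX2 : invariant s (h @^-1` ~` P).
  by apply: iff_invariant => x; rewrite /= hst twist_invariant.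
have tY1 : invariant t P by exact: iff_invariant.
have tY2 : invariant t (~` P) by apply: iff_invariant => y; rewrite /= Pt.
have hc : continuous h by exact: homeo_fun_cts.
exists (h @^-1` P), (h @^-1` ~` P), P, (~` P), sX1, sX2, tY1, tY2; split.
  split.
  - by move/continuousP: hc; exact.
  - by move/continuousP: hc; exact.
  - by apply/seteqP; split=> // x _; exact: EM.
  - by apply/seteqP; split=> // x [].
split.
  split=> //; apply/seteqP; split=> // y; first by move=> _; exact: EM.
  by case.
split; apply: (restrict_conjugate (h := h)) => // x Px; rewrite hst.
  by rewrite twist_in.
by rewrite twist_out.
Qed.

Lemma flip_twist : flip_conjugate s t -> twist_conjugate s t.
Proof.
move=> [h [hst|hst]]; exists h.
  have HP : clopen_invariant t setT by split=> //; [exact: openT|rewrite setCT; exact: open0].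
  by exists setT, HP => x; rewrite twist_in // -[RHS]hst.
have HP : clopen_invariant t set0 by split=> //; [exact: open0|rewrite setC0; exact: openT].
by exists set0, HP => x; rewrite twist_out // -[RHS]hst.
Qed.

(** If [P] and its complement were both nonempty, transitivity would give an orbit passing from one
    to the other, against invariance; connectedness rules this out because [P] is clopen. *)
Lemma twist_flip : topologically_transitive t \/ connected [set: Y] ->
  twist_conjugate s t -> flip_conjugate s t.
Proof.
move=> tc [h [P [HP hst]]]; have [Po Po' Pt] := HP.
have [PT|P0] : P = setT \/ P = set0.
  case: tc => [trans|conn].
    case: (eqVneq P set0) => [->|/set0P P0]; [by right|left].
    apply: contrapT => /eqP; rewrite -setC0 -[P]setCK (inj_eq (can_inj setCK)) => /set0P P0'.
    have [n [y [[z Pz <-]]]] := trans _ _ Po Po' P0 P0'.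
    by apply; apply/(clopen_invariant_iter HP).
  case: (eqVneq P set0) => [->|/set0P P0]; [by right|left].
  apply: conn => //; first by exists P; rewrite ?setTI.
  by exists P; rewrite ?setTI // -[P]setCK; exact: open_closedC.
- by exists h; left => x /=; rewrite hst twist_in // PT.
- by exists h; right => x /=; rewrite hst twist_out // P0.
Qed.

End decompositions.

(** * Twisted crossed products *)

Section block_twist.
Variables (K : numClosedFieldType) (A : starAlgType K) (e : A).
Hypotheses (eS : starop e = e) (eM : e * e = e).

Definition block_twist (v : A) : A := e * v + (1 - e) * starop v.

(** Products are formed blockwise, because [e] and [1 - e] are orthogonal idempotents and commute
    with [a] and [b]. *)
Lemma block_mul (a b c d : A) : a * e = e * a -> b * e = e * b ->
  (e * a + (1 - e) * b) * (e * c + (1 - e) * d) = e * (a * c) + (1 - e) * (b * d).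
Proof.
move=> ae be; have e0 : e * (1 - e) = 0 by rewrite mulrBr mulr1 eM subrr.
have e0' : (1 - e) * e = 0 by rewrite mulrBl mul1r eM subrr.
have e2 : (1 - e) * (1 - e) = 1 - e by rewrite mulrBl e0 subr0 mul1r.
have be' : b * (1 - e) = (1 - e) * b by rewrite mulrBr mulrBl be mulr1 mul1r.
have ae' : a * (1 - e) = (1 - e) * a by rewrite mulrBr mulrBl ae mulr1 mul1r.
rewrite mulrDl !mulrDr -!mulrA (mulrA a e) ae (mulrA a (1 - e)) ae'.
rewrite (mulrA b e) be (mulrA b (1 - e)) be' -!mulrA.
rewrite (mulrA e e) eM (mulrA e (1 - e)) e0 (mulrA (1 - e) e) e0'.
by rewrite (mulrA (1 - e) (1 - e)) e2 !mul0r addr0 add0r.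
Qed.

Lemma block_star v : v * e = e * v -> starop (block_twist v) = e * starop v + (1 - e) * v.
Proof.
move=> ve; have vse : starop v * e = e * starop v.
  by rewrite -{1}eS -star_mul -ve star_mul eS.
rewrite /block_twist starD !star_mul staropK starB star1 eS vse.
by rewrite mulrBr mulrBl ve mulr1 mul1r.
Qed.

Lemma block_unitary v : v * e = e * v -> unitary v -> unitary (block_twist v).
Proof.
move=> ve [v1 v2]; have vse : starop v * e = e * starop v.
  by rewrite -{1}eS -star_mul -ve star_mul eS.
split; rewrite block_star //.
  by rewrite block_mul // v1 v2 -mulrDl addrCA subrr addr0 mulr1.
by rewrite block_mul // v1 v2 -mulrDl addrCA subrr addr0 mulr1.
Qed.

Lemma block_twistK v : v * e = e * v -> block_twist (block_twist v) = v.
Proof.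
move=> ve; rewrite {1}/block_twist block_star // /block_twist.
rewrite !mulrDr !mulrA eM.
have e0 : e * (1 - e) = 0 by rewrite mulrBr mulr1 eM subrr.
have e0' : (1 - e) * e = 0 by rewrite mulrBl mul1r eM subrr.
have e2 : (1 - e) * (1 - e) = 1 - e by rewrite mulrBl e0 subr0 mul1r.
by rewrite e0 e0' e2 !mul0r addr0 add0r -mulrDl addrCA subrr addr0 mul1r.
Qed.

End block_twist.

Section twisted_crossed_product.
Variables (K : numClosedFieldType) (Y : topologicalType).
Local Notation CY := (contfun K Y).

Lemma homeo_inv_ext (t t' : homeo Y Y) : t =1 t' -> homeo_inv t =1 homeo_inv t'.
Proof.
by move=> tt y; apply: (can_inj (homeo_funK t)); rewrite homeo_invK tt homeo_invK.
Qed.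

Lemma covariant_ext (t t' : homeo Y Y) (A : starAlgType K) (i : CY -> A) u :
  t =1 t' -> covariant t i u -> covariant t' i u.
Proof.
move=> tt [iP uu c]; split=> // f; rewrite c; congr i.
by apply: contfunP => y; rewrite -[LHS]/(f (homeo_inv t y)) (homeo_inv_ext tt).
Qed.

Lemma is_crossed_product_ext (t t' : homeo Y Y) (A : cstarAlgType K) (i : CY -> A) u :
  t =1 t' -> is_crossed_product t i u -> is_crossed_product t' i u.
Proof.
move=> tt [c U]; split; first exact: covariant_ext c.
by move=> B j v c'; apply: U; apply: covariant_ext c' => y; rewrite tt.
Qed.

Variables (t : homeo Y Y) (P : set Y).

Fact indicator_cts : open P -> open (~` P) ->
  continuous (fun y => (`[< P y >]%:R : K^o)).
Proof.
move=> Po Po' y; have [Py|Py] := pselect (P y).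
  have e : \near y, (1 : K^o) = `[< P y >]%:R.
    by apply: filterS (open_nbhs_nbhs (conj Po Py)) => z Pz; rewrite asboolT.
  rewrite /continuous_at asboolT //.
  exact: cvg_trans (near_eq_cvg e) (@cvg_cst _ _ _ _ _).
have e : \near y, (0 : K^o) = `[< P y >]%:R.
  by apply: filterS (open_nbhs_nbhs (conj Po' Py)) => z Pz; rewrite asboolF.
rewrite /continuous_at asboolF //.
exact: cvg_trans (near_eq_cvg e) (@cvg_cst _ _ _ _ _).
Qed.

Variable HP : clopen_invariant t P.

Definition indicator : CY :=
  mk_contfun (indicator_cts (let: And3 Po _ _ := HP in Po) (let: And3 _ Po _ := HP in Po)).

Lemma indicator_in y : P y -> indicator y = 1.
Proof. by move=> Py; rewrite -[LHS]/(`[< P y >]%:R) asboolT. Qed.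

Lemma indicator_out y : ~ P y -> indicator y = 0.
Proof. by move=> Py; rewrite -[LHS]/(`[< P y >]%:R) asboolF. Qed.

Section image.
Variables (A : starAlgType K) (i : CY -> A).
Hypothesis iP : star_morphism i.

Lemma indicator_star : starop (i indicator) = i indicator.
Proof.
rewrite -(star_morph_star iP); congr i; apply: contfunP => y; rewrite cfS.
by have [Py|Py] := pselect (P y); [rewrite indicator_in ?conjC1|rewrite indicator_out ?conjC0].
Qed.

Lemma indicator_idem : i indicator * i indicator = i indicator.
Proof.
rewrite -(star_morphM iP); congr i; apply: contfunP => y; rewrite cfM.
by have [Py|Py] := pselect (P y); [rewrite indicator_in ?mulr1|rewrite indicator_out ?mulr0].
Qed.

Lemma indicator_comm f : i f * i indicator = i indicator * i f.
Proof.
by rewrite -!(star_morphM iP); congr i; apply: contfunP => y; rewrite !cfM mulrC.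
Qed.

End image.

Lemma covariant_indicator_comm (A : starAlgType K) (i : CY -> A) v :
  covariant t i v -> v * i indicator = i indicator * v.
Proof.
move=> iv; rewrite (covariant1 iv); congr (i _ * _); apply: contfunP => y.
rewrite translateE; have [Py|Py] := pselect (P y).
  by rewrite !indicator_in //; apply/(clopen_invariant_iter HP).
by rewrite !indicator_out //; move/(clopen_invariant_iter HP).
Qed.

Lemma covariant_twist (A : starAlgType K) (i : CY -> A) v :
  covariant t i v -> covariant (twist HP) i (block_twist (i indicator) v).
Proof.
move=> iv; have [iP vu c] := iv; have [v1 v2] := vu.
have eS := indicator_star iP; have eM := indicator_idem iP.
have ve := covariant_indicator_comm iv.
split=> //; first exact: block_unitary.
move=> f; rewrite (block_star eS) //.
have vse : starop v * i indicator = i indicator * starop v.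
  by rewrite -{1}eS -star_mul -ve star_mul eS.
have fE : i f = i indicator * i f + (1 - i indicator) * i f.
  by rewrite -mulrDl addrCA subrr addr0 mul1r.
rewrite {1}fE /block_twist block_mul // block_mul //; last first.
- by rewrite -mulrA indicator_comm // mulrA vse mulrA.
- by rewrite -mulrA indicator_comm // mulrA ve mulrA.
rewrite c (covariantN1 iv) -mulrA v1 mulr1.
rewrite -(star_morph1 iP) -scaleN1r -(star_morphZ iP) -(star_morphD iP) -!(star_morphM iP) -(star_morphD iP).
congr i; apply: contfunP => y; rewrite cfD !cfM cfD cfZ cf1 mulN1r translateE.
have [Py|Py] := pselect (P y).
  rewrite indicator_in // mul1r subrr mul0r addr0.
  by rewrite -[RHS]/(f (homeo_inv (twist HP) y)) twist_inv_in.
rewrite indicator_out // mul0r add0r subr0 mul1r.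
by rewrite -[RHS]/(f (homeo_inv (twist HP) y)) twist_inv_out.
Qed.

Lemma twist_clopen_invariant : clopen_invariant (twist HP) P.
Proof. by have [Po Po' _] := HP; split=> // y; exact: twist_invariant. Qed.

End twisted_crossed_product.

Section twist_universal.
Variables (K : numClosedFieldType) (Y : topologicalType) (t : homeo Y Y) (P : set Y).
Variable HP : clopen_invariant t P.
Local Notation CY := (contfun K Y).

(** Twisting [twist HP] once more over the same set gives back [t]. *)
Lemma covariant_untwist (A : starAlgType K) (i : CY -> A) v :
  covariant (twist HP) i v -> covariant t i (block_twist (i (indicator K HP)) v).
Proof.
move=> iv; have := covariant_twist (twist_clopen_invariant HP) iv.
rewrite (_ : indicator K (twist_clopen_invariant HP) = indicator K HP); last exact: contfunP.
apply: covariant_ext => y; have [Py|Py] := pselect (P y).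
  by rewrite !twist_in.
by rewrite twist_out // twist_inv_out.
Qed.

(** Twisting the unitary is an involution that exchanges the covariant pairs of [t] and of
    [twist HP] and commutes with the morphisms concerned, so the universal property carries over. *)
Lemma is_crossed_product_twist (A : cstarAlgType K) (i : CY -> A) u :
  is_crossed_product t i u ->
  is_crossed_product (twist HP) i (block_twist (i (indicator K HP)) u).
Proof.
move=> [iu U]; split; first exact: covariant_twist.
move=> B j v jv; have jv' := covariant_untwist jv.
have [L [[LP Lj Lu] Lun]] := U _ _ _ jv'.
have iP : star_morphism i by case: iu.
have jP : star_morphism j by case: jv.
have blockL (N : A -> B) : star_morphism N -> N \o i = j ->
    forall a, N (block_twist (i (indicator K HP)) a) = block_twist (j (indicator K HP)) (N a).
  move=> NP <- a; rewrite /block_twist (star_morphD NP) !(star_morphM NP).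
  by rewrite (star_morphD NP) -scaleN1r (star_morphZ NP) scaleN1r (star_morph1 NP) (star_morph_star NP).
have vj : v * j (indicator K HP) = j (indicator K HP) * v.
  have := covariant_indicator_comm (twist_clopen_invariant HP) jv.
  by rewrite (_ : indicator K (twist_clopen_invariant HP) = indicator K HP); last exact: contfunP.
have ui := covariant_indicator_comm HP iu.
exists L; split.
  split=> //; rewrite blockL // Lu block_twistK //.
    exact: indicator_star.
  exact: indicator_idem.
move=> N [NP Nj Nu]; apply: Lun; split=> //.
rewrite -Nu -blockL // block_twistK //.
  exact: indicator_star.
exact: indicator_idem.
Qed.

End twist_universal.

(** Both crossed products live on one and the same algebra: only the unitary is twisted and the
    functions are relabelled along [h]. The isomorphism is the identity. *)
Lemma twist_crossed_products_isomorphic (R : realType) (X Y : topologicalType)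
    (s : homeo X X) (t : homeo Y Y) :
  compact [set: Y] -> twist_conjugate s t -> crossed_products_isomorphic R[i] s t.
Proof.
move=> Yc [h [P [HP hst]]].
have HB := cp_universal R t Yc.
set B := cp_alg R t Yc in HB; set j := cp_fun t Yc in HB; set v := cp_unit R t Yc in HB.
have idP : star_morphism (@id B) by [].
have HA := is_crossed_product_transport h idP (fun _ => erefl) (fun _ => erefl)
  (is_crossed_product_twist HP HB).
have sE : homeo_conj h (twist HP) =1 s.
  by move=> x; rewrite -[LHS]/(homeo_inv h (twist HP (h x))) -hst homeo_funK.
exists B, (fun f => j (contfun_pull f (homeo_sym h))), (block_twist (j (indicator R[i] HP)) v), B, j, v.
split; [exact: is_crossed_product_ext sE HA|exact: HB|].
exists id; split=> //; first by exists id.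
rewrite image_id; apply/seteqP; split=> [_ [f _ <-]|_ [g _ <-]].
  by exists (contfun_pull f (homeo_sym h)).
by exists (contfun_pull g h) => //; rewrite contfun_pullKV.
Qed.

(** * Return to the original homeomorphisms, and the equivalences *)

Lemma twist_conjugate_conj (X Y : topologicalType) (s : homeo X X) (t : homeo Y Y)
    (h : homeo X Y) : twist_conjugate s (homeo_conj h t) -> twist_conjugate s t.
Proof.
move=> [g [P [HP gst]]]; have [Po Po' Pt] := HP.
have hc : continuous (homeo_inv h) by exact: homeo_inv_cts.
have HQ : clopen_invariant t (homeo_inv h @^-1` P).
  split=> [||y].
  - by move/continuousP: hc; exact.
  - by move/continuousP: hc => /(_ _ Po').
  - have := Pt (homeo_inv h y); rewrite -[homeo_conj h t _]/(homeo_inv h (t (h (homeo_inv h y)))).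
    by rewrite homeo_invK.
exists (homeo_comp g h), _, HQ => x.
rewrite -[LHS]/(h (g (s x))) gst -[homeo_comp g h x]/(h (g x)).
have [Py|Py] := pselect (P (g x)).
  rewrite !twist_in //; last by rewrite /= homeo_funK.
  by rewrite -[homeo_conj h t _]/(homeo_inv h (t (h (g x)))) homeo_invK.
rewrite !twist_out //; last by rewrite /= homeo_funK.
by rewrite -[homeo_inv (homeo_conj h t) _]/(homeo_inv h (homeo_inv t (h (g x)))) homeo_invK.
Qed.

Theorem theorem9p1 (R : realType) (X Y : topologicalType)
    (X_compact : compact [set: X]) (X_hausdorff : hausdorff_space X)
    (X_second_countable : @second_countable X)
    (Y_compact : compact [set: Y]) (Y_hausdorff : hausdorff_space Y)
    (Y_second_countable : @second_countable Y)
    (sigma : homeo X X) (tau : homeo Y Y) :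
  (DRgroupoid_isomorphic sigma tau <->
     crossed_products_isomorphic R[i] sigma tau) /\
  (crossed_products_isomorphic R[i] sigma tau <->
     piecewise_flip_conjugate sigma tau) /\
  ((topologically_transitive sigma /\ topologically_transitive tau) \/
   (connected [set: X] /\ connected [set: Y]) ->
   ([/\ DRgroupoid_isomorphic sigma tau,
        crossed_products_isomorphic R[i] sigma tau &
        piecewise_flip_conjugate sigma tau] <->
    flip_conjugate sigma tau)).
Proof.
have g_tw : DRgroupoid_isomorphic sigma tau -> twist_conjugate sigma tau.
  move=> /groupoid_isomorphic_cocycle[h /(cocycle_equivalent_twist R X_compact)].
  exact: twist_conjugate_conj.
have c_tw : crossed_products_isomorphic R[i] sigma tau -> twist_conjugate sigma tau.
  move=> /(crossed_products_isomorphic_cocycle X_compact X_hausdorff Y_compact Y_hausdorff).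
  by move=> [h /(cocycle_equivalent_twist R X_compact)]; exact: twist_conjugate_conj.
have tw_g : twist_conjugate sigma tau -> DRgroupoid_isomorphic sigma tau.
  by move=> [h [P [HP hst]]]; exact: twist_groupoid_isomorphic hst.
have tw_c := @twist_crossed_products_isomorphic R X Y sigma tau Y_compact.
split; first by split=> [/g_tw|/c_tw].
split; first by split=> [/c_tw/twist_piecewise|/piecewise_twist].
move=> tc; split=> [[_ _ /piecewise_twist]|/flip_twist tw].
  by apply: twist_flip; case: tc => -[_]; [left|right].
by split; [exact: tw_g|exact: tw_c|exact: twist_piecewise].
Qed.
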